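(* Let $T>0$, let $\Omega=[0,1]$, let $\nu>0$ be a constant, and let $a\in W^{1,\infty}(\Omega)$. Let $K=K(t,x)\ge 0$ and $K'=\kappa K$ for some constant $\kappa>0$. Let $u_{obs}$ solve $$\partial_t u_{obs}-\nu\,\partial_{xx}u_{obs}+a(x)\,\partial_x u_{obs}=0,\qquad u_{obs}|_{x=0}=u_{obs}|_{x=1}=0,\qquad u_{obs}|_{t=0}=u_{obs}^0$$ on $[0,T]\times\Omega$. Consider the coupled forward-backward problem of finding a pair $(u,\tilde u)$ on $[0,T]\times\Omega$ with $$(F)\quad \partial_t u-\nu\,\partial_{xx}u+a(x)\,\partial_x u=-K(u-u_{obs}),\qquad u|_{x=0}=u|_{x=1}=0,\qquad u|_{t=0}=u_0,$$ $$(B)\quad \partial_t\tilde u-\nu\,\partial_{xx}\tilde u+a(x)\,\partial_x\tilde u=K'(\tilde u-u_{obs}),\qquad \tilde u|_{x=0}=\tilde u|_{x=1}=0,\qquad \tilde u|_{t=T}=u(T).$$ Set $w(t)=u(t)-u_{obs}(t)$ and $\tilde w(t)=\tilde u(t)-u_{obs}(t)$. Then: 1. If $K(t,x)=K$ is constant (so $K'=\kappa K$ is constant), then for all $t\in[0,T]$, $$\tilde w(t)=e^{(-K-K')(T-t)}\,w(t).$$ 2. If $K(t,x)=K(x)$ is independent of $t$, not identically zero, with $\mathrm{Support}(K)\subset[a_1,b_1]$ where $0\le a_1<b_1\le 1$ and ($a_1\neq 0$ or $b_1\neq 1$), then the problem $(F)$-$(B)$ is ill-posed: in general there does not exist a solution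 $(u,\tilde u)$, i.e. there exist data $u_0$, $u_{obs}^0$ for which no pair $(u,\tilde u)$ solves $(F)$-$(B)$. 3. If $K(t,x)=K\,\mathbf 1_{[t_1,t_2]}(t)$ with a constant $K>0$ and $0\le t_1<t_2\le T$ (so that $K'(t,x)=K'\,\mathbf 1_{[t_1,t_2]}(t)$ with the constant $K'=\kappa K$), then $$\tilde w(0)=e^{(-K-K')(t_2-t_1)}\,w(0).$$
   Context: The problem $(F)$-$(B)$ is one step of the ''back and forth nudging'' (BFN) algorithm: the forward equation $(F)$ is solved on $[0,T]$ from the initial condition $u_0$, and the backward equation $(B)$ is the same transport-diffusion equation (with the same signs for the diffusion and transport terms) required to hold on $[0,T]$ with the final condition $\tilde u(T)=u(T)$. A solution of the one-step BFN is a pair $(u,\tilde u)$ satisfying both $(F)$ and $(B)$. The function $K$ is the nudging gain and $\mathbf 1_I$ denotes the indicator function of the interval $I$. No specific function spaces for the data and the solutions are prescribed. *)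

(* Defs.v *)
From HB Require Import structures.
From mathcomp Require Import all_boot all_order all_algebra.
From mathcomp Require Import all_classical all_reals all_analysis.
Set Implicit Arguments.
Unset Strict Implicit.
Unset Printing Implicit Defensive.
Import Order.TTheory GRing.Theory Num.Theory.
Import numFieldNormedType.Exports.
Local Open Scope classical_set_scope.
Local Open Scope ring_scope.

(* Functions of x are total functions R -> R, of which only the restriction to
   Omega = [0, 1] matters; functions of (t, x) are curried, time first.  The
   solutions considered are the usual weak (energy) solutions, in
   C([0,T]; L^2(Omega)) /\ L^2(0,T; H^1_0(Omega)), so that rough initial data
   and gains K that are discontinuous in t or in x are allowed.  Identities
   between states u(t), v(t) are identities in L^2(Omega), i.e. they hold
   for almost every x. *)

Definition Omega (R : realType) : set R := `[0, 1]%classic.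
Arguments Omega {R}.

Definition cylinder (R : realType) (s t : R) :
    set (measurableTypeR R * measurableTypeR R) :=
  `[s, t]%classic `*` Omega.

Definition leb2 (R : realType) :
    {measure set (measurableTypeR R * measurableTypeR R) -> \bar R} :=
  (@lebesgue_measure R \x @lebesgue_measure R)%E.
Arguments leb2 {R}.

Definition inL2 (R : realType) (f : R -> R) : Prop :=
  measurable_fun Omega f /\
  (@lebesgue_measure R).-integrable Omega (fun x => (f x ^+ 2)%:E).

Definition inLinf (R : realType) (f : R -> R) : Prop :=
  measurable_fun Omega f /\
  exists M : R, {ae @lebesgue_measure R, forall x, Omega x -> `|f x| <= M}.

Definition test_function (R : realType) (phi : R -> R) : Prop :=
  (forall (n : nat) (x : R), derivable (derive1n n phi) x 1) /\
  exists c d : R, [/\ 0 < c, d < 1 & forall x, ~~ (c <= x <= d) -> phi x = 0].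

Definition weak_derivative (R : realType) (f g : R -> R) : Prop :=
  forall phi : R -> R, test_function phi ->
    \int[@lebesgue_measure R]_(x in Omega) (f x * derive1 phi x) =
    - \int[@lebesgue_measure R]_(x in Omega) (g x * phi x).

Definition inW1inf (R : realType) (a : R -> R) : Prop :=
  inLinf a /\ exists b : R -> R, inLinf b /\ weak_derivative a b.

(* f is in H^1_0(0, 1) with derivative g: f is the absolutely continuous
   representative, so the Dirichlet conditions are meant pointwise. *)
Definition inH10 (R : realType) (f g : R -> R) : Prop :=
  [/\ inL2 g,
      forall x, Omega x ->
        f x = f 0 + \int[@lebesgue_measure R]_(y in `[0, x]%classic) g y,
      f 0 = 0 & f 1 = 0].

(* Essential support in Omega; it does not depend on the representative. *)
Definition ess_support (R : realType) (f : R -> R) : set R :=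
  [set x | forall U : set R, nbhs x U ->
     ~ {ae @lebesgue_measure R, forall y, Omega y -> U y -> f y = 0}].

Definition L2_continuous (R : realType) (T : R) (u : R -> R -> R) : Prop :=
  (forall t, 0 <= t <= T -> inL2 (u t)) /\
  forall t0, 0 <= t0 <= T ->
    (fun t => \int[@lebesgue_measure R]_(x in Omega) ((u t x - u t0 x) ^+ 2))
      @ within `[0, T]%classic (nbhs t0) --> (0 : R).

(* Weak solutions on [0, T] x Omega of
     d_t u - nu d_xx u + a d_x u = f,   u = 0 at x = 0 and at x = 1,
   without any initial or final condition; p stands for d_x u.  The last
   clause is d/dt <u, psi> + nu <d_x u, psi'> + <a d_x u, psi> = <f, psi>
   integrated over [s, t]. *)
Definition dirichlet_solution (R : realType) (T nu : R) (a : R -> R)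
    (f u : R -> R -> R) : Prop :=
  [/\ measurable_fun (cylinder 0 T) (fun z => u z.1 z.2),
      L2_continuous T u &
      exists p : R -> R -> R,
      [/\ measurable_fun (cylinder 0 T) (fun z => p z.1 z.2),
          leb2.-integrable (cylinder 0 T)
            (fun z => (p z.1 z.2 ^+ 2)%:E),
          {ae @lebesgue_measure R, forall t, 0 <= t <= T -> inH10 (u t) (p t)} &
          forall psi psi' : R -> R, inH10 psi psi' ->
          forall s t : R, 0 <= s -> s <= t -> t <= T ->
            \int[@lebesgue_measure R]_(x in Omega) (u t x * psi x)
            - \int[@lebesgue_measure R]_(x in Omega) (u s x * psi x) =
            \int[leb2]_(z in cylinder s t)
              (- nu * p z.1 z.2 * psi' z.2 - a z.2 * p z.1 z.2 * psi z.2
               + f z.1 z.2 * psi z.2)]].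

Definition observation (R : realType) (T nu : R) (a : R -> R)
    (uobs0 : R -> R) (uobs : R -> R -> R) : Prop :=
  dirichlet_solution T nu a (fun _ _ => 0) uobs /\
  ae_eq (@lebesgue_measure R) Omega (uobs 0) uobs0.

Definition forward_problem (R : realType) (T nu : R) (a : R -> R)
    (K uobs : R -> R -> R) (u0 : R -> R) (u : R -> R -> R) : Prop :=
  dirichlet_solution T nu a (fun t x => - K t x * (u t x - uobs t x)) u /\
  ae_eq (@lebesgue_measure R) Omega (u 0) u0.

Definition backward_problem (R : realType) (T nu : R) (a : R -> R)
    (K' uobs : R -> R -> R) (uT : R -> R) (ut : R -> R -> R) : Prop :=
  dirichlet_solution T nu a (fun t x => K' t x * (ut t x - uobs t x)) ut /\
  ae_eq (@lebesgue_measure R) Omega (ut T) uT.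

Definition bfn_solution (R : realType) (T nu kappa : R) (a : R -> R)
    (K uobs : R -> R -> R) (u0 : R -> R) (u ut : R -> R -> R) : Prop :=
  forward_problem T nu a K uobs u0 u /\
  backward_problem T nu a (fun t x => kappa * K t x) uobs (u T) ut.

(* Main.v *)
Require Import Defs.
From HB Require Import structures.
From mathcomp Require Import all_boot all_order all_algebra.
From mathcomp Require Import all_classical all_reals all_analysis.
From mathcomp Require Import measurable_realfun.
From mathcomp Require Import ring lra.

(** The drift is removed by the weight [rho = exp (- int a / nu)]: as
[- nu u'' + a u' = - (nu / rho) (rho u')'], the operator is symmetric and
nonnegative for the product [<f, g> = int rho f g].  The differences
[w = u - uobs] and [wt = ut - uobs] satisfy [w' + A w = c w] with [c = - K] and
[c = kappa K] respectively.  Multiplying by [exp (- m t)] turns this into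
[v' + L v = 0] with the nonnegative symmetric operator [L = A + m - c].  Weak
solutions enter the argument only through this equation tested on the domain of
[L], which is described by fluxes ([weak_flux], [gauged_evolution]).

For such evolutions [<v t, w s>] depends only on [t + s] ([ip_symmetry]).  In
particular [<v t, v s>] is the square of the norm of [v] at the midpoint, from
which follow contraction and backward uniqueness: an evolution that vanishes at
its final time vanishes identically.  When the gain is constant on a time
interval, [c = - k] and [c = kappa k] are both removed completely by
multiplication by [exp (- c t)]; the two resulting evolutions of [A] are
proportional at the final time, hence at all times.  Applied once, or on the
three successive intervals before, during and after the action of the gain, this
gives the two identities ([constant_gain_comparison]).

For a gain [K (x)] that vanishes almost everywhere on an open interval, take
[uobs = 0] and suppose that a solution exists.  The operators [L1] and [L2] of
the forward and backward equations agree on functions supported in that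
interval, so for such [psi] all time derivatives of [<ut - u, psi>] vanish at
[T].  Evolutions are analytic in time, in the quantitative form of bounds on
finite differences ([diff_bound]), and Newton's formula shows that
[<ut - u, psi> = 0] at times close to [T] ([local_agreement]).  Let [psi] be the
indicator of an interval where [K] vanishes, [Psi] the solution of
[(L2 + 1) Psi = psi] and [Theta] that of [(L1 + 1) Theta = psi].  Then
[E = <ut, Psi> - <u, Theta>] satisfies [E' = E] close to [T].  Chebyshev
polynomials of the time translation are contractions on evolutions and arbitrarily
large on the exponential, so [E = 0], and at the time [T] this says that [u T] is
orthogonal to [Psi - Theta] ([obstruction]).

The initial state is chosen as [u0 = Psi - Theta].  The square of the norm of
[u (T / 2)] is [<u T, u 0> = 0] up to the factor due to [m], so [u0 = 0] by
backward uniqueness and [Psi = Theta].  Subtracting the two equations, [K Psi = 0]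
almost everywhere.  But [Psi] does not vanish outside the support of [psi]
([driven_nonvanishing]), so [K = 0] almost everywhere, a contradiction. *)

Set Implicit Arguments.
Unset Strict Implicit.
Unset Printing Implicit Defensive.
Import Order.TTheory GRing.Theory Num.Theory.
Import numFieldNormedType.Exports.
Local Open Scope classical_set_scope.
Local Open Scope ring_scope.

(** * Derivatives of real functions *)

Section OneVariable.
Context {R : realType}.
Implicit Types f df : R -> R.

(** The mean value theorem in the form used to compare increments with a fixed
slope [c]; [a] and [b] may come in either order. *)
Lemma mean_value_bound f df (c e a b : R) :
  (forall x : R, Num.min a b <= x <= Num.max a b -> is_derive x 1 f (df x)) ->
  (forall x : R, Num.min a b <= x <= Num.max a b -> `|df x - c| <= e) ->
  `|f b - f a - c * (b - a)| <= e * `|b - a|.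
Proof.
have key (p q : R) : p < q -> (forall x : R, p <= x <= q -> is_derive x 1 f (df x)) ->
    (forall x, p <= x <= q -> `|df x - c| <= e) ->
    `|f q - f p - c * (q - p)| <= e * `|q - p|.
  move=> pq dfP bnd.
  have fc : {within `[p, q], continuous f}.
    apply: derivable_within_continuous => x; rewrite in_itv /= => xpq.
    by have := dfP _ xpq; case.
  have dfP' x : x \in `]p, q[ -> is_derive x 1 f (df x).
    by rewrite in_itv /= => /andP[px xq]; apply: dfP; rewrite !ltW.
  have [x] := MVT pq dfP' fc; rewrite in_itv /= => /andP[px xq] ->.
  by rewrite -mulrBl normrM ler_wpM2r// bnd// !ltW.
case: (ltgtP a b) => [ab|ba|->] dfP bnd; first exact: key.
- rewrite -[X in `|X|]opprK normrN opprB (distrC b).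
  rewrite (_ : c * (b - a) - (f b - f a) = f a - f b - c * (a - b)); last by ring.
  exact: key.
- by rewrite !subrr mulr0 subrr normr0 mulr0.
Qed.

Lemma dist_between (p k x : R) : Num.min p (p + k) <= x <= Num.max p (p + k) -> `|x - p| <= `|k|.
Proof.
rewrite ge_min le_max => /andP[/orP[] x1 /orP[] x2];
rewrite ler_norml; have := ler_norm k; have := ler_norm (- k); rewrite normrN => *;
by apply/andP; split; lra.
Qed.

Lemma is_derive0_eps f (x : R) :
  (forall e, 0 < e -> exists2 d, 0 < d &
     forall h, `|h| < d -> `|f (x + h) - f x| <= e * `|h|) ->
  is_derive x 1 f 0.
Proof.
move=> H.
have lim0 : (fun h => h^-1 *: (f (h *: 1 + x) - f x)) @ 0^' --> (0 : R).
  apply/cvgrPdist_le => e e0; have [d d0 dP] := H _ e0.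
  near=> h.
  have h0 : h != 0 by near: h; exact: nbhs_dnbhs_neq.
  rewrite sub0r normrN normrZ normfV ler_pdivrMl ?normr_gt0// mulrC.
  rewrite (_ : h *: 1 + x = x + h); last by rewrite [h *: 1]mulr1 addrC.
  apply: dP.
  near: h; exact: dnbhs0_lt.
apply: DeriveDef; first by apply/cvg_ex; exists 0.
exact: cvg_lim lim0.
Unshelve. all: end_near. Qed.

Lemma constant_on_itv f (p q : R) :
  (forall x : R, p < x < q -> is_derive x 1 f 0) ->
  forall x y : R, p < x < q -> p < y < q -> f x = f y.
Proof.
move=> H x y /andP[px xq] /andP[py yq].
have : `|f x - f y - 0 * (x - y)| <= 0 * `|x - y|.
  apply: (@mean_value_bound f (fun=> 0)) => z /andP[z1 z2]; last by rewrite subrr normr0.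
  apply: H; rewrite (lt_le_trans _ z1) ?lt_min ?py ?px//=.
  by rewrite (le_lt_trans z2)// gt_max yq xq.
by rewrite !mul0r subr0 normr_le0 subr_eq0 => /eqP.
Qed.

Lemma is_derive_shift f (x c d : R) :
  is_derive (x + c) 1 f d -> is_derive x 1 (fun r => f (r + c)) d.
Proof.
move=> D.
have F : is_derive x 1 (fun r : R => r + c) 1.
  by have := is_deriveD (is_derive_id x (1:R)) (is_derive_cst c x (1:R)); rewrite addr0.
by have := @is_derive1_comp R f (fun r => r + c) x _ _ D F; rewrite mulr1.
Qed.

Lemma is_derive_eps f (x d : R) : is_derive x 1 f d ->
  forall e, 0 < e -> exists2 a, 0 < a &
    forall h, `|h| < a -> `|f (x + h) - f x - d * h| <= e * `|h|.
Proof.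
move=> [fx <-] e e0; rewrite /derive; set D := lim _.
have /cvgrPdist_le/(_ _ e0) := fx.
rewrite -/D => /nbhs_ballP[a /= a0 aP]; exists a => // h ha.
have [->|h0] := eqVneq h 0; first by rewrite addr0 subrr mulr0 subrr normr0 mulr0.
have := aP h; rewrite /ball/= sub0r normrN => /(_ ha h0).
have -> : h *: (1 : R) = h by exact: mulr1.
rewrite [h + x]addrC distrC => H.
rewrite -ler_pdivrMr ?normr_gt0// -normfV -normrM mulrBl.
by rewrite mulfK// [_ * h^-1]mulrC.
Qed.

End OneVariable.

(** * Semi-inner products and weak evolutions *)

Section SemiInner.
Context {R : realType} {X : lmodType R}.
Implicit Types (x y z : X) (a b : R).

(** Functions that agree almost everywhere are identified through the value 0 of
the seminorm [nrm] of their difference; this avoids a quotient space. *)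
Record semi_inner (ip : X -> X -> R) : Prop := SemiInner {
  ipC : forall x y, ip x y = ip y x;
  ipDl : forall x y z, ip (x + y) z = ip x z + ip y z;
  ipZl : forall a x y, ip (a *: x) y = a * ip x y;
  ip_ge0 : forall x, 0 <= ip x x }.

Variable ip : X -> X -> R.
Hypothesis ipP : semi_inner ip.

Definition nrm x := Num.sqrt (ip x x).

Lemma ipDr x y z : ip x (y + z) = ip x y + ip x z.
Proof. by rewrite ipC// ipDl// [ip y x]ipC// [ip z x]ipC. Qed.

Lemma ipZr a x y : ip x (a *: y) = a * ip x y.
Proof. by rewrite ipC// ipZl// ipC. Qed.

Lemma ipNl x y : ip (- x) y = - ip x y.
Proof. by rewrite -scaleN1r ipZl// mulN1r. Qed.

Lemma ipNr x y : ip x (- y) = - ip x y.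
Proof. by rewrite ipC// ipNl ipC. Qed.

Lemma ipBl x y z : ip (x - y) z = ip x z - ip y z.
Proof. by rewrite ipDl// ipNl. Qed.

Lemma ipBr x y z : ip x (y - z) = ip x y - ip x z.
Proof. by rewrite ipDr ipNr. Qed.

Lemma ip0l y : ip 0 y = 0.
Proof. by rewrite -(scale0r 0) ipZl// mul0r. Qed.

Lemma ip_suml (I : Type) (s : seq I) (P : pred I) (F : I -> X) y :
  ip (\sum_(i <- s | P i) F i) y = \sum_(i <- s | P i) ip (F i) y.
Proof. by apply: (big_morph (ip^~ y)) => [u v|]; rewrite ?ipDl// ip0l. Qed.

Lemma ip_sumr (I : Type) (s : seq I) (P : pred I) (F : I -> X) y :
  ip y (\sum_(i <- s | P i) F i) = \sum_(i <- s | P i) ip y (F i).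
Proof. by rewrite ipC// ip_suml; apply: eq_bigr => i _; rewrite ipC. Qed.

Lemma nrm_ge0 x : 0 <= nrm x. Proof. exact: sqrtr_ge0. Qed.

Lemma nrm_sqr x : nrm x ^+ 2 = ip x x.
Proof. by rewrite sqr_sqrtr// ip_ge0. Qed.

(** Nonnegativity of the quadratic form on [s x + t y] at a well chosen pair
[(s, t)]; when [ip y y = 0] the form is affine in the coefficient of [y] and
must be constant. *)
Lemma cauchy_schwarz x y : `|ip x y| <= nrm x * nrm y.
Proof.
rewrite -sqrtrM ?ip_ge0// -sqrtr_sqr ler_wsqrtr//.
have q s t : 0 <= s ^+ 2 * ip x x + 2 * s * t * ip x y + t ^+ 2 * ip y y.
  have := ip_ge0 ipP (s *: x + t *: y).
  by rewrite ipDl// !ipDr !(ipZl, ipZr)// (ipC ipP y x); congr (_ <= _); ring.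
have [c0|c0] := eqVneq (ip y y) 0.
  suff -> : ip x y = 0 by rewrite expr0n/= mulr_ge0// ip_ge0.
  apply/eqP/negPn/negP => b0.
  have := q 1 (- (ip x x + 1) / (2 * ip x y)).
  have -> : 1 ^+ 2 * ip x x + 2 * 1 * (- (ip x x + 1) / (2 * ip x y)) * ip x y
     + (- (ip x x + 1) / (2 * ip x y)) ^+ 2 * ip y y = -1.
    by rewrite c0; field.
  by rewrite oppr_ge0 ler10.
have cp : 0 < ip y y by rewrite lt_neqAle eq_sym c0 ip_ge0.
have := q (ip y y) (- ip x y).
have -> : ip y y ^+ 2 * ip x x + 2 * ip y y * - ip x y * ip x y + (- ip x y) ^+ 2 * ip y y
   = ip y y * (ip x x * ip y y - ip x y ^+ 2) by ring.
by rewrite pmulr_rge0// subr_ge0.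
Qed.

Lemma nrmD x y : nrm (x + y) <= nrm x + nrm y.
Proof.
rewrite -(@ler_pXn2r _ 2)// ?nnegrE ?addr_ge0 ?nrm_ge0// sqrrD !nrm_sqr.
rewrite ipDl// !ipDr (ipC ipP y x).
have := le_trans (ler_norm _) (cauchy_schwarz x y); lra.
Qed.

Lemma nrmZ a x : nrm (a *: x) = `|a| * nrm x.
Proof.
by rewrite /nrm ipZl// ipZr mulrA -expr2 sqrtrM ?sqr_ge0// sqrtr_sqr.
Qed.

Lemma nrmN x : nrm (- x) = nrm x.
Proof. by rewrite -scaleN1r nrmZ normrN1 mul1r. Qed.

Lemma nrmB x y : nrm (x - y) <= nrm x + nrm y.
Proof. by rewrite (le_trans (nrmD _ _))// nrmN. Qed.

Lemma nrm_distC x y : nrm (x - y) = nrm (y - x).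
Proof. by rewrite -nrmN opprB. Qed.

Lemma nrm0_ip x y : nrm x = 0 -> ip x y = 0.
Proof.
by move=> x0; apply/eqP; rewrite -normr_le0 (le_trans (cauchy_schwarz _ _))// x0 mul0r.
Qed.

(** [L P h] reads: P is in the domain and is mapped to h. A relation rather than
a function, because domain and values are only determined almost everywhere.
Surjectivity together with symmetry plays the role of self-adjointness. *)
Record positive_operator (L : X -> X -> Prop) : Prop := PositiveOperator {
  op_sym : forall P h Q k, L P h -> L Q k -> ip h Q = ip P k;
  op_surj : forall h, exists P, L P h;
  op_pos : forall P h, L P h -> 0 <= ip h P }.

(** A weak solution of [v' + L v = 0] on [[al, be]]: the equation is tested on
the domain of [L], so that nothing is known about the regularity of [v t]
itself. *)
Record evolution (L : X -> X -> Prop) (al be : R) (v : R -> X) : Prop := Evolution {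
  evol_cont : forall t0 : R, al <= t0 <= be -> forall e : R, 0 < e -> exists2 d : R, 0 < d &
     forall t : R, al <= t <= be -> `|t - t0| < d -> nrm (v t - v t0) < e;
  evol_derive : forall P h, L P h -> forall t : R, al < t < be ->
     is_derive t 1 (fun r => ip (v r) P) (- ip (v t) h) }.

Implicit Types (L : X -> X -> Prop) (al be : R) (u v w : R -> X).

Lemma evolution_sub L al be al' be' v : al <= al' -> be' <= be ->
  evolution L al be v -> evolution L al' be' v.
Proof.
move=> aa bb [vc vd]; split.
  move=> t0 /andP[t1 t2] e e0.
  have [|d d0 dP] := vc t0 _ e e0; first by rewrite (le_trans aa t1) (le_trans t2 bb).
  exists d => // t /andP[t3 t4]; apply: dP.
  by rewrite (le_trans aa t3) (le_trans t4 bb).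
move=> P h LPh t /andP[t1 t2]; apply: vd => //.
by rewrite (le_lt_trans aa t1) (lt_le_trans t2 bb).
Qed.

Lemma evolution_shift L al be v s : evolution L al be v ->
  evolution L (al - s) (be - s) (fun t => v (t + s)).
Proof.
have itvS (p q t : R) : (p - s <= t <= q - s) = (p <= t + s <= q).
  by rewrite lerBlDr lerBrDr.
have itvS' (p q t : R) : (p - s < t < q - s) = (p < t + s < q).
  by rewrite ltrBlDr ltrBrDr.
move=> [vc vd]; split.
  move=> t0; rewrite itvS => t0P e e0; have [d d0 dP] := vc _ t0P e e0.
  exists d => // t; rewrite itvS => tP tt0; apply: dP => //.
  by rewrite opprD addrACA subrr addr0.
move=> P h LPh t; rewrite itvS' => tP.
by apply: (@is_derive_shift _ (fun r => ip (v r) P)); exact: vd.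
Qed.

Lemma evolutionZ L al be v a : evolution L al be v ->
  evolution L al be (fun t => a *: v t).
Proof.
move=> [vc vd]; split.
  move=> t0 t0P e e0.
  have a1 : 0 < `|a| + 1 by rewrite ltr_wpDl.
  have [|d d0 dP] := vc _ t0P (e / (`|a| + 1)); first by rewrite divr_gt0.
  exists d => // t tP tt0; rewrite -scalerBr nrmZ.
  apply: (@le_lt_trans _ _ ((`|a| + 1) * nrm (v t - v t0))).
    by rewrite ler_wpM2r ?nrm_ge0// lerDl.
  by rewrite mulrC -ltr_pdivlMr// dP.
move=> P h LPh t tP; have := vd P h LPh t tP => vd'.
have -> : (fun r => ip (a *: v r) P) = a \*: (fun r => ip (v r) P).
  by apply/funext => r; rewrite ipZl.
by rewrite ipZl// -mulrN; exact: is_deriveZ.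
Qed.

Lemma evolutionD L al be v w : evolution L al be v -> evolution L al be w ->
  evolution L al be (fun t => v t + w t).
Proof.
move=> [vc vd] [wc wd]; split.
  move=> t0 t0P e e0; have e2 : 0 < e / 2 by rewrite divr_gt0.
  have [d d0 dP] := vc _ t0P _ e2; have [d' d'0 d'P] := wc _ t0P _ e2.
  exists (Num.min d d'); first by rewrite lt_min d0.
  move=> t tP; rewrite lt_min => /andP[tt0 tt0'].
  rewrite opprD addrACA (le_lt_trans (nrmD _ _))//.
  by have := dP _ tP tt0; have := d'P _ tP tt0'; lra.
move=> P h LPh t tP; have vd' := vd P h LPh t tP; have wd' := wd P h LPh t tP.
have -> : (fun r => ip (v r + w r) P) = (fun r => ip (v r) P) + (fun r => ip (w r) P).
  by apply/funext => r; rewrite ipDl.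
by rewrite ipDl// opprD; exact: is_deriveD.
Qed.

Lemma evolutionB L al be v w : evolution L al be v -> evolution L al be w ->
  evolution L al be (fun t => v t - w t).
Proof.
move=> ev ew; under eq_fun do rewrite -scaleN1r.
exact/evolutionD/evolutionZ.
Qed.

(** Joint continuity of the pairing of two curves; it carries the identities
proved at interior times to the end points. *)
Lemma evol_ip_continuous L1 L2 al be v w : evolution L1 al be v -> evolution L2 al be w ->
  forall t0 s0 : R, al <= t0 <= be -> al <= s0 <= be -> forall e : R, 0 < e ->
  exists2 d : R, 0 < d & forall t s : R, al <= t <= be -> al <= s <= be ->
    `|t - t0| < d -> `|s - s0| < d -> `|ip (v t) (w s) - ip (v t0) (w s0)| < e.
Proof.
move=> [vc _] [wc _] t0 s0 t0P s0P e e0.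
pose M := nrm (v t0) + nrm (w s0) + 1.
have M0 : 0 < M by rewrite ltr_wpDl// addr_ge0 ?nrm_ge0.
pose e1 := Num.min 1 (e / (2 * M)).
have e10 : 0 < e1 by rewrite lt_min ltr01 divr_gt0// mulr_gt0.
have [d d0 dP] := vc _ t0P _ e10; have [d' d'0 d'P] := wc _ s0P _ e10.
exists (Num.min d d'); first by rewrite lt_min d0.
move=> t s tP sP; rewrite !lt_min => /andP[tt _] /andP[_ ss].
have := dP _ tP tt; have := d'P _ sP ss.
set x := v t - v t0; set y := w s - w s0 => yP xP.
have -> : ip (v t) (w s) - ip (v t0) (w s0) = ip x y + ip x (w s0) + ip (v t0) y.
  by rewrite /x /y !ipBl !ipBr; lra.
have x1 : nrm x < 1 by rewrite (lt_le_trans xP)// ge_min lexx.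
have -> : e = e / (2 * M) * (2 * M) by rewrite divfK// mulf_neq0// gt_eqF.
have e1e : e1 <= e / (2 * M) by rewrite ge_min lexx orbT.
have c1 := cauchy_schwarz x y; have c2 := cauchy_schwarz x (w s0).
have c3 := cauchy_schwarz (v t0) y.
rewrite (le_lt_trans (ler_normD _ _))//.
rewrite (@le_lt_trans _ _ (`|ip x y| + `|ip x (w s0)| + `|ip (v t0) y|))//.
  by rewrite lerD2r ler_normD.
apply: (@le_lt_trans _ _ (nrm x * nrm y + nrm x * nrm (w s0) + nrm (v t0) * nrm y)).
  by rewrite !lerD.
have n1 := nrm_ge0 x; have n2 := nrm_ge0 y; have n3 := nrm_ge0 (v t0); have n4 := nrm_ge0 (w s0).
apply: (@le_lt_trans _ _ (e1 * M)).
  rewrite /M !mulrDr mulr1 -!addrA; rewrite addrCA addrC -!addrA.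
  have : nrm x * nrm y <= e1 by rewrite (le_trans _ (ltW yP))// ler_piMl// ltW.
  have : nrm x * nrm (w s0) <= e1 * nrm (w s0) by rewrite ler_wpM2r// ltW.
  have : nrm (v t0) * nrm y <= e1 * nrm (v t0) by rewrite mulrC ler_wpM2r// ltW.
  lra.
apply: (@le_lt_trans _ _ (e / (2 * M) * M)); first by rewrite ler_wpM2r// ltW.
by rewrite ltr_pM2l ?divr_gt0 ?mulr_gt0//; lra.
Qed.

End SemiInner.

(** * Time symmetry of the pairing of two evolutions *)

Section Symmetry.
Context {R : realType} {X : lmodType R}.
Variables (ip : X -> X -> R) (L : X -> X -> Prop).
Hypotheses (ipP : semi_inner ip) (LP : positive_operator ip L).
Implicit Types (al be t s : R) (u v w : R -> X).
Local Notation nrm := (nrm ip).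
Local Notation evolution := (evolution ip L).

(** With [B] a right inverse of [L], [B] is symmetric and the derivative of [r
|-> <v r, B (w (c - r))>] is [- <v r, w (c - r)> + <v r, w (c - r)> = 0]. The
function is not known to be a product of differentiable factors, so the two
partial increments are bounded separately with the mean value theorem. *)
Lemma resolvent_ip_symmetry al be v w : evolution al be v -> evolution al be w ->
  forall B, (forall h, L (B h) h) ->
  forall t s t' s', al < t < be -> al < s < be -> al < t' < be -> al < s' < be ->
  t + s = t' + s' -> ip (v t) (B (w s)) = ip (v t') (B (w s')).
Proof.
move=> ev ew B BP t s t' s' tP sP t'P s'P E.
have symB x y : ip x (B y) = ip (B x) y by apply: (op_sym LP); exact: BP.
pose c := t + s.
pose phi r := ip (v r) (B (w (c - r))).
have c1 : c - t = s by rewrite /c addrAC subrr add0r.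
have c2 : c - t' = s' by rewrite /c E addrAC subrr add0r.
suff : phi t = phi t' by rewrite /phi c1 c2.
apply: (@constant_on_itv R phi (Num.max al (c - be)) (Num.min be (c - al))); last 2 first.
- by rewrite gt_max lt_min /c; move: tP sP => /andP[-> ->] /andP[? ?]; apply/andP; split; lra.
- by rewrite gt_max lt_min /c E; move: t'P s'P => /andP[-> ->] /andP[? ?]; apply/andP; split; lra.
move=> r; rewrite gt_max lt_min => /andP[/andP[r1 r2] /andP[r3 r4]].
apply: is_derive0_eps => e e0.
have rP : al <= r <= be by rewrite !ltW.
have crP : al <= c - r <= be by apply/andP; split; lra.
have e2 : 0 < e / 2 by rewrite divr_gt0.
have [d d0 dP] := evol_ip_continuous ipP ev ew rP crP e2.
pose d1 := Num.min d (Num.min (Num.min (r - al) (be - r)) (Num.min (be - (c - r)) (c - r - al))).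
exists d1; first by rewrite !lt_min d0 !subr_gt0/= r1 r3/=; apply/andP; split; lra.
move=> h; rewrite !lt_min => /andP[hd /andP[/andP[ha hb] /andP[hc hg]]].
have := ler_norm h; have := ler_norm (- h); rewrite normrN => h1 h2.
set g0 := ip (v r) (w (c - r)).
have B1 : `|ip (v (r + h)) (B (w (c - (r + h)))) - ip (v r) (B (w (c - (r + h))))
            - (- g0) * (r + h - r)| <= e / 2 * `|r + h - r|.
  apply: (@mean_value_bound _ (fun x => ip (v x) (B (w (c - (r + h)))))
     (fun x => - ip (v x) (w (c - (r + h))))) => x /dist_between xr.
    apply: (evol_derive ev) => //; move: xr; rewrite ler_norml => /andP[x1 x2].
    by apply/andP; split; lra.
  rewrite -opprD normrN ltW//; move: (xr); rewrite ler_norml => /andP[x1 x2].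
  apply: dP; try (by apply/andP; split; lra); first exact: le_lt_trans hd.
  by rewrite (_ : c - (r + h) - (c - r) = - h) ?normrN//; ring.
have B2 : `|ip (v r) (B (w (c - r - h))) - ip (v r) (B (w (c - r)))
            - (- g0) * (c - r - h - (c - r))| <= e / 2 * `|c - r - h - (c - r)|.
  apply: (@mean_value_bound _ (fun x => ip (v r) (B (w x)))
     (fun x => - ip (v r) (w x))) => x /dist_between; rewrite normrN => xr.
    have -> : (fun x => ip (v r) (B (w x))) = (fun x => ip (w x) (B (v r))).
      by apply/funext => y; rewrite symB ipC.
    rewrite [ip (v r) _](ipC ipP).
    apply: (evol_derive ew) => //; move: xr; rewrite ler_norml => /andP[x1 x2].
    by apply/andP; split; lra.
  rewrite -opprD normrN ltW//; move: (xr); rewrite ler_norml => /andP[x1 x2].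
  apply: dP => //; try (by apply/andP; split; lra); last exact: le_lt_trans hd.
  by rewrite subrr normr0.
have e1 : r + h - r = h by lra.
have e3 : c - r - h - (c - r) = - h by lra.
have e4 : c - (r + h) = c - r - h by lra.
move: B1 B2; rewrite e1 e3 e4 normrN /phi e4 => B1 B2.
set p := ip _ _ in B1 *; set q := ip _ _ in B1 B2 *; set q' := ip _ _ in B2 *.
have -> : p - q' = (p - q - - g0 * h) + (q - q' - - g0 * - h) by ring.
by rewrite (le_trans (ler_normD _ _))//; lra.
Qed.

Lemma has_resolvent : exists B, forall h, L (B h) h.
Proof. by have [B BP] := boolp.choice (op_surj LP); exists B. Qed.

(** Differentiating the identity of [resolvent_ip_symmetry] in one of the two
times removes [B]. *)
Lemma ip_symmetry_interior al be v w : evolution al be v -> evolution al be w ->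
  forall t s t' s', al < t < be -> al < s < be -> al < t' < be -> al < s' < be ->
  t + s = t' + s' -> ip (v t) (w s) = ip (v t') (w s').
Proof.
move=> ev ew t s t' s' tP sP t'P s'P E; have [B BP] := has_resolvent.
have D1 := evol_derive ev (BP (w s)) tP.
have D2 := evol_derive ev (BP (w s')) t'P.
have D2' : is_derive t 1 (fun r => ip (v (r + (t' - t))) (B (w s'))) (- ip (v t') (w s')).
  apply: (@is_derive_shift _ (fun r => ip (v r) (B (w s')))).
  rewrite (_ : t + (t' - t) = t'); [exact: D2|lra].
apply: oppr_inj.
have /@derive_val <- := D1; have /@derive_val <- := D2'.
apply: near_eq_derive.
pose d := Num.min (Num.min (t - al) (be - t)) (Num.min (t' - al) (be - t')).
have d0 : 0 < d by move: tP t'P; rewrite !lt_min !subr_gt0 => /andP[-> ->] /andP[-> ->].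
near=> r.
have : `|t - r| < d by near: r; exact: (@nbhsx_ballx _ _ t).
rewrite !lt_min => /andP[/andP[h1 h2] /andP[h3 h4]].
have := ler_norm (t - r); have := ler_norm (- (t - r)); rewrite normrN => h5 h6.
apply: (resolvent_ip_symmetry ev ew BP) => //; try (by apply/andP; split; lra).
by lra.
Unshelve. all: end_near. Qed.

End Symmetry.

(** * Contraction and backward uniqueness *)

Section Contraction.
Context {R : realType} {X : lmodType R}.
Variables (ip : X -> X -> R) (L : X -> X -> Prop).
Hypotheses (ipP : semi_inner ip) (LP : positive_operator ip L).
Implicit Types (al be t s : R) (u v w : R -> X).
Local Notation nrm := (nrm ip).
Local Notation evolution := (evolution ip L).

(** The semigroup identity [<exp(-tL) x, exp(-sL) y> = <exp(-t'L) x, exp(-s'L)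
y>] for [t + s = t' + s'], obtained without constructing the semigroup. The end
points are reached by shrinking the four times towards the midpoint with a
common ratio, which keeps the two sums equal. *)
Lemma ip_symmetry al be v w : evolution al be v -> evolution al be w ->
  forall t s t' s', al <= t <= be -> al <= s <= be -> al <= t' <= be -> al <= s' <= be ->
  t + s = t' + s' -> ip (v t) (w s) = ip (v t') (w s').
Proof.
move=> ev ew t s t' s' tP sP t'P s'P E.
have [abE|ab] := leP be al.
  have only x : al <= x <= be -> x = al by move=> /andP[x1 x2]; apply/eqP; rewrite eq_le; apply/andP; split; lra.
  by rewrite !(only _ tP) !(only _ sP) !(only _ t'P) !(only _ s'P).
apply/eqP; rewrite -subr_eq0 -normr_le0; apply/ler_addgt0Pl => e e0; rewrite addr0.
have e2 : 0 < e / 2 by rewrite divr_gt0.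
have [d d0 dP] := evol_ip_continuous ipP ev ew tP sP e2.
have [d' d'0 d'P] := evol_ip_continuous ipP ev ew t'P s'P e2.
pose m := (al + be) / 2.
(* common ratio of the contraction towards the midpoint [m] *)
pose eta := Num.min (1/2) (Num.min d d' / (2 * (be - al))).
have ba : 0 < 2 * (be - al) by rewrite mulr_gt0// subr_gt0.
have eta0 : 0 < eta by rewrite !lt_min !divr_gt0//= lt_min d0 d'0.
have eta1 : eta <= 1/2 by rewrite ge_min lexx.
have etad : eta * (2 * (be - al)) <= Num.min d d'.
  by rewrite -ler_pdivlMr// ge_min lexx orbT.
pose c x := x + eta * (m - x).
have cP x : al <= x <= be -> al < c x < be.
  move=> /andP[x1 x2]; rewrite /c /m.
  have : 0 < eta * (be - al) by rewrite mulr_gt0// subr_gt0.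
  have : 0 <= (1 - eta) * (x - al) by rewrite mulr_ge0// ?subr_ge0//; lra.
  have : 0 <= (1 - eta) * (be - x) by rewrite mulr_ge0// ?subr_ge0//; lra.
  move=> ? ? ?; apply/andP; split; lra.
have cd x : al <= x <= be -> `|c x - x| < Num.min d d'.
  move=> /andP[x1 x2]; rewrite /c addrC addKr normrM gtr0_norm//.
  apply: lt_le_trans etad; rewrite ltr_pM2l// /m.
  by rewrite ltr_norml; apply/andP; split; lra.
have cle x : al <= x <= be -> al <= c x <= be by move=> /cP/andP[x1 x2]; rewrite !ltW.
have := dP _ _ (cle _ tP) (cle _ sP); have := d'P _ _ (cle _ t'P) (cle _ s'P).
have := cd _ tP; have := cd _ sP; have := cd _ t'P; have := cd _ s'P.
rewrite !lt_min => /andP[_ c1] /andP[_ c2] /andP[c3 _] /andP[c4 _].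
move=> /(_ c2 c1) H1 /(_ c4 c3).
rewrite (@ip_symmetry_interior R X ip L ipP LP al be v w ev ew (c t) (c s) (c t') (c s'))//;
  try exact: cP; last first.
  have EE : eta * (t + s) = eta * (t' + s') by rewrite E.
  by rewrite /c; lra.
move=> H2.
set p := ip (v t) _; set q := ip _ (w s'); set r := ip _ _ in H1 H2.
have -> : p - q = (r - q) - (r - p) by ring.
by rewrite (le_trans (ler_normB _ _))//; lra.
Qed.

(** This is log-convexity of the norm in its sharpest form, and the source of
contraction and of uniqueness backwards in time. *)
Lemma ip_mid al be v : evolution al be v -> forall t s, al <= t <= be -> al <= s <= be ->
  ip (v t) (v s) = nrm (v ((t + s) / 2)) ^+ 2.
Proof.
move=> ev t s tP sP; rewrite nrm_sqr//; move: (tP) (sP) => /andP[? ?] /andP[? ?].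
by apply: (ip_symmetry ev ev) => //; first [lra | apply/andP; split; lra].
Qed.

(** The function [ga (t + s) = <v t, B (v s)>] is midpoint convex because [B] is
nonnegative, and its derivative at [2 t] is [- ip (v t) (v t)]. Monotonicity of
that derivative is read off from the increments of [ga] over a lattice joining
[a] to [b]. *)
Lemma contraction_interior al be v : evolution al be v ->
  forall a b : R, 2 * al < a -> a < b -> b < 2 * be ->
  ip (v (b / 2)) (v (b / 2)) <= ip (v (a / 2)) (v (a / 2)).
Proof.
move=> ev a b a1 ab b1; have [B BP] := has_resolvent LP.
have symB x y : ip x (B y) = ip (B x) y by apply: (op_sym LP); exact: BP.
have SYM := resolvent_ip_symmetry ipP LP ev ev BP.
pose ga (x : R) := ip (v (x / 2)) (B (v (x / 2))).
have gaE t s : al < t < be -> al < s < be -> ip (v t) (B (v s)) = ga (t + s).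
  move=> tP sP; move: (tP) (sP) => /andP[? ?] /andP[? ?].
  by apply: SYM => //; first [lra | apply/andP; split; lra].
(* the midpoint convexity of ga *)
have convex x h : 2 * al < x -> 0 < h -> x + 2 * h < 2 * be ->
    ga (x + h) - ga x <= ga (x + 2 * h) - ga (x + h).
  move=> x1 h0 x2.
  pose y := v (x / 2 + h) - v (x / 2).
  have := op_pos LP (BP y).
  have -> : ip y (B y) = ip (v (x/2+h)) (B (v (x/2+h))) - ip (v (x/2+h)) (B (v (x/2)))
      - ip (v (x/2)) (B (v (x/2+h))) + ip (v (x/2)) (B (v (x/2))).
    rewrite {1}/y ipBl// (symB (v (x/2+h)) y) (symB (v (x/2)) y) /y !ipBr// -!symB.
    by ring.
  rewrite !gaE; try (by apply/andP; split; lra).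
  have -> : x / 2 + h + (x / 2 + h) = x + 2 * h by lra.
  have -> : x / 2 + h + x / 2 = x + h by lra.
  have -> : x / 2 + (x / 2 + h) = x + h by lra.
  have -> : x / 2 + x / 2 = x by lra.
  lra.
have ga_derive x : 2 * al < x -> x < 2 * be -> is_derive x 1 ga (- ip (v (x/2)) (v (x/2))).
  move=> x1 x2; have xP : al < x / 2 < be by apply/andP; split; lra.
  have D := evol_derive ev (BP (v (x / 2))) xP.
  have D4 : is_derive x 1 (fun r => ip (v (r - x / 2)) (B (v (x / 2)))) (- ip (v (x/2)) (v (x/2))).
    apply: (@is_derive_shift _ (fun r => ip (v r) (B (v (x / 2))))).
    by rewrite (_ : x + - (x / 2) = x / 2); [exact: D|lra].
  apply: (near_eq_is_derive _ D4).
  pose d := Num.min (x / 2 - al) (be - x / 2).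
  have d0 : 0 < d by move: xP => /andP[? ?]; rewrite lt_min !subr_gt0; apply/andP.
  near=> r.
  have : `|x - r| < d by near: r; exact: (@nbhsx_ballx _ _ x).
  rewrite !lt_min => /andP[h1 h2].
  have := ler_norm (x - r); have := ler_norm (- (x - r)); rewrite normrN => h5 h6.
  rewrite /= gaE//; first by congr ga; lra.
  by apply/andP; split; lra.
(* slopes over a lattice *)
have slope k h : 0 < h -> 2 * al < a -> a + k%:R * h + h < 2 * be ->
    ga (a + h) - ga a <= ga (a + k%:R * h + h) - ga (a + k%:R * h).
  move=> h0 _; elim: k => [|k IH] H; first by rewrite mul0r addr0.
  have kh : 0 <= k%:R * h by rewrite mulr_ge0// ltW.
  move: H; rewrite -natr1 mulrDl mul1r => H.
  apply: (le_trans (IH _)); first by lra.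
  have := @convex (a + k%:R * h) h.
  have -> : a + k%:R * h + 2 * h = a + (k%:R * h + h) + h by lra.
  by rewrite addrA; apply; lra.
rewrite -lerN2; set ga'a := - _; set ga'b := - _.
have [b2 a2] : 2 * al < b /\ a < 2 * be by split; lra.
apply/ler_addgt0Pr => e e0; have e2 : 0 < e / 2 by rewrite divr_gt0.
have [d d0 dP] := is_derive_eps (ga_derive _ a1 a2) e2.
have [d' d'0 d'P] := is_derive_eps (ga_derive _ b2 b1) e2.
pose D := Num.min (Num.min d d') (2 * be - b).
have D0 : 0 < D by rewrite !lt_min d0 d'0 subr_gt0.
have ba : 0 < b - a by rewrite subr_gt0.
pose k := (Num.truncn ((b - a) / D)).+1.
have k0 : 0 < k%:R :> R by rewrite ltr0n.
pose h := (b - a) / k%:R.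
have h0 : 0 < h by rewrite divr_gt0.
have kh : k%:R * h = b - a by rewrite mulrC divfK// gt_eqF.
have hD : h < D.
  by rewrite ltr_pdivrMr// mulrC -ltr_pdivrMr// truncnS_gt.
move: hD; rewrite !lt_min => /andP[/andP[hd hd'] hb].
have := dP h; rewrite gtr0_norm// => /(_ hd).
have := d'P h; rewrite gtr0_norm// => /(_ hd').
have akh : a + k%:R * h = b by rewrite kh; lra.
have := slope k h h0 a1; rewrite akh => S.
have {}S : ga (a + h) - ga a <= ga (b + h) - ga b by apply: S; lra.
rewrite -/ga'a -/ga'b !ler_norml => /andP[H1 H2] /andP[H3 H4].
rewrite -(ler_pM2r h0) mulrDl; lra.
Unshelve. all: end_near. Qed.

Lemma contraction al be v : evolution al be v ->
  forall t t', al <= t -> t <= t' -> t' <= be -> nrm (v t') <= nrm (v t).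
Proof.
move=> ev t t' t1 tt t2.
have [->//|tn] := eqVneq t t'.
have {tn}tt : t < t' by rewrite lt_neqAle tn.
have tP : al <= t <= be by rewrite t1 (le_trans (ltW tt)).
have t'P : al <= t' <= be by rewrite t2 (le_trans t1 (ltW tt)).
rewrite -(@ler_pXn2r _ 2)// ?nnegrE ?nrm_ge0// !nrm_sqr//.
apply/ler_addgt0Pr => e e0; have e2 : 0 < e / 2 by rewrite divr_gt0.
have [d d0 dP] := evol_ip_continuous ipP ev ev tP tP e2.
have [d' d'0 d'P] := evol_ip_continuous ipP ev ev t'P t'P e2.
pose r := Num.min (Num.min d d') ((t' - t)) / 4.
have dt : 0 < t' - t by rewrite subr_gt0.
have r0 : 0 < r by rewrite divr_gt0// !lt_min d0 d'0.
have [rd rd' rt] : [/\ r < d, r < d' & 4 * r <= t' - t].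
  have -> : 4 * r = Num.min (Num.min d d') (t' - t) by rewrite /r; lra.
  have : 4 * r <= Num.min d d' by rewrite mulrC divfK// ge_min lexx.
  rewrite le_min => /andP[? ?]; split; try lra.
  by rewrite ge_min lexx orbT.
have sP : al <= t + r <= be by apply/andP; split; lra.
have s'P : al <= t' - r <= be by apply/andP; split; lra.
have := dP _ _ sP sP; rewrite addrAC subrr add0r gtr0_norm// => /(_ rd rd).
have := d'P _ _ s'P s'P; rewrite addrAC subrr add0r normrN gtr0_norm// => /(_ rd' rd').
rewrite !ltr_norml => /andP[H1 H2] /andP[H3 H4].
have := @contraction_interior al be v ev (2 * (t + r)) (2 * (t' - r)).
have h2 (x : R) : 2 * x / 2 = x by lra.
rewrite !h2 => C; have {}C := C _ _ _.
have : ip (v (t' - r)) (v (t' - r)) <= ip (v (t + r)) (v (t + r)) by apply: C; lra.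
lra.
Qed.

(** By [ip_mid], [nrm (v ((al + be) / 2)) ^+ 2 = ip (v al) (v be) = 0];
iterating the halving gives zeros accumulating at [al], and contraction
propagates the zero forward from [al]. *)
Lemma backward_uniqueness al be v : evolution al be v -> al <= be ->
  nrm (v be) = 0 -> forall t, al <= t <= be -> nrm (v t) = 0.
Proof.
move=> ev ab vb t tP.
(* v vanishes at the middle of [s, be] because |v((s + be)/2)|^2 = <v s, v be> *)
have half n : nrm (v (al + (be - al) / 2 ^+ n)) = 0.
  elim: n => [|n IH]; first by rewrite expr0 divr1 addrC subrK.
  set be' := al + _ / 2 ^+ n in IH.
  have n0 : 0 < 2 ^+ n :> R by rewrite exprn_gt0.
  have b1 : al <= be' by rewrite lerDl divr_ge0 ?subr_ge0// ltW.
  have b2 : be' <= be.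
    rewrite -lerBrDl ler_pdivrMr// ler_peMr ?subr_ge0//.
    by rewrite exprn_ege1// ler1n.
  have aP : al <= al <= be by rewrite lexx.
  have b'P : al <= be' <= be by rewrite b1.
  have := ip_mid ev aP b'P; rewrite ipC// nrm0_ip// => /esym/eqP.
  rewrite sqrf_eq0 => /eqP; set x := _ / 2; set y := al + _.
  suff -> : x = y by [].
  by rewrite /x /y /be' exprS invfM; lra.
have v0 : nrm (v al) = 0.
  apply/eqP; rewrite eq_le nrm_ge0 andbT; apply/ler_addgt0Pr => e e0; rewrite add0r.
  have aP : al <= al <= be by rewrite lexx.
  have [d d0 dP] := evol_cont ev aP e0.
  have [n nP] : exists n, (be - al) / 2 ^+ n < d.
    exists (Num.truncn ((be - al) / d)).+1.
    rewrite ltr_pdivrMr ?exprn_gt0// mulrC -ltr_pdivrMr//.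
    apply: (lt_le_trans (truncnS_gt _)).
    by rewrite -natrX ler_nat ltnW// ltn_expl.
  have n0 : 0 <= (be - al) / 2 ^+ n by rewrite divr_ge0 ?subr_ge0 ?exprn_ge0.
  have := dP (al + (be - al) / 2 ^+ n); rewrite addrAC subrr add0r ger0_norm//.
  rewrite lerDl n0/= => H.
  have : nrm (v (al + (be - al) / 2 ^+ n) - v al) < e.
    apply: H => //; rewrite -lerBrDl ler_pdivrMr ?exprn_gt0// ler_peMr ?subr_ge0//.
    by rewrite exprn_ege1// ler1n.
  set x := v _; move=> xv; rewrite -(subKr x (v al)).
  by rewrite (le_trans (nrmB ipP _ _))// half add0r ltW.
apply/eqP; rewrite eq_le nrm_ge0 andbT -v0.
by move: tP => /andP[t1 t2]; apply: (contraction ev).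
Qed.

End Contraction.

(** * Iterated differences in time and the Newton formula *)

Section DifferenceBounds.
Context {R : realType} {X : lmodType R}.
Variables (ip : X -> X -> R) (L : X -> X -> Prop).
Hypotheses (ipP : semi_inner ip) (LP : positive_operator ip L).
Implicit Types (al be t s h : R) (u v w : R -> X).
Local Notation nrm := (nrm ip).
Local Notation evolution := (evolution ip L).

Definition diff (V : zmodType) (h : R) (f : R -> V) (t : R) : V := f t - f (t + h).

Lemma evolution_diff al be v h : 0 <= h -> evolution al be v ->
  evolution al (be - h) (diff h v).
Proof.
move=> h0 ev; apply: evolutionB => //.
  by apply: (evolution_sub _ _ ev) => //; rewrite gerBl.
apply: (evolution_sub _ (lexx _) (evolution_shift h ev)).
by rewrite gerBl.
Qed.

Lemma evolution_iter_diff al be v h i : 0 <= h -> evolution al be v ->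
  evolution al (be - i%:R * h) (iter i (diff h) v).
Proof.
move=> h0 ev; elim: i => [|i IH]; first by rewrite mul0r subr0.
rewrite iterS -natr1 mulrDl mul1r opprD addrA.
exact: evolution_diff.
Qed.

(** The k values [diff h v] at the lattice points telescope to [v al - v (al + k
h)]. Their mutual products are squares of norms at midpoints, hence at least
[nrm (diff h v (al + k h)) ^+ 2] by contraction: all the steps point in the same
direction, so no cancellation can occur. *)
Lemma diff_bound1 al be v h k : 0 <= h -> al + k%:R * h + h <= be -> evolution al be v ->
  k%:R * nrm (diff h v (al + k%:R * h)) <= nrm (v al).
Proof.
move=> h0 kb ev; have ew := evolution_diff h0 ev.
have kh i : 0 <= i%:R * h by rewrite mulr_ge0.
have ikh i : (i <= k)%N -> i%:R * h <= k%:R * h by move=> ik; rewrite ler_wpM2r// ler_nat.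
pose x i := al + i%:R * h.
have xP i : (i <= k)%N -> al <= x i <= be - h.
  by move=> ik; rewrite /x; have := kh i; have := ikh i ik; move=> *; apply/andP; split; lra.
rewrite -(@ler_pXn2r _ 2)// ?nnegrE ?mulr_ge0 ?nrm_ge0// exprMn.
have tele m : \sum_(i < m) diff h v (x i) = v al - v (x m).
  elim: m => [|m IH]; first by rewrite big_ord0 /x mul0r addr0 subrr.
  rewrite big_ord_recr/= IH /diff (_ : x m + h = x m.+1) ?addrA ?subrK//.
  by rewrite /x -natr1; ring.
apply: (@le_trans _ _ (nrm (v al - v (x k)) ^+ 2)).
  rewrite -tele nrm_sqr// ip_suml//; under eq_bigr do rewrite ip_sumr//.
  rewrite (_ : k%:R ^+ 2 * _ = \sum_(i < k) \sum_(j < k) nrm (diff h v (x k)) ^+ 2); last first.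
    by rewrite !(sumr_const, card_ord) -mulrnA -[RHS]mulr_natl natrM expr2.
  apply: ler_sum => i _; apply: ler_sum => j _.
  have iP := xP _ (ltnW (ltn_ord i)); have jP := xP _ (ltnW (ltn_ord j)).
  rewrite (ip_mid ipP LP ew iP jP) ler_pXn2r ?nnegrE ?nrm_ge0//.
  have := ikh _ (ltnW (ltn_ord i)); have := ikh _ (ltnW (ltn_ord j)).
  have := kh i; have := kh j; have := xP _ (leqnn k); rewrite /x => /andP[? ?] *.
  by apply: (contraction ipP LP ew); lra.
have aP : al <= al <= be by have := kh k; rewrite lexx; move=> ?; apply/andP; split; lra.
have kP : al <= x k <= be by have := xP _ (leqnn k) => /andP[? ?]; apply/andP; split; lra.
rewrite !nrm_sqr// ipBl// !ipBr// (ipC ipP (v (x k)) (v al)).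
rewrite -[ip (v al) (v al)]nrm_sqr// -[ip (v (x k)) (v (x k))]nrm_sqr// (ip_mid ipP LP ev aP kP).
have : nrm (v (x k)) ^+ 2 <= nrm (v ((al + x k) / 2)) ^+ 2.
  rewrite ler_pXn2r ?nnegrE ?nrm_ge0//; move: aP kP => /andP[? ?] /andP[? ?].
  by apply: (contraction ipP LP ev); lra.
have := sqr_ge0 (nrm (v (x k))); lra.
Qed.

(** Induction on [i], each difference using up one stretch of length [k h] of
time. *)
Lemma diff_bound_lattice al be v h k i : 0 <= h ->
  al + (i * k)%:R * h + i%:R * h <= be -> evolution al be v ->
  k%:R ^+ i * nrm (iter i (diff h) v (al + (i * k)%:R * h)) <= nrm (v al).
Proof.
move=> h0 + ev; elim: i => [|i IH] H; first by rewrite expr0 mul1r mul0n mul0r addr0.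
move: H; rewrite mulSn natrD -natr1 !mulrDl mul1r => H.
have kh : 0 <= k%:R * h by rewrite mulr_ge0.
have ikh : 0 <= (i * k)%:R * h by rewrite mulr_ge0.
have {}IH := IH _; rewrite exprSr -mulrA; apply: le_trans (IH _); last by lra.
rewrite ler_wpM2l ?exprn_ge0// iterS.
have e1 := evolution_iter_diff i h0 ev.
have e2 : evolution (al + (i * k)%:R * h) (be - i%:R * h) (iter i (diff h) v).
  by apply: (evolution_sub _ _ e1) => //; rewrite lerDl.
have D := diff_bound1 (k := k) h0 _ e2.
rewrite [X in _ * nrm X <= _](_ : _ = diff h (iter i (diff h) v)
  (al + (i * k)%:R * h + k%:R * h)); first by apply: D; lra.
by congr (diff _ _ _); ring.
Qed.

(** Quantitative analyticity in time: the i-th derivative is bounded by [(C i /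
(t - al)) ^+ i], here for finite differences, so that no differentiability of
the curve is involved. *)
Lemma diff_bound al be v h i t : 0 < h -> 0 < t - al -> i%:R * h <= t - al -> t + i%:R * h <= be ->
  evolution al be v ->
  nrm (iter i (diff h) v t) <= (2 * i%:R * h / (t - al)) ^+ i * nrm (v al).
Proof.
move=> h0 tal H1 H2 ev.
have ih0 : 0 <= i%:R * h by rewrite mulr_ge0// ltW.
case: i H1 H2 ih0 => [|i] H1 H2 ih0.
  by rewrite expr0 mul1r; apply: (contraction ipP LP ev) => //; lra.
set I := i.+1 in H1 H2 ih0 *.
have I0 : 0 < I%:R * h by rewrite mulr_gt0// ltr0n.
(* as many steps per difference as fit between [al] and [t] *)
pose k := Num.truncn ((t - al) / (I%:R * h)).
have q1 : 1 <= (t - al) / (I%:R * h) by rewrite ler_pdivlMr// mul1r.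
have k1 : (1 <= k)%N by rewrite truncn_ge_nat// (le_trans ler01).
have kle : k%:R * (I%:R * h) <= t - al.
  by rewrite -ler_pdivlMr// truncn_le (le_trans ler01).
have klt : t - al <= 2 * k%:R * (I%:R * h).
  rewrite -ler_pdivrMr//; apply: ltW; apply: (lt_le_trans (truncnS_gt _)).
  rewrite -/k -natr1; have : 1 <= k%:R :> R by rewrite ler1n.
  lra.
have k0 : 0 < k%:R :> R by rewrite ltr0n.
have ev' := evolution_iter_diff I (ltW h0) ev.
have ik : (I * k)%:R * h = k%:R * (I%:R * h) by rewrite natrM; ring.
have := @diff_bound_lattice al be v h k I (ltW h0).
rewrite ik => D; have {}D := D _ ev.
have khp : 0 <= k%:R * (I%:R * h) by rewrite mulr_ge0// ltW.
have C : nrm (iter I (diff h) v t) <= nrm (iter I (diff h) v (al + k%:R * (I%:R * h))).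
  by apply: (contraction ipP LP ev'); lra.
apply: (le_trans C).
have kI0 : 0 < k%:R ^+ I :> R by rewrite exprn_gt0.
rewrite -(ler_pM2l kI0); apply: le_trans (D _) _; first by lra.
rewrite mulrA -exprMn ler_peMl ?nrm_ge0// exprn_ege1//.
by rewrite mulrA ler_pdivlMr// mul1r; lra.
Qed.

End DifferenceBounds.

Section Newton.
Context {R : realType}.
Implicit Types (V : zmodType).

(** The value at [T - j h] is expanded in differences taken at times that stay
between [T - j h] and [T], so that nothing after [T] is used. *)
Lemma newton_backward V (f : R -> V) (T h : R) j :
  f (T - j%:R * h) = \sum_(i < j.+1) (iter i (diff h) f (T - i%:R * h)) *+ 'C(j, i).
Proof.
elim: j T => [|j IH] T.
  by rewrite big_ord_recl big_ord0 addr0/= mulr1n.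
have -> : T - j.+1%:R * h = T - h - j%:R * h by rewrite -natr1; ring.
rewrite IH.
have step i : iter i (diff h) f (T - h - i%:R * h) =
    iter i (diff h) f (T - i%:R * h) + iter i.+1 (diff h) f (T - i.+1%:R * h).
  rewrite iterS /diff -natr1.
  have -> : T - (i%:R + 1) * h = T - h - i%:R * h by ring.
  have -> : T - h - i%:R * h + h = T - i%:R * h by ring.
  by rewrite [RHS]addrC subrK.
under eq_bigr do rewrite step mulrnDl.
rewrite big_split/=.
rewrite big_ord_recl [in RHS]big_ord_recl -!addrA; congr (_ + _); first by rewrite !bin0.
rewrite [X in X + _](_ : _ = \sum_(i < j.+1) (iter i.+1 (diff h) f (T - i.+1%:R * h)) *+ 'C(j, i.+1)); last first.
  by rewrite [RHS]big_ord_recr/= bin_small// mulr0n addr0.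
rewrite -big_split; apply: eq_bigr => i _.
by rewrite /= -mulrnDr -binS.
Qed.

(** A crude Stirling bound: [i ^ i <= (2 i) ^_ i = 'C(2 i, i) * i! <= 4 ^ i *
i!]. *)
Lemma pow_le_fact (i : nat) : (i ^ i <= 4 ^ i * i`!)%N.
Proof.
have H : (i ^ i <= (i + i) ^_ i)%N.
  rewrite ffact_prod -[X in (X <= _)%N](_ : (\prod_(j < i) i = i ^ i)%N).
    by apply: leq_prod => j _; rewrite -addnBA ?leq_addr// ltnW.
  by rewrite prod_nat_const card_ord.
apply: (leq_trans H); rewrite -bin_ffact leq_mul2r; apply/orP; right.
have -> : (4 ^ i = (1 + 1) ^ (i + i))%N by rewrite -[4%N]/(2 ^ 2)%N -expnM mul2n -addnn.
have iP : (i < (i + i).+1)%N by rewrite ltnS leq_addr.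
rewrite expnDn (bigD1 (Ordinal iP))//= !exp1n !muln1.
exact: leq_addr.
Qed.

End Newton.

(** * Chebyshev combinations of translates; local agreement of two evolutions *)

Section Chebyshev.
Context {R : realType}.
Implicit Types (eps mu : R).

(** The Chebyshev polynomial of degree [2 ^ k] evaluated at the translation by
[eps], through [T_(2n) = 2 T_n ^ 2 - 1]. Translation acts on evolutions as a
symmetric contraction, on which this polynomial is bounded by 1. *)
Fixpoint cheb (V : zmodType) eps (k : nat) (f : R -> V) (t : R) : V :=
  if k is k'.+1 then cheb eps k' (cheb eps k' f) t *+ 2 - f t else f (t + eps).

Fixpoint chebT (k : nat) (x : R) : R :=
  if k is k'.+1 then 2 * chebT k' x ^+ 2 - 1 else x.

(** Outside [-1, 1] the Chebyshev polynomials grow like their degree squared,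
which is [4 ^+ k]. *)
Lemma chebT_ge k (a : R) : 0 <= a -> 1 + 4 ^+ k * a <= chebT k (1 + a).
Proof.
move=> a0; elim: k => [|k IH]; first by rewrite expr0 mul1r.
rewrite [chebT _ _]/=; have := ler_pM _ _ IH IH.
have k0 : 0 <= 4 ^+ k * a by rewrite mulr_ge0// exprn_ge0.
have k1 : 0 <= 1 + 4 ^+ k * a by rewrite addr_ge0.
move=> /(_ k1 k1); rewrite [4 ^+ k.+1]exprS.
have : 0 <= (4 ^+ k * a) ^+ 2 by rewrite sqr_ge0.
lra.
Qed.

(** An exponential is an eigenvector of the translations. *)
Lemma cheb_exp eps mu c (al be : R) k f : 0 <= eps ->
  (forall t, al <= t <= be -> f t = c * expR (mu * t)) ->
  forall t, al <= t -> t + 2 ^+ k * eps <= be ->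
  cheb eps k f t = chebT k (expR (mu * eps)) * f t.
Proof.
move=> eps0; elim: k be c f => [|k IH] be c f fE t t1.
  rewrite expr0 mul1r => t2 /=; rewrite !fE; [|apply/andP; split; lra..].
  by rewrite mulrDr expRD; ring.
have k0 : 0 <= 2 ^+ k * eps by rewrite mulr_ge0// exprn_ge0.
rewrite exprS => t2 /=.
rewrite (IH (be - 2 ^+ k * eps) (chebT k (expR (mu * eps)) * c)); [|..]; try lra.
  rewrite (IH be c)//; last lra.
  by rewrite expr2 mulr2n; ring.
by move=> r /andP[r1 r2]; rewrite (IH be c)// ?fE; try lra; apply/andP; split; lra.
Qed.

Lemma chebB (V : zmodType) eps k (f g : R -> V) t :
  cheb eps k (fun r => f r - g r) t = cheb eps k f t - cheb eps k g t.
Proof.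
elim: k f g t => [//|k IH] f g t /=.
have -> : cheb eps k (fun r => f r - g r) = (fun r => cheb eps k f r - cheb eps k g r).
  by apply/funext => r; exact: IH.
by rewrite IH mulrnBl !opprB addrACA [RHS]addrACA; congr (_ + _); exact: addrC.
Qed.

Context {X : lmodType R}.
Variables (ip : X -> X -> R).
Hypotheses (ipP : semi_inner ip).
Implicit Types (u v w : R -> X).

Lemma cheb_ip eps k v (P : X) t :
  ip (cheb eps k v t) P = cheb eps k (fun r => ip (v r) P) t.
Proof.
elim: k v t => [//|k IH] v t /=.
rewrite ipBl// mulr2n ipDl// -mulr2n !IH; congr (_ *+ 2 - _).
by under eq_fun do rewrite IH.
Qed.

Variable L : X -> X -> Prop.
Hypothesis LP : positive_operator ip L.
Local Notation nrm := (nrm ip).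
Local Notation evolution := (evolution ip L).

Lemma evolution_cheb al be eps k v : 0 <= eps -> evolution al be v ->
  evolution al (be - 2 ^+ k * eps) (cheb eps k v).
Proof.
move=> eps0; elim: k be v => [|k IH] be v ev.
  rewrite expr0 mul1r /=; apply: (evolution_sub _ (lexx _) (evolution_shift eps ev)).
  by rewrite gerBl.
have k0 : 0 <= 2 ^+ k * eps by rewrite mulr_ge0// exprn_ge0.
have -> : be - 2 ^+ k.+1 * eps = be - 2 ^+ k * eps - 2 ^+ k * eps by rewrite exprS; ring.
have e1 := IH _ _ (IH _ _ ev).
rewrite -[cheb _ _ _]/(fun t => cheb eps k (cheb eps k v) t
  + cheb eps k (cheb eps k v) t - v t).
apply: evolutionB => //; first exact: evolutionD.
by apply: (evolution_sub _ _ ev) => //; lra.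
Qed.

(** A polynomial in the translations, which are symmetric by [ip_symmetry]. *)
Lemma cheb_selfadjoint al be eps k v w : 0 <= eps -> al + 2 ^+ k * eps <= be ->
  evolution al be v -> evolution al be w ->
  ip (cheb eps k v al) (w al) = ip (v al) (cheb eps k w al).
Proof.
move=> eps0; elim: k be v w => [|k IH] be v w.
  rewrite expr0 mul1r => H ev ew; apply: (ip_symmetry ipP LP ev ew); try (apply/andP; split; lra).
  by ring.
have k0 : 0 <= 2 ^+ k * eps by rewrite mulr_ge0// exprn_ge0.
rewrite exprS => H ev ew /=.
have ev' := evolution_cheb k eps0 ev; have ew' := evolution_cheb k eps0 ew.
have ev2 : evolution al (be - 2 ^+ k * eps) v by apply: (evolution_sub _ _ ev) => //; lra.
have ew2 : evolution al (be - 2 ^+ k * eps) w by apply: (evolution_sub _ _ ew) => //; lra.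
rewrite ipBl// ipBr// !mulr2n ipDl// ipDr//.
rewrite (IH (be - 2 ^+ k * eps) (cheb eps k v) w)//; last lra.
by rewrite (IH (be - 2 ^+ k * eps) v (cheb eps k w))//; lra.
Qed.

(** If [C] is a symmetric contraction then so is [2 C ^ 2 - 1]: the square of
the norm of [2 C^2 v - v] is [4 |C^2 v|^2 - 4 |C v|^2 + |v|^2 <= |v|^2]. *)
Lemma cheb_contraction al be eps k v : 0 <= eps -> al + 2 ^+ k * eps <= be ->
  evolution al be v -> nrm (cheb eps k v al) <= nrm (v al).
Proof.
move=> eps0; elim: k be v => [|k IH] be v.
  by rewrite expr0 mul1r => H ev; apply: (contraction ipP LP ev); lra.
have k0 : 0 <= 2 ^+ k * eps by rewrite mulr_ge0// exprn_ge0.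
rewrite exprS => H ev.
have ev' := evolution_cheb k eps0 ev.
have ev2 : evolution al (be - 2 ^+ k * eps) v by apply: (evolution_sub _ _ ev) => //; lra.
have := IH (be - 2 ^+ k * eps) (cheb eps k v) _ ev' => C; have {}C := C _.
have {}C : nrm (cheb eps k (cheb eps k v) al) <= nrm (cheb eps k v al) by apply: C; lra.
rewrite -(@ler_pXn2r _ 2)// ?nnegrE ?nrm_ge0// in C.
have : ip (cheb eps k (cheb eps k v) al) (v al) = ip (cheb eps k v al) (cheb eps k v al).
  by apply: (cheb_selfadjoint eps0 _ ev' ev2); lra.
rewrite -(@ler_pXn2r _ 2)// ?nnegrE ?nrm_ge0//.
rewrite -[cheb _ k.+1 _ _]/(cheb eps k (cheb eps k v) al + cheb eps k (cheb eps k v) al - v al).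
move: (cheb eps k (cheb eps k v) al) (cheb eps k v al) C => x y; rewrite !nrm_sqr// => C xv.
by rewrite (ipBl ipP) !(ipBr ipP) !(ipDl ipP) !(ipDr ipP) (ipC ipP (v al) x) xv; lra.
Qed.

End Chebyshev.

Section Locality.
Context {R : realType} {X : lmodType R}.
Variables (ip : X -> X -> R) (L1 L2 : X -> X -> Prop).
Hypotheses (ipP : semi_inner ip).
Hypotheses (L1P : positive_operator ip L1) (L2P : positive_operator ip L2).
Local Notation nrm := (nrm ip).
Implicit Types (h t : R) (i : nat) (P : X).

Lemma iter_diff_ip i h (z : R -> X) P t :
  iter i (diff h) (fun r => ip (z r) P) t = ip (iter i (diff h) z t) P.
Proof.
elim: i t => [//|i IH] t; rewrite !iterS /diff.
by rewrite -/(diff h) ipBl// !IH.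
Qed.

Lemma iter_diffB (V : zmodType) i h (f g : R -> V) t :
  iter i (diff h) (fun r => f r - g r) t = iter i (diff h) f t - iter i (diff h) g t.
Proof.
elim: i t => [//|i IH] t; rewrite !iterS /diff !IH.
by rewrite !opprB addrACA [RHS]addrACA; congr (_ + _); exact: addrC.
Qed.

Lemma is_derive_iter_diff i h (f df : R -> R) (al be t : R) : 0 <= h ->
  (forall r, al < r < be -> is_derive r 1 f (df r)) ->
  al < t -> t + i%:R * h < be ->
  is_derive t 1 (iter i (diff h) f) (iter i (diff h) df t).
Proof.
move=> h0 D; elim: i t => [|i IH] t t1.
  by rewrite mul0r addr0 => t2; apply: D; rewrite t1.
rewrite -natr1 mulrDl mul1r => t2.
have ih : 0 <= i%:R * h by rewrite mulr_ge0.
have D1 := IH t t1 _; have D2 := IH (t + h) _ _.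
rewrite iterS /diff; apply: is_deriveB; first by apply: D1; lra.
by apply: is_derive_shift; apply: D2; lra.
Qed.

Variables (al be : R) (u v : R -> X).
Hypotheses (ab : al < be) (eu : evolution ip L1 al be u) (ev : evolution ip L2 al be v).
Hypothesis uv : nrm (v be - u be) = 0.

Let z t := v t - u t.
Let M := nrm (u al) + nrm (v al).

Let M0 : 0 <= M. Proof. by rewrite addr_ge0// nrm_ge0. Qed.

Let z_bound i h t : 0 < h -> 0 < t - al -> i%:R * h <= t - al -> t + i%:R * h <= be ->
  nrm (iter i (diff h) z t) <= (2 * i%:R * h / (t - al)) ^+ i * M.
Proof.
move=> h0 t0 t1 t2; rewrite iter_diffB (le_trans (nrmB ipP _ _))// mulrDr addrC.
by apply: lerD; [apply: (diff_bound ipP L1P _ _ _ _ eu)|apply: (diff_bound ipP L2P _ _ _ _ ev)].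
Qed.

(** The i-th difference of [<z, psi>], [z = v - u], is [o(h ^ i)] at the common
end time: the finite difference version of the vanishing of the i-th derivative
at [be]. *)
Definition flat i (psi : X) := forall e : R, 0 < e -> exists2 d : R, 0 < d &
  forall h t, 0 < h < d -> be - d < t -> t + i%:R * h < be ->
  `|ip (iter i (diff h) z t) psi| <= e * h ^+ i.

Lemma flat_linear i a x y : flat i x -> flat i y -> flat i (a *: x + y).
Proof.
move=> fx fy e e0; have a0 : 0 < `|a| + 1 by rewrite ltr_wpDl.
have e1 : 0 < e / 2 / (`|a| + 1) by rewrite !divr_gt0.
have e2 : 0 < e / 2 by rewrite divr_gt0.
have [d d0 dP] := fx _ e1; have [d' d'0 d'P] := fy _ e2.
exists (Num.min d d'); first by rewrite lt_min d0.
move=> h t; rewrite lt_min => /andP[h0 /andP[hd hd']] t1 t2.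
have h1 : 0 < h < d by rewrite h0.
have h2 : 0 < h < d' by rewrite h0.
have t3 : be - d < t.
  by apply: le_lt_trans t1; rewrite lerD2l lerN2 ge_min lexx.
have t4 : be - d' < t.
  by apply: le_lt_trans t1; rewrite lerD2l lerN2 ge_min lexx orbT.
have H1 := dP _ _ h1 t3 t2; have H2 := d'P _ _ h2 t4 t2.
rewrite ipDr// ipZr// (le_trans (ler_normD _ _))// normrM.
have hi : 0 < h ^+ i by rewrite exprn_gt0.
have : `|a| * `|ip (iter i (diff h) z t) x| <= e / 2 * h ^+ i.
  apply: le_trans (ler_wpM2l (normr_ge0 a) H1) _.
  rewrite mulrA (ler_pM2r hi).
  rewrite [leRHS](_ : _ = (`|a| + 1) * (e / 2 / (`|a| + 1))); last by field; rewrite gt_eqF.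
  by rewrite ler_pM2r// lerDl.
lra.
Qed.

(** The bound of [diff_bound] is uniform near [be], so flatness passes to limits
of test vectors. *)
Lemma flat_closed i psi :
  (forall e : R, 0 < e -> exists2 psi', nrm (psi - psi') <= e & flat i psi') -> flat i psi.
Proof.
move=> H e e0; pose D := be - al; have D0 : 0 < D by rewrite subr_gt0.
pose K := (4 * i%:R / D) ^+ i * M + 1.
have K0 : 0 < K.
  by rewrite ltr_wpDl// mulr_ge0// exprn_ge0// divr_ge0// ?mulr_ge0// ltW.
have e1 : 0 < e / 2 / K by rewrite !divr_gt0.
have e2 : 0 < e / 2 by rewrite divr_gt0.
have [psi' pp f'] := H _ e1; have [d d0 dP] := f' _ e2.
pose d2 := Num.min d (D / (2 * i.+1%:R)).
exists d2; first by rewrite lt_min d0 divr_gt0// mulr_gt0// ltr0n.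
move=> h t; rewrite lt_min => /andP[h0 /andP[hd hd']] t1 t2.
have h1 : 0 < h < d by rewrite h0.
have t3 : be - d < t.
  by apply: le_lt_trans t1; rewrite lerD2l lerN2 ge_min lexx.
have t4 : D / 2 <= t - al.
  suff : be - D / 2 <= t by rewrite /D; lra.
  apply: le_trans (ltW t1); rewrite lerD2l lerN2 ge_min; apply/orP; right.
  by rewrite ler_pM2l// lef_pV2// ?posrE ?mulr_gt0 ?ltr0n// ler_peMr// ler1n.
have hi : 0 < h ^+ i by rewrite exprn_gt0.
have ih : i%:R * h <= D / 2.
  have : h * (2 * i.+1%:R) < D by rewrite -ltr_pdivlMr// mulr_gt0 ?ltr0n.
  by rewrite -[i.+1%:R]natr1; lra.
have nb : nrm (iter i (diff h) z t) <= K * h ^+ i.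
  apply: (le_trans (z_bound h0 _ _ _)); rewrite ?(ltW t2)//; try lra.
  apply: (@le_trans _ _ ((4 * i%:R / D) ^+ i * h ^+ i * M)); last by rewrite /K; lra.
  rewrite ler_wpM2r//.
  have ih0 : 0 <= 2 * i%:R * h by rewrite mulr_ge0 ?mulr_ge0// ltW.
  have q : 1 <= 2 / D * (t - al) by rewrite mulrAC ler_pdivlMr// mul1r; lra.
  have t5 : 0 < t - al by lra.
  rewrite -exprMn; apply: lerXn2r; rewrite ?nnegrE.
  - by rewrite divr_ge0// ltW.
  - by rewrite mulr_ge0 ?divr_ge0 ?mulr_ge0// ltW.
  rewrite ler_pdivrMr//.
  rewrite (_ : 4 * _ / D * h * _ = 2 * i%:R * h * (2 / D * (t - al))); last by ring.
  by rewrite ler_peMr.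
have H1 := dP _ _ h1 t3 t2.
have -> : psi = psi' + (psi - psi') by rewrite addrC subrK.
rewrite ipDr// (le_trans (ler_normD _ _))//.
have : `|ip (iter i (diff h) z t) (psi - psi')| <= e / 2 * h ^+ i.
  rewrite (le_trans (cauchy_schwarz ipP _ _))//.
  have -> : e / 2 * h ^+ i = K * h ^+ i * (e / 2 / K) by field; rewrite gt_eqF.
  by rewrite ler_pM ?nrm_ge0.
lra.
Qed.

Variable S : X -> Prop.

Hypothesis SP : forall psi, S psi -> forall e : R, 0 < e -> exists psi' eta,
  [/\ nrm (psi - psi') <= e, L1 psi' eta, L2 psi' eta &
    forall N : X -> Prop, (forall a x y, N x -> N y -> N (a *: x + y)) ->
      (forall x, S x -> N x) -> N eta].

(** If [L1 psi' = L2 psi' = eta] then [<z, psi'>' = - <z, eta>], so flatness of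
order [i] of [eta] gives order [i + 1] for [psi']. As [eta] is again a
combination of test vectors the induction closes. *)
Lemma test_flat i psi : S psi -> flat i psi.
Proof.
elim: i psi => [|i IH] psi Spsi.
  move=> e e0; have bP : al <= be <= be by rewrite lexx ltW.
  have n1 : 0 < nrm psi + 1 by rewrite ltr_wpDl// nrm_ge0.
  have e1 : 0 < e / (nrm psi + 1) / 2 by rewrite !divr_gt0.
  have [d d0 dP] := evol_cont eu bP e1; have [d' d'0 d'P] := evol_cont ev bP e1.
  exists (Num.min (Num.min d d') (be - al)); first by rewrite !lt_min d0 d'0 subr_gt0.
  move=> h t _ t1; rewrite mul0r addr0 expr0 mulr1 => t2.
  have : be - t < Num.min (Num.min d d') (be - al) by lra.
  rewrite !lt_min => /andP[/andP[t3 t4] t5].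
  have tP : al <= t <= be by rewrite (ltW t2) andbT; lra.
  have tb : `|t - be| = be - t by rewrite distrC gtr0_norm// subr_gt0.
  have := dP _ tP; rewrite tb => /(_ t3) H1.
  have := d'P _ tP; rewrite tb => /(_ t4) H2.
  have zn : nrm (z t) <= e / (nrm psi + 1).
    have -> : z t = (v t - v be) - (u t - u be) + (v be - u be) by rewrite /z opprB -addrA [X in _ = _ + X]addrC !addrA !subrK.
    rewrite (le_trans (nrmD ipP _ _))// uv addr0 (le_trans (nrmB ipP _ _))//; lra.
  rewrite (le_trans (cauchy_schwarz ipP _ _))//.
  have -> : e = e / (nrm psi + 1) * (nrm psi + 1) by field; rewrite gt_eqF.
  by rewrite ler_pM ?nrm_ge0// lerDl.
apply: flat_closed => e0 e0P; have [psi' [eta [pp l1 l2 lin]]] := SP Spsi e0P.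
exists psi' => //.
have fh : flat i eta by apply: lin => //; exact: flat_linear.
move=> e e1; have [d d0 dP] := fh _ e1.
exists (Num.min d (be - al)); first by rewrite lt_min d0 subr_gt0.
move=> h t; rewrite lt_min => /andP[h0 /andP[hd hd']] t1 t2.
have [t3 t4] : be - d < t /\ al < t.
  have : be - t < Num.min d (be - al) by lra.
  by rewrite lt_min => /andP[? ?]; split; lra.
have h1 : 0 < h < d by rewrite h0.
move: t2; rewrite -natr1 mulrDl mul1r => t2.
rewrite -iter_diff_ip iterS /diff distrC.
have D r : al < r < be -> is_derive r 1 (fun r => ip (z r) psi') (- ip (z r) eta).
  move=> rP; rewrite /z.
  have -> : (fun r => ip (v r - u r) psi') = (fun r => ip (v r) psi' - ip (u r) psi').
    by apply/funext => x; rewrite ipBl.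
  have -> : - ip (v r - u r) eta = - ip (v r) eta - - ip (u r) eta by rewrite (ipBl ipP); ring.
  by apply: is_deriveB; [exact: (evol_derive ev)|exact: (evol_derive eu)].
have := @mean_value_bound R (iter i (diff h) (fun r => ip (z r) psi'))
  (iter i (diff h) (fun r => - ip (z r) eta)) 0 (e * h ^+ i) t (t + h).
rewrite mul0r subr0 (_ : t + h - t = h) ?(gtr0_norm h0) ?exprSr ?mulrA; [apply|by ring].
  move=> r; rewrite min_l ?max_r ?lerDl ?(ltW h0)// => /andP[r1 r2].
  by apply: (is_derive_iter_diff (ltW h0) D); lra.
move=> r; rewrite min_l ?max_r ?lerDl ?(ltW h0)// => /andP[r1 r2].
rewrite subr0 (_ : (fun r => - ip (z r) eta) = (fun r => ip (z r) (- eta))); last first.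
  by apply/funext => x; rewrite ipNr.
by rewrite iter_diff_ip ipNr// normrN; apply: dP => //; lra.
Qed.

Let f psi t := ip (z t) psi.

Let uniform_flat psi n (e : R) : S psi -> 0 < e -> exists2 d : R, 0 < d &
  forall i h t, (i < n)%N -> 0 < h < d -> be - d < t -> t + i%:R * h < be ->
  `|ip (iter i (diff h) z t) psi| <= e * h ^+ i.
Proof.
move=> Spsi e0; elim: n => [|n [d d0 dP]]; first by exists 1.
have [d' d'0 d'P] := @test_flat n psi Spsi _ e0.
exists (Num.min d d'); first by rewrite lt_min d0.
move=> i h t; rewrite ltnS leq_eqVlt lt_min => iP /andP[h0 /andP[hd hd']] t1 t2.
have [t3 t4] : be - d < t /\ be - d' < t.
  have : be - t < Num.min d d' by lra.
  by rewrite lt_min => /andP[? ?]; split; lra.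
have h1 : 0 < h < d by rewrite h0.
have h2 : 0 < h < d' by rewrite h0.
by case/orP: iP => [/eqP ii|iP]; [subst i; exact: d'P|exact: dP].
Qed.

Let geometric n m : \sum_(i < m) (1 / 2) ^+ (n + i) <= 2 * (1 / 2) ^+ n :> R.
Proof.
suff : \sum_(i < m) (1 / 2) ^+ (n + i) <= 2 * (1 / 2) ^+ n - 2 * (1 / 2) ^+ (n + m) :> R.
  have h2 : 0 <= 1 / 2 :> R by lra.
  by have := exprn_ge0 (n + m) h2; lra.
elim: m => [|m IH]; first by rewrite big_ord0 addn0 subrr.
by rewrite big_ord_recr/= addnS exprS; lra.
Qed.

Let bin_pow j i : ('C(j, i) * i`! <= j ^ i)%N.
Proof.
rewrite bin_ffact ffact_prod -[X in (_ <= X)%N](_ : (\prod_(k < i) j = j ^ i)%N).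
  by apply: leq_prod => k _; exact: leq_subr.
by rewrite prod_nat_const card_ord.
Qed.

(** All time derivatives of [<z, psi>] vanish at [be] and the function is
analytic, hence zero near [be]. In the Newton expansion at [be - s] the first
[n] terms are small by flatness, and the remaining ones are bounded by a
geometric series thanks to [diff_bound]. *)
Lemma local_agreement psi (s : R) : S psi -> 0 < s -> s <= (be - al) / 32 ->
  ip (z (be - s)) psi = 0.
Proof.
move=> Spsi s0 sD; pose D := be - al; have D0 : 0 < D by rewrite subr_gt0.
have DE : D = be - al by [].
apply/eqP; rewrite -normr_le0; apply/ler_addgt0Pl => e e0; rewrite addr0.
pose M' := M * nrm psi; have M'0 : 0 <= M' by rewrite mulr_ge0// nrm_ge0.
(* beyond the first [n] terms the geometric bound [aB] is summed; the first [n]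
   are made small by flatness with the constant [e'] *)
pose n := (Num.truncn (4 * M' / e)).+1.
have nP : M' * (2 * (1 / 2) ^+ n) <= e / 2.
  have : 4 * M' / e < 2 ^+ n.
    by apply: (lt_le_trans (truncnS_gt _)); rewrite -natrX ler_nat ltnW// ltn_expl.
  rewrite ltr_pdivrMr// => H.
  have n0 : 0 < 2 ^+ n :> R by rewrite exprn_gt0.
  rewrite expr_div_n expr1n mul1r mulrA ler_pdivrMr//; lra.
have s1 : 0 < (1 + s) ^+ n by rewrite exprn_gt0// addr_gt0.
pose e' := e / (2 * n.+1%:R * (1 + s) ^+ n).
have e'0 : 0 < e' by rewrite divr_gt0// !mulr_gt0// ltr0n.
have [d d0 dP] := @uniform_flat psi n e' Spsi e'0.
(* the Newton expansion has base time [be - h], since flatness holds before [be] *)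
pose j := (n + Num.truncn (n.+1%:R * s / d))%N.
have j0 : 0 < j.+1%:R :> R by rewrite ltr0n.
pose h := s / j.+1%:R.
have h0 : 0 < h by rewrite divr_gt0.
have hj : j.+1%:R * h = s by rewrite mulrC divfK// gt_eqF.
have hd : n.+1%:R * h < d.
  rewrite mulrA ltr_pdivrMr// [d * _]mulrC -ltr_pdivrMr//.
  apply: (lt_le_trans (truncnS_gt _)).
  by rewrite ler_nat ltnS leq_addl.
have jh : j%:R * h <= s by rewrite -hj ler_wpM2r ?(ltW h0)// ler_nat.
have -> : z (be - s) = z (be - h - j%:R * h).
  by congr z; rewrite -hj -natr1; ring.
have -> : ip (z (be - h - j%:R * h)) psi = f psi (be - h - j%:R * h) by [].
rewrite newton_backward.
pose a i := (iter i (diff h) (f psi) (be - h - i%:R * h)) *+ 'C(j, i).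
have ij i : (i <= j)%N -> i.+1%:R * h <= s.
  by move=> ij; rewrite -hj ler_wpM2r ?(ltW h0)// ler_nat.
have aA i : (i < n)%N -> `|a i| <= e / (2 * n.+1%:R).
  move=> ni; rewrite /a normrMn iter_diff_ip -[_ *+ 'C(j, i)]mulr_natr.
  have ij' : (i <= j)%N by rewrite (leq_trans (ltnW ni))// leq_addr.
  have ih : i.+1%:R * h <= n.+1%:R * h by rewrite ler_wpM2r ?(ltW h0)// ler_nat ltnS ltnW.
  move: (ih); rewrite -natr1 => ih'.
  have i0 : 0 <= i%:R * h by rewrite mulr_ge0// ltW.
  have H := dP i h (be - h - i%:R * h) ni.
  have {}H : `|ip (iter i (diff h) z (be - h - i%:R * h)) psi| <= e' * h ^+ i.
    by apply: H; [rewrite h0; lra|lra|lra].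
  apply: (@le_trans _ _ (e' * h ^+ i * j%:R ^+ i)).
    apply: ler_pM => //; rewrite -natrX ler_nat (leq_trans _ (bin_pow _ _))//.
    by rewrite leq_pmulr// fact_gt0.
  rewrite -mulrA -exprMn [h * _]mulrC.
  have -> : e / (2 * n.+1%:R) = e' * (1 + s) ^+ n.
    by rewrite /e' [in RHS]invfM mulrA divfK// gt_eqF.
  rewrite ler_pM2l//; apply: (@le_trans _ _ ((1 + s) ^+ i)).
    apply: lerXn2r; rewrite ?nnegrE; try lra.
    by rewrite mulr_ge0// ltW.
  by rewrite ler_weXn2l ?(ltnW ni)//; lra.
have aB i : (i <= j)%N -> `|a i| <= M' * (1 / 2) ^+ i.
  move=> ij'; rewrite /a normrMn iter_diff_ip -[_ *+ 'C(j, i)]mulr_natr.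
  have := ij _ ij'; rewrite -natr1 => ih.
  have i0 : 0 <= i%:R * h by rewrite mulr_ge0// ltW.
  set t := be - h - i%:R * h.
  have t1 : D / 2 <= t - al by rewrite /t; lra.
  have t0 : 0 < t - al by lra.
  have zb : nrm (iter i (diff h) z t) <= (4 * i%:R * h / D) ^+ i * M.
    apply: (le_trans (z_bound h0 t0 _ _)); [by rewrite /t; lra|by rewrite /t; lra|].
    rewrite ler_wpM2r//; apply: lerXn2r; rewrite ?nnegrE.
    - by rewrite divr_ge0 ?(ltW t0)//; lra.
    - by rewrite divr_ge0 ?(ltW D0)//; lra.
    rewrite ler_pdivrMr// (_ : 4 * _ * h / D * _ = 2 * i%:R * h * (2 / D * (t - al))); last by ring.
    rewrite ler_peMr//; first lra.
    by rewrite mulrAC ler_pdivlMr// mul1r; lra.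
  apply: (@le_trans _ _ ((4 * i%:R * h / D) ^+ i * M' * 'C(j, i)%:R)).
    rewrite ler_wpM2r// (le_trans (cauchy_schwarz ipP _ _))// /M' mulrA.
    by rewrite ler_wpM2r// nrm_ge0.
  rewrite mulrAC mulrC ler_wpM2l//.
  have ifact : 0 < i`!%:R :> R by rewrite ltr0n fact_gt0.
  have B1 : 'C(j, i)%:R * i`!%:R <= j%:R ^+ i :> R by rewrite -natrM -natrX ler_nat bin_pow.
  have B2 : i%:R ^+ i <= 4 ^+ i * i`!%:R :> R.
    by rewrite -(natrX _ i i) -(natrX _ 4) -natrM ler_nat pow_le_fact.
  have q0 : 0 <= 4 * h / D by rewrite divr_ge0 ?(ltW D0)//; lra.
  have -> : (4 * i%:R * h / D) ^+ i * 'C(j, i)%:R = (4 * h / D) ^+ i * (i%:R ^+ i * 'C(j, i)%:R).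
    by rewrite mulrA -exprMn; congr (_ ^+ _ * _); ring.
  apply: (@le_trans _ _ ((4 * h / D) ^+ i * (4 ^+ i * j%:R ^+ i))).
    rewrite ler_wpM2l ?exprn_ge0//.
    apply: (@le_trans _ _ (4 ^+ i * i`!%:R * 'C(j, i)%:R)); first by rewrite ler_wpM2r.
    by rewrite -mulrA ler_wpM2l ?exprn_ge0// mulrC.
  rewrite -!exprMn; apply: lerXn2r; rewrite ?nnegrE; try lra.
    by apply: mulr_ge0 => //; apply: mulr_ge0.
  rewrite [leLHS](_ : _ = 16 * (j%:R * h) / D); last by ring.
  rewrite ler_pdivrMr//; move: sD; rewrite -/D; lra.
have nj : (n <= j.+1)%N by apply: leqW; exact: leq_addr.
apply: (@le_trans _ _ (\sum_(i < j.+1) `|a i|)); first exact: ler_norm_sum.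
rewrite -(big_mkord xpredT (fun i => `|a i|)) (big_cat_nat (leq0n n) nj)/=.
have S1 : \sum_(0 <= i < n) `|a i| <= e / 2.
  rewrite big_mkord; apply: (@le_trans _ _ (\sum_(i < n) e / (2 * n.+1%:R))).
    by apply: ler_sum => i _; exact: aA.
  rewrite sumr_const card_ord -[_ *+ n]mulr_natr.
  have nn : n%:R <= n.+1%:R :> R by rewrite ler_nat.
  apply: (@le_trans _ _ (e / (2 * n.+1%:R) * n.+1%:R)).
    by rewrite ler_wpM2l// divr_ge0 ?mulr_ge0// ltW.
  by rewrite le_eqVlt; apply/orP; left; apply/eqP; field; rewrite addrC natr1 pnatr_eq0.
have S2 : \sum_(n <= i < j.+1) `|a i| <= e / 2.
  apply: le_trans nP; rewrite -{1}[n]add0n big_addn big_mkord.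
  apply: (@le_trans _ _ (\sum_(i < j.+1 - n) M' * (1 / 2) ^+ (n + i))).
    apply: ler_sum => i _; rewrite addnC; apply: aB.
    by rewrite -ltnS -ltn_subRL.
  by rewrite -mulr_sumr ler_wpM2l.
lra.
Qed.

End Locality.

(** * The obstruction to solving forward and backward *)

Section Obstruction.
Context {R : realType} {X : lmodType R}.
Variables (ip : X -> X -> R) (L1 L2 : X -> X -> Prop).
Hypotheses (ipP : semi_inner ip).
Hypotheses (L1P : positive_operator ip L1) (L2P : positive_operator ip L2).
Local Notation nrm := (nrm ip).
Variables (al be : R) (u v : R -> X).
Hypotheses (ab : al < be) (eu : evolution ip L1 al be u) (ev : evolution ip L2 al be v).
Hypothesis uv : nrm (v be - u be) = 0.
Variable S : X -> Prop.
Hypothesis SP : forall psi, S psi -> forall e : R, 0 < e -> exists psi' eta,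
  [/\ nrm (psi - psi') <= e, L1 psi' eta, L2 psi' eta &
    forall N : X -> Prop, (forall a x y, N x -> N y -> N (a *: x + y)) ->
      (forall x, S x -> N x) -> N eta].

(** On the test vector [psi] the two evolutions agree near [be], so [E = <v,
Psi> - <u, Theta>] satisfies [E' = mu E] there and grows exponentially. Each of
its two terms stays bounded under the Chebyshev combinations of translates,
whereas the exponential is multiplied by unbounded factors; therefore [E]
vanishes near [be], and at [be] by continuity. *)
Lemma obstruction (mu : R) psi Psi Theta : 0 < mu -> S psi ->
  L2 Psi (psi - mu *: Psi) -> L1 Theta (psi - mu *: Theta) ->
  ip (u be) (Psi - Theta) = 0.
Proof.
move=> mu0 Spsi LPsi LTheta.
pose D := be - al; have DE : D = be - al by [].
have D0 : 0 < D by rewrite subr_gt0.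
(* on [p, be[ [local_agreement] applies; [q] leaves room for the translations *)
pose p := be - D / 32; pose q := be - D / 64.
pose E t := ip (v t) Psi - ip (u t) Theta.
have zpsi t : p <= t < be -> ip (v t) psi = ip (u t) psi.
  move=> /andP[t1 t2]; apply/eqP; rewrite -subr_eq0 -(ipBl ipP).
  have := @local_agreement _ _ _ _ _ ipP L1P L2P _ _ _ _ ab eu ev uv _ SP psi (be - t) Spsi.
  rewrite subKr => ->//; first by rewrite subr_gt0.
  by rewrite /p in t1; lra.
have dE t : p <= t < be -> is_derive t 1 E (mu * E t).
  move=> tP; have := zpsi _ tP; move: tP => /andP[t1 t2] zt.
  have tP : al < t < be by rewrite t2 andbT; rewrite /p in t1; lra.
  have -> : mu * E t = - ip (v t) (psi - mu *: Psi) - - ip (u t) (psi - mu *: Theta).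
    by rewrite !(ipBr ipP) !(ipZr ipP) zt /E; ring.
  by apply: is_deriveB; [exact: (evol_derive ev)|exact: (evol_derive eu)].
pose G t := E t * expR (- mu * t).
have Gc t : p <= t < be -> G t = G p.
  move=> /andP[t1 t2].
  have : `|G t - G p - 0 * (t - p)| <= 0 * `|t - p|.
    apply: (@mean_value_bound R G (fun=> 0)) => x; last by rewrite subrr normr0.
    rewrite min_l// max_r// => /andP[x1 x2].
    have xP : p <= x < be by rewrite x1 (le_lt_trans x2).
    have d1 := dE _ xP.
    have d3 : is_derive x 1 (fun r : R => - mu * r) (- mu).
      by have := is_deriveZ (- mu) (is_derive_id x (1 : R)); rewrite [_ *: 1]mulr1.
    have d2 : is_derive x 1 (fun r : R => expR (- mu * r)) (- mu * expR (- mu * x)).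
      have := @is_derive1_comp R expR (fun r => - mu * r) x _ _ (is_derive_expR _) d3.
      by rewrite mulrC.
    have := is_deriveM d1 d2.
    by rewrite -[_ *: _]/(_ * _) -[X in _ + X]/(_ * _) (_ : _ + _ = 0)//; ring.
  by rewrite !mul0r subr0 normr_le0 subr_eq0 => /eqP.
have Eexp t : p <= t < be -> E t = G p * expR (mu * t).
  by move=> tP; rewrite -(Gc t)// /G -mulrA -expRD mulNr addNr expR0 mulr1.
(* the Chebyshev combinations of E at p are bounded, but their coefficients are not *)
have Ep : E p = 0.
  apply/eqP/negPn/negP => Ep0.
  pose B := nrm (v p) * nrm Psi + nrm (u p) * nrm Theta.
  have r0 : 0 < q - p by rewrite /p /q; lra.
  have bound k : (2 ^+ k * (mu * (q - p))) * `|E p| <= B.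
    pose eps := (q - p) / 2 ^+ k.
    have k0 : 0 < 2 ^+ k :> R by rewrite exprn_gt0.
    have eps0 : 0 <= eps by rewrite divr_ge0// ltW.
    have keps : 2 ^+ k * eps = q - p by rewrite /eps mulrC divfK// gt_eqF.
    have pal : al <= p by rewrite /p; lra.
    have evp : evolution ip L2 p be v by exact: (evolution_sub _ _ ev).
    have eup : evolution ip L1 p be u by exact: (evolution_sub _ _ eu).
    have C1 : cheb eps k E p = chebT k (expR (mu * eps)) * E p.
      apply: (@cheb_exp R eps mu (G p) p q) => //; last by rewrite keps; lra.
      by move=> t /andP[t1 t2]; apply: Eexp; rewrite t1 (le_lt_trans t2)// /q; lra.
    have C2 : cheb eps k E p = ip (cheb eps k v p) Psi - ip (cheb eps k u p) Theta.
      by rewrite !(cheb_ip ipP) -chebB.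
    have C3 : `|cheb eps k E p| <= B.
      rewrite C2 (le_trans (ler_normB _ _))//; apply: lerD.
        rewrite (le_trans (cauchy_schwarz ipP _ _))// ler_wpM2r ?nrm_ge0//.
        by apply: (cheb_contraction ipP L2P eps0 _ evp); rewrite keps /q; lra.
      rewrite (le_trans (cauchy_schwarz ipP _ _))// ler_wpM2r ?nrm_ge0//.
      by apply: (cheb_contraction ipP L1P eps0 _ eup); rewrite keps /q; lra.
    apply: le_trans C3; rewrite C1 normrM ler_wpM2r//.
    have m0 : 0 <= expR (mu * eps) - 1.
      by rewrite subr_ge0 -expR0 ler_expR mulr_ge0// ltW.
    have := chebT_ge k m0; rewrite [1 + (_ - 1)]addrC subrK => H.
    apply: le_trans (ler_norm _); apply: le_trans H.
    have H1 : mu * eps <= expR (mu * eps) - 1 by have := expR_ge1Dx (mu * eps); lra.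
    have -> : 2 ^+ k * (mu * (q - p)) = 4 ^+ k * (mu * eps).
      rewrite -keps (_ : 4 = 2 * 2 :> R); last by ring.
      by rewrite exprMn; ring.
    have : 4 ^+ k * (mu * eps) <= 4 ^+ k * (expR (mu * eps) - 1).
      by rewrite ler_wpM2l// exprn_ge0.
    lra.
  have c0 : 0 < mu * (q - p) * `|E p| by rewrite !mulr_gt0// normr_gt0.
  have := bound (Num.truncn (B / (mu * (q - p) * `|E p|))).+1.
  rewrite -mulrA -ler_pdivlMr// leNgt => /negP; apply.
  apply: (lt_le_trans (truncnS_gt _)).
  by rewrite -natrX ler_nat ltnW// ltn_expl.
have E0 t : p <= t < be -> E t = 0.
  by move=> tP; rewrite Eexp// /G Ep !mul0r.
(* continuity up to be *)
apply/eqP; rewrite -normr_le0; apply/ler_addgt0Pl => e e0; rewrite addr0.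
have bP : al <= be <= be by rewrite ltW//=.
pose K := nrm Psi + nrm Theta + 1.
have K0 : 0 < K by rewrite ltr_wpDl// addr_ge0// nrm_ge0.
have e1 : 0 < e / K by rewrite divr_gt0.
have [d d0 dP] := evol_cont eu bP e1; have [d' d'0 d'P] := evol_cont ev bP e1.
pose m := Num.min (Num.min d d') (D / 32) / 2.
have m0 : 0 < Num.min (Num.min d d') (D / 32) by rewrite !lt_min d0 d'0 divr_gt0.
have [m1 m2 m3] : [/\ m < d, m < d' & m < D / 32].
  have : m < Num.min (Num.min d d') (D / 32) by rewrite /m; lra.
  by rewrite !lt_min => /andP[/andP[-> ->] ->].
have m4 : 0 < m by rewrite divr_gt0.
have tP : p <= be - m < be by rewrite /p; apply/andP; split; lra.
have taP : al <= be - m <= be by apply/andP; split; lra.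
have tb : `|be - m - be| = m by rewrite addrAC subrr add0r normrN gtr0_norm.
have := dP _ taP; rewrite tb => /(_ m1) H1.
have := d'P _ taP; rewrite tb => /(_ m2) H2.
have -> : ip (u be) (Psi - Theta) = E be.
  rewrite (ipBr ipP) /E; congr (_ - _).
  by apply/eqP; rewrite eq_sym -subr_eq0 -(ipBl ipP) (nrm0_ip ipP).
have -> : E be = E be - E (be - m) by rewrite (E0 _ tP) subr0.
have -> : E be - E (be - m) = ip (u (be - m) - u be) Theta - ip (v (be - m) - v be) Psi.
  by rewrite /E !(ipBl ipP); ring.
rewrite (le_trans (ler_normB _ _))//.
have H3 := cauchy_schwarz ipP (u (be - m) - u be) Theta.
have H4 := cauchy_schwarz ipP (v (be - m) - v be) Psi.
have n1 := nrm_ge0 ip Psi; have n2 := nrm_ge0 ip Theta.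
have H5 : nrm (u (be - m) - u be) * nrm Theta <= e / K * nrm Theta by rewrite ler_wpM2r// ltW.
have H6 : nrm (v (be - m) - v be) * nrm Psi <= e / K * nrm Psi by rewrite ler_wpM2r// ltW.
have : e = e / K * nrm Psi + e / K * nrm Theta + e / K by rewrite -!mulrDr -?mulrDr -[X in _ + X]mulr1 -mulrDr divfK// gt_eqF.
lra.
Qed.

End Obstruction.

(** * Integrals and primitives over the unit interval *)

Section IntegralOverOmega.
Context {R : realType}.
Local Notation mu := (@lebesgue_measure R).
Local Notation Omega := (@Omega R).
Implicit Types (f g : R -> R) (x y : R).

Lemma measurable_Omega : measurable Omega. Proof. exact: measurable_itv. Qed.
Hint Resolve measurable_Omega : core.

Lemma OmegaP x : Omega x <-> 0 <= x <= 1.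
Proof. by rewrite /Defs.Omega /= in_itv. Qed.

Lemma Omega0 : Omega 0. Proof. by apply/OmegaP; rewrite lexx ler01. Qed.
Lemma Omega1 : Omega 1. Proof. by apply/OmegaP; rewrite lexx ler01. Qed.

Lemma mu_Omega : mu Omega = 1%:E.
Proof. by rewrite /Defs.Omega lebesgue_measure_itv/= lte_fin ltr01 oppr0 adde0. Qed.

Definition intO f := mu.-integrable Omega (EFin \o f).

Lemma intO_measurable f : intO f -> measurable_fun Omega f.
Proof. by move=> /measurable_int/measurable_EFinP. Qed.

Lemma intO_eq f g : (forall x, Omega x -> f x = g x) -> intO f -> intO g.
Proof.
move=> fg; apply: eq_integrable => // x /set_mem xO.
by rewrite /= fg.
Qed.

Lemma intOD f g : intO f -> intO g -> intO (fun x => f x + g x).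
Proof.
move=> If Ig; apply: (eq_integrable _ _ _ _ (integrableD _ If Ig)) => //.
Qed.

Lemma intOZ (a : R) f : intO f -> intO (fun x => a * f x).
Proof.
move=> If; apply: (eq_integrable _ _ _ _ (integrableZl _ a If)) => //.
Qed.

Lemma intON f : intO f -> intO (fun x => - f x).
Proof. by move=> If; apply: intO_eq (intOZ (-1) If) => x _; rewrite mulN1r. Qed.

Lemma intOB f g : intO f -> intO g -> intO (fun x => f x - g x).
Proof. by move=> If Ig; apply: intOD => //; exact: intON. Qed.

Lemma intO_norm f : intO f -> intO (fun x => `|f x|).
Proof. exact: integrable_norm. Qed.

Lemma bounded_onP g (C : R) : (forall x, Omega x -> `|g x| <= C) -> [bounded g x | x in Omega].
Proof.
move=> gC; exists `|C|; split => // M CM x Ox.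
apply: le_trans (gC _ Ox) _; exact: le_trans (ler_norm _) (ltW CM).
Qed.

Lemma intO_bounded g (C : R) : measurable_fun Omega g ->
  (forall x, Omega x -> `|g x| <= C) -> intO g.
Proof.
move=> mg /bounded_onP gC; apply: measurable_bounded_integrable => //.
by rewrite [X in (X < _)%E]mu_Omega ltry.
Qed.

Lemma intO_cst (c : R) : intO (fun=> c).
Proof. by apply: (@intO_bounded _ `|c|). Qed.

Lemma intO_bddM g f (C : R) : measurable_fun Omega g ->
  (forall x, Omega x -> `|g x| <= C) -> intO f -> intO (fun x => g x * f x).
Proof.
move=> mg /bounded_onP gC If.
have H := @integrableMr _ _ _ mu Omega measurable_Omega g _ mg gC If.
by apply: (eq_integrable _ _ _ _ H).
Qed.

Lemma intO_le f g : measurable_fun Omega f -> intO g ->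
  (forall x, Omega x -> `|f x| <= `|g x|) -> intO f.
Proof.
move=> mf Ig fg; apply: (le_integrable _ _ _ Ig) => //.
exact/measurable_EFinP.
Qed.

Definition I f : R := \int[mu]_(x in Omega) f x.

Lemma I_eq f g : (forall x, Omega x -> f x = g x) -> I f = I g.
Proof. by move=> fg; apply: eq_Rintegral => x /set_mem; exact: fg. Qed.

Lemma I_D f g : intO f -> intO g -> I (fun x => f x + g x) = I f + I g.
Proof. exact: RintegralD. Qed.

Lemma I_B f g : intO f -> intO g -> I (fun x => f x - g x) = I f - I g.
Proof. exact: RintegralB. Qed.

Lemma I_Z a f : intO f -> I (fun x => a * f x) = a * I f.
Proof. exact: RintegralZl. Qed.

Lemma I_le f g : intO f -> intO g -> (forall x, Omega x -> f x <= g x) -> I f <= I g.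
Proof. exact: le_Rintegral. Qed.

Lemma I_ge0 f : (forall x, Omega x -> 0 <= f x) -> 0 <= I f.
Proof. by move=> f0; rewrite /I; apply: Rintegral_ge0. Qed.

Lemma I_cst c : I (fun=> c) = c.
Proof. by rewrite /I Rintegral_cst// [X in fine X]mu_Omega mulr1. Qed.

Lemma I_ae f g : measurable_fun Omega f -> measurable_fun Omega g ->
  ae_eq mu Omega f g -> I f = I g.
Proof.
move=> mf mg fg; congr fine; apply: ae_eq_integral => //.
- exact/measurable_EFinP.
- exact/measurable_EFinP.
- by apply: filterS fg => x /= H Ox; rewrite H.
Qed.

Lemma I_eq0 f : intO f -> (forall x, Omega x -> 0 <= f x) -> I f = 0 ->
  ae_eq mu Omega f (cst 0).
Proof.
move=> If f0 If0.
have mf : measurable_fun Omega (EFin \o f) by exact: measurable_int If.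
have : (\int[mu]_(x in Omega) `|(EFin \o f) x| = 0)%E.
  rewrite (_ : (\int[mu]_(x in Omega) `|(EFin \o f) x|)%E = \int[mu]_(x in Omega) (EFin \o f) x)%E.
    by rewrite -[LHS]fineK; [rewrite -/(Rintegral _ _ _) -/(I f) If0|exact: integrable_fin_num].
  by apply: eq_integral => x /set_mem /f0 fx; rewrite /= ger0_norm.
by move=> H0; have := (ae_eq_integral_abs mu measurable_Omega mf).1 H0;
  apply: filterS => x /= H /H [].
Qed.

Definition prim f x : R := \int[mu]_(y in `[0, x]) f y.

Lemma sub_Omega x : Omega x -> `[0, x]%classic `<=` Omega.
Proof. by move=> /OmegaP/andP[_ x1]; apply: subset_itvl; rewrite bnd_simp. Qed.

Lemma intO_sub f x : Omega x -> intO f -> mu.-integrable `[0, x] (EFin \o f).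
Proof. by move=> Ox; apply: integrableS => //; exact: sub_Omega. Qed.

Lemma prim_eq f g x : Omega x -> (forall x, Omega x -> f x = g x) -> prim f x = prim g x.
Proof. by move=> Ox fg; apply: eq_Rintegral => y /set_mem /(sub_Omega Ox); exact: fg. Qed.

Lemma prim_D f g x : Omega x -> intO f -> intO g ->
  prim (fun x => f x + g x) x = prim f x + prim g x.
Proof. by move=> Ox If Ig; apply: RintegralD => //; exact: intO_sub. Qed.

Lemma prim_B f g x : Omega x -> intO f -> intO g ->
  prim (fun x => f x - g x) x = prim f x - prim g x.
Proof. by move=> Ox If Ig; apply: RintegralB => //; exact: intO_sub. Qed.

Lemma prim_Z a f x : Omega x -> intO f -> prim (fun x => a * f x) x = a * prim f x.
Proof. by move=> Ox If; apply: RintegralZl => //; exact: intO_sub. Qed.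

Lemma prim_le f g x : Omega x -> intO f -> intO g ->
  (forall y, Omega y -> y <= x -> f y <= g y) -> prim f x <= prim g x.
Proof.
move=> Ox If Ig fg; apply: le_Rintegral => //; try exact: intO_sub.
move=> y yx; apply: fg; first exact: (sub_Omega Ox).
by move: yx; rewrite /= in_itv => /andP[].
Qed.

Lemma prim_ge0 f x : Omega x -> (forall y, Omega y -> 0 <= f y) -> 0 <= prim f x.
Proof. by move=> Ox f0; apply: Rintegral_ge0 => y /(sub_Omega Ox); exact: f0. Qed.

Lemma prim_norm f x : Omega x -> intO f -> `|prim f x| <= prim (fun x => `|f x|) x.
Proof. by move=> Ox If; apply: le_normr_Rintegral => //; exact: intO_sub. Qed.

Lemma prim0 f : prim f 0 = 0.
Proof. by rewrite /prim set_itv1 Rintegral_set1. Qed.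

Lemma prim1 f : prim f 1 = I f. Proof. by []. Qed.

Lemma prim_cst c x : Omega x -> prim (fun=> c) x = c * x.
Proof.
move=> /OmegaP/andP[x0 x1].
have E : mu `[0, x] = x%:E.
  rewrite lebesgue_measure_itv/= lte_fin.
  by case: ltgtP x0 => // [x0 _|<- _]; rewrite ?oppr0 ?adde0.
by rewrite /prim Rintegral_cst// [X in fine X]E.
Qed.

Lemma prim_sub f x y : Omega x -> Omega y -> x <= y -> intO f ->
  prim f y - prim f x = \int[mu]_(z in `]x, y]) f z.
Proof.
move=> /OmegaP/andP[x0 x1] Oy xy If; apply: Rintegral_itvB; rewrite ?bnd_simp//.
exact: intO_sub.
Qed.

Lemma prim_mono f x y : Omega x -> Omega y -> x <= y -> intO f ->
  (forall y, Omega y -> 0 <= f y) -> prim f x <= prim f y.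
Proof.
move=> Ox Oy xy If f0; rewrite -subr_ge0 prim_sub//; apply: Rintegral_ge0 => z.
rewrite /= in_itv/= => /andP[xz zy]; apply: f0; apply/OmegaP.
by move: Ox Oy => /OmegaP/andP[? ?] /OmegaP/andP[? ?]; apply/andP; split; lra.
Qed.

Lemma prim_le_I f x : Omega x -> intO f -> (forall y, Omega y -> 0 <= f y) ->
  prim f x <= I f.
Proof.
move=> Ox If f0; rewrite -prim1; apply: prim_mono => //; first exact: Omega1.
by move: Ox => /OmegaP/andP[].
Qed.

Lemma prim_sub_le f g x y : Omega x -> Omega y -> x <= y -> intO f -> intO g ->
  (forall z, Omega z -> x < z <= y -> f z <= g z) ->
  prim f y - prim f x <= prim g y - prim g x.
Proof.
move=> Ox Oy xy If Ig fg; rewrite !prim_sub//.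
have sub : `]x, y]%classic `<=` Omega.
  move=> z /=; rewrite in_itv/= => /andP[xz zy]; apply/OmegaP.
  by move: Ox Oy => /OmegaP/andP[? ?] /OmegaP/andP[? ?]; apply/andP; split; lra.
apply: le_Rintegral => //.
- exact: (@integrableS _ _ _ mu Omega _ _ measurable_Omega _ sub If).
- exact: (@integrableS _ _ _ mu Omega _ _ measurable_Omega _ sub Ig).
- by move=> z zxy; apply: fg; [exact: sub|move: zxy; rewrite /= in_itv].
Qed.

Lemma prim_sub_eq f g x y : Omega x -> Omega y -> x <= y -> intO f -> intO g ->
  (forall z, Omega z -> x < z <= y -> f z = g z) ->
  prim f y - prim f x = prim g y - prim g x.
Proof.
move=> Ox Oy xy If Ig fg; apply/eqP; rewrite eq_le.
by rewrite !prim_sub_le// => z Oz zP; rewrite fg.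
Qed.

Lemma prim_sub_ge f (m : R) x y : Omega x -> Omega y -> x <= y -> intO f ->
  (forall z, Omega z -> x < z <= y -> m <= f z) ->
  m * (y - x) <= prim f y - prim f x.
Proof.
move=> Ox Oy xy If mf.
have -> : m * (y - x) = prim (fun=> m) y - prim (fun=> m) x by rewrite !prim_cst// mulrBr.
by apply: prim_sub_le => //; exact: intO_cst.
Qed.

Lemma prim_continuous f : intO f -> {within Omega, continuous (prim f)}.
Proof. by move=> If; exact: (parameterized_integral_continuous ler01 If). Qed.

Lemma within_measurable f : {within Omega, continuous f} -> measurable_fun Omega f.
Proof. exact: subspace_continuous_measurable_fun. Qed.

Lemma prim_measurable f : intO f -> measurable_fun Omega (prim f).
Proof. by move=> If; apply: within_measurable; exact: prim_continuous. Qed.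

Lemma prim_bounded f x : Omega x -> intO f -> `|prim f x| <= I (fun x => `|f x|).
Proof.
by move=> Ox If; apply: (le_trans (prim_norm Ox If)); apply: prim_le_I => //; exact: intO_norm.
Qed.

Lemma intO_primM f g : intO f -> intO g -> intO (fun x => prim f x * g x).
Proof.
move=> If Ig; apply: (intO_bddM (C := I (fun x => `|f x|))) => //.
  exact: prim_measurable.
by move=> x Ox; exact: prim_bounded.
Qed.

End IntegralOverOmega.

(** * Calculus of absolutely continuous functions *)

Section AbsolutelyContinuous.
Context {R : realType}.
Local Notation mu := (@lebesgue_measure R).
Local Notation Omega := (@Omega R).
Implicit Types (f g : R -> R) (x y : R).
Hint Resolve measurable_Omega : core.

Lemma Rintegral_EFin d (T : measurableType d) (m : {measure set T -> \bar R}) (D : set T) (h : T -> R) :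
  measurable D -> m.-integrable D (EFin \o h) ->
  (\int[m]_(y in D) (h y)%:E)%E = (\int[m]_(y in D) h y)%:E.
Proof.
move=> mD ih; rewrite /Rintegral fineK//.
exact: integrable_fin_num.
Qed.

(** Fubini on the triangle [s < r <= x] with the integrand [f s * g r]. *)
Lemma triangle_fubini f g x : intO f -> intO g -> Omega x ->
  prim (fun s => f s * (prim g x - prim g s)) x = prim (fun r => g r * prim f r) x.
Proof.
move=> If Ig Ox; pose D : set R := `[0, x]%classic.
have mD : measurable D by exact: measurable_itv.
have DO : D `<=` Omega by exact: sub_Omega.
pose A : set (measurableTypeR R * measurableTypeR R) := [set z | (z.1 : R) < z.2].
have mA : measurable A.
  rewrite /A; have := @measurable_fun_ltr _ (measurableTypeR R * measurableTypeR R)%type R setT fst snd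
    measurable_fst measurable_snd.
  by move=> /(_ measurableT [set true])/=; rewrite setTI; apply.
have If' : mu.-integrable D (EFin \o f) by exact: intO_sub.
have Ig' : mu.-integrable D (EFin \o g) by exact: intO_sub.
have Tf : mu.-integrable setT (EFin \o (f \_ D)).
  by rewrite -restrict_EFin; apply/integrable_restrict => //; rewrite setTI.
have Tg : mu.-integrable setT (EFin \o (g \_ D)).
  by rewrite -restrict_EFin; apply/integrable_restrict => //; rewrite setTI.
have mf : measurable_fun setT (f \_ D : measurableTypeR R -> R).
  by apply/measurable_EFinP; exact: (measurable_int mu).
have mg : measurable_fun setT (g \_ D : measurableTypeR R -> R).
  by apply/measurable_EFinP; exact: (measurable_int mu).
pose H (z : measurableTypeR R * measurableTypeR R) : R := (f \_ D) z.1 * (g \_ D) z.2 * \1_A z.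
have mH : measurable_fun setT H.
  apply: measurable_funM; last exact: measurable_indic.
  by apply: measurable_funM; [exact: (measurableT_comp mf measurable_fst)|
    exact: (measurableT_comp mg measurable_snd)].
have mEH : measurable_fun setT (EFin \o H) by exact/measurable_EFinP.
have mAH : measurable_fun setT (abse \o (EFin \o H)).
  by apply/measurableT_comp.
have inH s r : `|H (s, r)| <= `|(f \_ D) s| * `|(g \_ D) r|.
  rewrite /H !normrM -[leRHS]mulr1 ler_wpM2l ?mulr_ge0//.
  by rewrite indicE; case: (_ \in _); rewrite ?normr1 ?normr0.
have nTf : mu.-integrable setT (EFin \o (fun s => `|(f \_ D) s|)) by exact: integrable_norm Tf.
have nTg : mu.-integrable setT (EFin \o (fun s => `|(g \_ D) s|)) by exact: integrable_norm Tg.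
have mnf : measurable_fun setT (fun s : measurableTypeR R => `|(f \_ D) s|).
  by apply/measurable_EFinP; exact: (measurable_int mu nTf).
have mng : measurable_fun setT (fun s : measurableTypeR R => `|(g \_ D) s|).
  by apply/measurable_EFinP; exact: (measurable_int mu nTg).
have IH : (mu \x mu)%E.-integrable setT (EFin \o H).
  apply/integrable12ltyP => //.
  pose G := (\int[mu]_y `|(g \_ D) y|).
  have G0 : 0 <= G by rewrite /G; apply: Rintegral_ge0.
  apply: (@le_lt_trans _ _ (\int[mu]_s (G * `|(f \_ D) s|)%:E)%E).
    apply: ge0_le_integral => //.
    - by move=> s _; apply: integral_ge0.
    - apply: (@measurable_fun_fubini_tonelli_F _ _ (measurableTypeR R) (measurableTypeR R) R mu
        (abse \o (EFin \o H)) mAH) => z.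
      exact: abse_ge0.
    - apply/measurable_EFinP; exact: (measurable_funM (measurable_cst G) mnf).
    move=> s _; rewrite mulrC EFinM /G -Rintegral_EFin//.
    rewrite -ge0_integralZl//; last by apply/measurable_EFinP.
    apply: ge0_le_integral => //.
    - exact: (measurable_fun_pair2 s mAH).
    - by apply/measurable_EFinP; exact: (measurable_funM (measurable_cst _) mng).
    by move=> r _; rewrite -EFinM lee_fin; exact: inH.
  rewrite Rintegral_EFin ?ltry//.
  exact: (integrableZl _ G nTf).
have intOpg : intO (fun s => f s * (prim g x - prim g s)).
  apply: (@intO_eq _ (fun s => (prim g x - prim g s) * f s)) => [s _|]; first by rewrite mulrC.
  apply: (intO_bddM (C := I (fun x => `|g x|) + I (fun x => `|g x|))) => //.
    by apply: measurable_funB => //; exact: prim_measurable.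
  by move=> s Os; rewrite (le_trans (ler_normB _ _))// lerD// prim_bounded.
have intOpf : intO (fun r => g r * prim f r).
  by apply: (@intO_eq _ (fun r => prim f r * g r)) => [r _|]; [rewrite mulrC|exact: intO_primM].
have inner1 s : (\int[mu]_r (H (s, r))%:E)%E =
    (((fun s => f s * (prim g x - prim g s)) \_ D) s)%:E.
  rewrite patchE; case: ifPn => [sD|sD]; last first.
    rewrite -[RHS](integral0 mu setT); apply: eq_integral => r _.
    by rewrite /H/= patchE (negbTE sD) !mul0r.
  have Os : Omega s by apply: DO; exact: set_mem.
  have sx : s <= x by move: (set_mem sD); rewrite /D/= in_itv/= => /andP[].
  have Igs : mu.-integrable `]s, x] (EFin \o g).
    apply: integrableS Ig' => // z /=; rewrite /D/= !in_itv/= => /andP[sz ->].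
    by move: Os => /OmegaP/andP[s0 _]; rewrite (le_trans s0 (ltW sz)).
  rewrite (prim_sub Os Ox sx Ig) -RintegralZl// -Rintegral_EFin//; last first.
    exact: (integrableZl _ (f s) Igs).
  rewrite [RHS]integral_mkcond; apply: eq_integral => r _.
  rewrite /H/= restrict_EFin /patch sD indicE/=.
  have -> : ((s, r) \in A) = (s < r) by apply/idP/idP; rewrite inE.
  have -> : (r \in D) = (0 <= r <= x) by apply/idP/idP; rewrite inE /D/= in_itv.
  have -> : (r \in `]s, x]%classic) = (s < r <= x) by apply/idP/idP; rewrite inE/= in_itv.
  move: Os => /OmegaP/andP[s0 _].
  case: (ltP s r) => [sr|]; last by rewrite /= mulr0.
  by rewrite (le_trans s0 (ltW sr))/= mulr1; case: ifP; rewrite ?mulr0.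
have inner2 r : (\int[mu]_s (H (s, r))%:E)%E = (((fun r => g r * prim f r) \_ D) r)%:E.
  rewrite patchE; case: ifPn => [rD|rD]; last first.
    rewrite -[RHS](integral0 mu setT); apply: eq_integral => s _.
    by rewrite /H/= [(g \_ D) r]patchE (negbTE rD) mulr0 mul0r.
  have Or : Omega r by apply: DO; exact: set_mem.
  have rx : r <= x by move: (set_mem rD); rewrite /D/= in_itv/= => /andP[].
  have Ifr : mu.-integrable `[0, r[ (EFin \o f).
    by apply: integrableS (intO_sub Or If) => //; apply: subset_itvl; rewrite bnd_simp.
  rewrite /prim -Rintegral_itv_bndo_bndc// -RintegralZl//.
  rewrite -Rintegral_EFin//; last exact: (integrableZl _ (g r) Ifr).
  rewrite [RHS]integral_mkcond; apply: eq_integral => s _.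
  rewrite /H/= restrict_EFin /patch rD indicE/=.
  have -> : ((s, r) \in A) = (s < r) by apply/idP/idP; rewrite inE.
  have -> : (s \in D) = (0 <= s <= x) by apply/idP/idP; rewrite inE /D/= in_itv.
  have -> : (s \in `[0, r[%classic) = (0 <= s < r) by apply/idP/idP; rewrite inE/= in_itv.
  case: (ltP s r) => [sr|]; last by rewrite /= andbF mulr0.
  rewrite (le_trans (ltW sr) rx) !andbT mulr1.
  by case: ifP; rewrite ?mul0r// mulrC.
have e1 : (\int[mu]_s \int[mu]_r (H (s, r))%:E)%E =
    (prim (fun s => f s * (prim g x - prim g s)) x)%:E.
  rewrite /prim -[RHS]Rintegral_EFin//; last exact: intO_sub.
  by rewrite [RHS]integral_mkcond; apply: eq_integral => s _; rewrite inner1 restrict_EFin.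
have e2 : (\int[mu]_r \int[mu]_s (H (s, r))%:E)%E = (prim (fun r => g r * prim f r) x)%:E.
  rewrite /prim -[RHS]Rintegral_EFin//; last exact: intO_sub.
  by rewrite [RHS]integral_mkcond; apply: eq_integral => r _; rewrite inner2 restrict_EFin.
by have := Fubini IH; rewrite /= e1 e2 => -[].
Qed.

(** The product rule for absolutely continuous functions, in integrated form. *)
Lemma prim_mul f g (F0 G0 x : R) : intO f -> intO g -> Omega x ->
  (F0 + prim f x) * (G0 + prim g x) =
  F0 * G0 + prim (fun y => f y * (G0 + prim g y) + g y * (F0 + prim f y)) x.
Proof.
move=> If Ig Ox.
have Ifg : intO (fun y => f y * prim g y).
  by apply: (@intO_eq _ (fun r => prim g r * f r)) => [r _|]; [rewrite mulrC|exact: intO_primM].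
have Igf : intO (fun y => g y * prim f y).
  by apply: (@intO_eq _ (fun r => prim f r * g r)) => [r _|]; [rewrite mulrC|exact: intO_primM].
have -> : prim (fun y => f y * (G0 + prim g y) + g y * (F0 + prim f y)) x =
   prim (fun y => (G0 * f y + f y * prim g y) + (F0 * g y + g y * prim f y)) x.
  by apply: prim_eq => // y _; ring.
rewrite !prim_D// ?prim_Z//; try (by apply: intOD => //; exact: intOZ); try exact: intOZ.
have := triangle_fubini If Ig Ox.
have -> : prim (fun s => f s * (prim g x - prim g s)) x =
    prim (fun s => prim g x * f s - f s * prim g s) x.
  by apply: prim_eq => // y _; ring.
rewrite prim_B// ?prim_Z//; last exact: intOZ.
move=> H; rewrite -H; ring.
Qed.

Lemma intO_Mprim f g (a : R) : intO f -> intO g -> intO (fun y => g y * (a + prim f y)).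
Proof.
move=> If Ig; apply: (@intO_eq _ (fun y => a * g y + prim f y * g y)) => [y _|].
  by rewrite mulrDr [g y * a]mulrC [g y * _]mulrC.
by apply: intOD; [exact: intOZ|exact: intO_primM].
Qed.

Lemma prim_dominated (f_ : nat -> R -> R) f g x : Omega x ->
  (forall n, intO (f_ n)) -> intO g ->
  (forall y n, Omega y -> `|f_ n y| <= g y) ->
  (forall y, Omega y -> f_ ^~ y @ \oo --> f y) ->
  intO f /\ prim (f_ n) x @[n --> \oo] --> prim f x.
Proof.
move=> Ox If_ Ig fg ff.
have cvgE y : Omega y -> (EFin \o f_ n) y @[n --> \oo] --> (EFin \o f) y.
  by move=> Oy; apply: cvg_EFin; [exact: nearW|exact: ff].
have mf : measurable_fun Omega (EFin \o f).
  apply: (emeasurable_fun_cvg (fun n => EFin \o f_ n)) => // n.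
  exact: (measurable_int mu (If_ n)).
have DC (D : set R) : measurable D -> D `<=` Omega -> mu.-integrable D (EFin \o f) /\
    (\int[mu]_(y in D) (EFin \o f_ n) y)%E @[n --> \oo] --> (\int[mu]_(y in D) (EFin \o f) y)%E.
  move=> mD DO.
  have [] := @dominated_convergence _ _ _ mu D mD (fun n => EFin \o f_ n) (EFin \o f) (EFin \o g).
  - move=> n; exact: (measurable_funS measurable_Omega DO (measurable_int mu (If_ n))).
  - exact: (measurable_funS measurable_Omega DO mf).
  - by apply: aeW => y /DO; exact: cvgE.
  - exact: (@integrableS _ _ _ mu Omega D (EFin \o g) measurable_Omega mD DO Ig).
  - by apply: aeW => y n /DO Oy; rewrite lee_fin fg.
  by [].
have [If _] := DC _ measurable_Omega (@subset_refl _ Omega); split => //.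
have [Ifx H] := DC _ (measurable_itv `[0, x]) (sub_Omega Ox).
apply: fine_cvg; rewrite fineK; last exact: (integrable_fin_num _ Ifx).
exact: H.
Qed.

(** The chain rule for the exponential of a primitive. Term by term [prim f ^+
n.+1 = n.+1 * prim (f * prim f ^+ n)] by the product rule, and the exponential
series passes under the integral by domination. *)
Lemma exp_prim f x : intO f -> Omega x ->
  intO (fun y => f y * expR (prim f y)) /\
  expR (prim f x) = 1 + prim (fun y => f y * expR (prim f y)) x.
Proof.
move=> If Ox.
pose M := I (fun x => `|f x|).
have powI n : intO (fun y => f y * prim f y ^+ n).
  apply: (@intO_eq _ (fun y => prim f y ^+ n * f y)) => [y _|]; first by rewrite mulrC.
  apply: (intO_bddM (C := M ^+ n)) => //.
    by apply: measurable_funX; exact: prim_measurable.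
  move=> y Oy; rewrite normrX; apply: lerXn2r; rewrite ?nnegrE//; last exact: prim_bounded.
  exact: le_trans (normr_ge0 _) (prim_bounded Oy If).
have powE n y : Omega y -> prim f y ^+ n.+1 = n.+1%:R * prim (fun y => f y * prim f y ^+ n) y.
  elim: n y => [|n IH] y Oy.
    by rewrite expr1 mul1r; apply: prim_eq => // z _; rewrite expr0 mulr1.
  have cI := intOZ n.+1%:R (powI n).
  have := prim_mul 0 0 cI If Oy; rewrite !add0r mul0r add0r prim_Z// -IH// -exprSr => ->.
  rewrite (@prim_eq _ _ (fun z => n.+2%:R * (f z * prim f z ^+ n.+1)) y Oy) ?prim_Z//.
  move=> z Oz; rewrite !add0r prim_Z// -IH// -[n.+2%:R]natr1 [prim f z ^+ n.+1 in LHS]exprSr.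
  by rewrite [prim f z ^+ n.+1 in RHS]exprSr; ring.
pose e_ n y := \sum_(0 <= k < n) (k`!%:R)^-1 * prim f y ^+ k.
have e_cvg y : e_ n y @[n --> \oo] --> expR (prim f y).
  have -> : (fun n => e_ n y) = series (exp_coeff (prim f y)).
    by apply/funext => n; rewrite /e_ /series/=; apply: eq_bigr => k _; rewrite mulrC.
  exact: is_cvg_series_exp_coeff.
have e_bound n y : Omega y -> `|e_ n y| <= expR M.
  move=> Oy; have M0 : 0 <= M by exact: le_trans (normr_ge0 _) (prim_bounded Oy If).
  apply: (@le_trans _ _ (\sum_(0 <= k < n) (k`!%:R)^-1 * M ^+ k)).
    apply: le_trans (ler_norm_sum _ _ _) _; apply: ler_sum => k _.
    rewrite normrM normfV normr_nat ler_wpM2l// normrX.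
    by apply: lerXn2r; rewrite ?nnegrE//; exact: prim_bounded.
  have -> : \sum_(0 <= k < n) (k`!%:R)^-1 * M ^+ k = series (exp_coeff M) n.
    by rewrite /series/=; apply: eq_bigr => k _; rewrite mulrC.
  apply: nondecreasing_cvgn_le; last exact: is_cvg_series_exp_coeff.
  apply/nondecreasing_seqP => k; rewrite /series/= big_nat_recr//= lerDl.
  by rewrite divr_ge0// exprn_ge0.
have me n : measurable_fun Omega (e_ n).
  apply: measurable_sum => k; apply: measurable_funM => //.
  by apply: measurable_funX; exact: prim_measurable.
have Ie n : intO (fun y => f y * e_ n y).
  apply: (@intO_eq _ (fun y => e_ n y * f y)) => [y _|]; first by rewrite mulrC.
  by apply: (intO_bddM (C := expR M)) => // y; exact: e_bound.
have e_prim n y : Omega y -> e_ n.+1 y = 1 + prim (fun z => f z * e_ n z) y.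
  move=> Oy; elim: n => [|n IH].
    rewrite /e_ big_nat1 expr0 fact0 invr1 mulr1 (@prim_eq _ _ (fun=> 0) y Oy).
      by rewrite prim_cst// mul0r addr0.
    by move=> z _; rewrite big_geq// mulr0.
  rewrite /e_ big_nat_recr//= -/(e_ n.+1 y) IH powE//.
  rewrite [in RHS](@prim_eq _ _ (fun z => f z * e_ n z + (n`!%:R)^-1 * (f z * prim f z ^+ n)) y Oy).
    rewrite prim_D// ?prim_Z//; last exact: intOZ.
    rewrite -addrA; congr (_ + (_ + _)).
    have n0 : n.+1%:R != 0 :> R by rewrite pnatr_eq0.
    by rewrite factS natrM invfM [n.+1%:R^-1 * _]mulrC -mulrA [n.+1%:R^-1 * _]mulrA mulVf ?mul1r.
  by move=> z _; rewrite /e_ big_nat_recr//= mulrDr; congr (_ + _); ring.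
have Hcvg y : Omega y -> f y * e_ n y @[n --> \oo] --> f y * expR (prim f y).
  by move=> _; apply: cvgMr; exact: e_cvg.
have Hbnd y n : Omega y -> `|f y * e_ n y| <= expR M * `|f y|.
  by move=> Oy; rewrite normrM mulrC ler_wpM2r// e_bound.
have [Ifin cvg1] := prim_dominated Ox Ie (intOZ _ (intO_norm If)) Hbnd Hcvg.
split => //.
have c1 : e_ n.+1 x @[n --> \oo] --> expR (prim f x).
  by have := e_cvg x; rewrite -(cvg_shiftS (fun n => e_ n x)).
have c2 : e_ n.+1 x @[n --> \oo] --> 1 + prim (fun y => f y * expR (prim f y)) x.
  under eq_fun do rewrite e_prim//.
  by apply: cvgD => //; exact: cvg_cst.
exact: (cvg_unique _ c1 c2).
Qed.

End AbsolutelyContinuous.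

(** * A linear initial value problem with nonnegative data *)

Section InitialValueProblem.
Context {R : realType}.
Local Notation mu := (@lebesgue_measure R).
Local Notation Omega := (@Omega R).
Implicit Types (x y : R).
Hint Resolve measurable_Omega : core.

Lemma prim_exp (lam x : R) : Omega x ->
  intO (fun y => expR (lam * y)) /\ lam * prim (fun y => expR (lam * y)) x = expR (lam * x) - 1.
Proof.
move=> Ox; have cO y : Omega y -> prim (fun=> lam) y = lam * y by exact: prim_cst.
have IE : intO (fun y => expR (lam * y)).
  have mE : measurable_fun Omega (fun y => expR (lam * y)).
    apply: within_measurable; apply: continuous_subspaceT => z.
    by apply: continuous_comp; [exact: mulrl_continuous|exact: continuous_expR].
  apply: (intO_bounded (C := expR `|lam|) mE) => y /OmegaP/andP[y0 y1].
  rewrite ger0_norm ?expR_ge0// ler_expR (le_trans (ler_norm _))// normrM (ger0_norm y0).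
  by rewrite ler_piMr.
split => //; have [_] := exp_prim (intO_cst lam) Ox.
rewrite cO// (@prim_eq _ _ (fun y => lam * expR (lam * y)) x Ox) ?prim_Z//.
  by move=> ->; rewrite [1 + _]addrC addrK.
by move=> y Oy; rewrite cO.
Qed.

(** [Psi' = r xi], [xi' = w Psi + f], [Psi 0 = 0], [xi 0 = xi0] with all data
nonnegative: the Picard iteration started at 0 is monotone and converges without
any contraction argument. The growing weight in the invariant [good] is an
explicit supersolution that bounds the iterates. The last clause says that the
solution stays 0 as long as nothing has entered the equation. *)
Lemma ivp (w f r : R -> R) (xi0 Wm Rm : R) :
  measurable_fun Omega w -> (forall x, Omega x -> 0 <= w x <= Wm) ->
  intO f -> (forall x, Omega x -> 0 <= f x) ->
  measurable_fun Omega r -> (forall x, Omega x -> 0 <= r x <= Rm) ->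
  0 <= xi0 ->
  exists Psi xi : R -> R,
  [/\ intO (fun y => w y * Psi y + f y), intO (fun y => r y * xi y),
      forall x, Omega x -> xi x = xi0 + prim (fun y => w y * Psi y + f y) x,
      forall x, Omega x -> Psi x = prim (fun y => r y * xi y) x &
      forall x, Omega x -> 0 <= Psi x /\ (xi0 + prim f x = 0 -> Psi x = 0)].
Proof.
move=> mw wP If f0 mr rP xi00.
have Wm0 : 0 <= Wm by have /andP[] := wP _ Omega0; exact: le_trans.
have Rm0 : 0 <= Rm by have /andP[] := rP _ Omega0; exact: le_trans.
pose A x := xi0 + prim f x.
have A0 x : Omega x -> 0 <= A x by move=> Ox; rewrite addr_ge0// prim_ge0.
have Amono x y : Omega x -> Omega y -> x <= y -> A x <= A y.
  by move=> Ox Oy xy; rewrite lerD2l prim_mono.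
have Omega_le1 x : Omega x -> x <= 1 by move=> /OmegaP/andP[].
(* [C x * expR (lam * x)] is a supersolution once [lam] absorbs both coefficients *)
pose lam := 1 + 2 * Rm * Wm; have lam1 : 1 <= lam by rewrite lerDl !mulr_ge0.
have lam0 : 0 < lam by exact: lt_le_trans lam1.
pose C x := 2 * Rm * A x.
have C0 x : Omega x -> 0 <= C x by move=> Ox; rewrite !mulr_ge0// A0.
have Cmono x y : Omega x -> Omega y -> x <= y -> C x <= C y.
  by move=> Ox Oy xy; rewrite ler_wpM2l ?mulr_ge0// Amono.
pose X P x := xi0 + prim (fun y => w y * P y + f y) x.
pose S P x := prim (fun y => r y * X P y) x.
pose good (P : R -> R) := measurable_fun Omega P /\ forall x, Omega x -> 0 <= P x <= C x * expR (lam * x).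
pose B := C 1 * expR lam.
have goodB P x : good P -> Omega x -> `|P x| <= B.
  move=> [_ PP] Ox; have /andP[P0 P1] := PP _ Ox; rewrite ger0_norm// (le_trans P1)//.
  rewrite ler_pM ?expR_ge0 ?C0 ?Cmono ?Omega_le1//; first exact: Omega1.
  by rewrite ler_expR ler_piMr ?Omega_le1// ltW.
have wB x : Omega x -> `|w x| <= Wm.
  by move=> Ox; have /andP[w0 w1] := wP _ Ox; rewrite ger0_norm.
have rB x : Omega x -> `|r x| <= Rm.
  by move=> Ox; have /andP[w0 w1] := rP _ Ox; rewrite ger0_norm.
have IP P : good P -> intO P.
  by move=> gP; apply: (intO_bounded (C := B)) => [|x Ox]; [case: gP|exact: goodB].
have IX P : good P -> intO (fun y => w y * P y + f y).
  by move=> gP; apply: intOD => //; apply: (intO_bddM mw wB); exact: IP.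
have mX P : good P -> measurable_fun Omega (X P).
  by move=> gP; apply: measurable_funD => //; apply: prim_measurable; exact: IX.
have X0 P x : good P -> Omega x -> 0 <= X P x.
  move=> gP Ox; rewrite addr_ge0// prim_ge0// => y Oy; rewrite addr_ge0// ?f0// mulr_ge0//.
    by have /andP[] := wP _ Oy.
  by have [_ /(_ _ Oy)/andP[]] := gP.
have Xle P x : good P -> Omega x -> X P x <= A x + Wm * C x * expR (lam * x) / lam.
  move=> gP Ox; rewrite /X /A -addrA lerD2l.
  have [IE PE] := prim_exp lam Ox.
  rewrite prim_D//; last by apply: (intO_bddM mw wB); exact: IP.
  rewrite [leLHS]addrC; apply: lerD => //.
  have := @prim_le R (fun y => w y * P y) (fun y => Wm * C x * expR (lam * y)) x Ox _ (intOZ _ IE).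
  move=> H; apply: le_trans (H _ _) _.
  - by apply: (intO_bddM mw wB); exact: IP.
  - move=> y Oy yx; rewrite -mulrA; have /andP[w0 w1] := wP _ Oy.
    have [_ /(_ _ Oy)/andP[? PC]] := gP; rewrite ler_pM// (le_trans PC)//.
    by rewrite ler_wpM2r ?expR_ge0// Cmono.
  rewrite prim_Z// ler_pdivlMr//.
  rewrite [leLHS](_ : _ = Wm * C x * (lam * prim (fun y => expR (lam * y)) x)); last by ring.
  by rewrite PE; apply: ler_wpM2l; [apply: mulr_ge0 => //; exact: C0|rewrite gerBl].
have XB P x : good P -> Omega x -> `|X P x| <= A 1 + Wm * C 1 * expR lam / lam.
  move=> gP Ox; rewrite ger0_norm ?X0//; apply: le_trans (Xle _ _ gP Ox) _.
  apply: lerD; first by apply: Amono; [|exact: Omega1|exact: Omega_le1].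
  apply: ler_wpM2r; first by rewrite invr_ge0 ltW.
  apply: ler_pM; [by apply: mulr_ge0 => //; exact: C0|exact: expR_ge0| |].
    by apply: ler_wpM2l => //; apply: Cmono; [|exact: Omega1|exact: Omega_le1].
  by rewrite ler_expR ler_piMr ?Omega_le1// ltW.
have IXX P : good P -> intO (X P).
  by move=> gP; apply: (intO_bounded (C := A 1 + Wm * C 1 * expR lam / lam)) => [|x Ox]; [exact: mX|exact: XB].
have IrX P : good P -> intO (fun y => r y * X P y).
  by move=> gP; apply: (intO_bddM mr rB); exact: IXX.
have goodS P : good P -> good (S P).
  move=> gP; split; first by apply: prim_measurable; exact: IrX.
  move=> x Ox; apply/andP; split.
    apply: prim_ge0 => // y Oy; rewrite mulr_ge0 ?X0//.
    by have /andP[] := rP _ Oy.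
  have [IE PE] := prim_exp lam Ox.
  have I1 : intO (fun y => Rm * A x + Rm * Wm * C x / lam * expR (lam * y)).
    by apply: intOD; [exact: intO_cst|exact: intOZ].
  apply: (@le_trans _ _ (prim (fun y => Rm * A x + Rm * Wm * C x / lam * expR (lam * y)) x)).
    apply: prim_le => //; first exact: IrX.
    move=> y Oy yx; have /andP[r0 r1] := rP _ Oy.
    apply: (@le_trans _ _ (Rm * (A x + Wm * C x * expR (lam * y) / lam))).
      rewrite ler_pM ?X0// (le_trans (Xle _ _ gP Oy))// lerD ?Amono//.
      rewrite ler_wpM2r ?invr_ge0 ?(ltW lam0)// ler_wpM2r ?expR_ge0//.
      by rewrite ler_wpM2l// Cmono.
    by rewrite mulrDr lerD2l le_eqVlt; apply/orP; left; apply/eqP; ring.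
  rewrite prim_D//; [|exact: intO_cst|exact: intOZ].
  rewrite prim_cst// prim_Z//; move: (Ox) => /OmegaP/andP[x0 x1].
  have e1 : 1 <= expR (lam * x) by rewrite -expR0 ler_expR mulr_ge0// ltW.
  have h1 : Rm * A x * x <= C x / 2 * expR (lam * x).
    rewrite (_ : C x / 2 = Rm * A x); last by rewrite /C; lra.
    by rewrite ler_wpM2l ?mulr_ge0 ?A0// (le_trans x1).
  suff : Rm * Wm * C x / lam * prim (fun y => expR (lam * y)) x <= C x / 2 * expR (lam * x) by lra.
  have -> : prim (fun y => expR (lam * y)) x = (expR (lam * x) - 1) / lam.
    by rewrite -PE mulrAC divff ?mul1r// gt_eqF.
  have h2 : (expR (lam * x) - 1) / lam <= expR (lam * x).
    rewrite ler_pdivrMr//; apply: (@le_trans _ _ (expR (lam * x) * 1)); first by rewrite mulr1 gerBl.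
    by rewrite ler_wpM2l// expR_ge0.
  have h3 : Rm * Wm * C x / lam <= C x / 2.
    rewrite ler_pdivrMr//; have -> : C x / 2 * lam = C x / 2 + Rm * Wm * C x by rewrite /lam; field.
    by rewrite lerDr divr_ge0 ?C0.
  have e0 : 0 <= (expR (lam * x) - 1) / lam.
    by rewrite divr_ge0 ?(ltW lam0)// subr_ge0.
  apply: ler_pM => //; apply: divr_ge0; last exact: ltW.
  by apply: mulr_ge0; [exact: mulr_ge0|exact: C0].
have monoS P Q : good P -> good Q -> (forall x, Omega x -> P x <= Q x) ->
    forall x, Omega x -> S P x <= S Q x.
  move=> gP gQ PQ x Ox; apply: prim_le => //; [exact: IrX|exact: IrX|].
  move=> y Oy _; have /andP[r0 _] := rP _ Oy; rewrite ler_wpM2l// lerD2l.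
  apply: prim_le => //; [exact: IX|exact: IX|] => z Oz _; rewrite lerD2r.
  by have /andP[w0 _] := wP _ Oz; rewrite ler_wpM2l// PQ.
pose P_ n := iter n S (fun=> 0).
have gP n : good (P_ n).
  elim: n => [|n IH]; last by rewrite /P_ iterS; exact: goodS.
  split; first exact: measurable_cst.
  by move=> x Ox; rewrite lexx/=; apply: mulr_ge0; [exact: C0|exact: expR_ge0].
have P_mono n x : Omega x -> P_ n x <= P_ n.+1 x.
  elim: n x => [|n IH] x Ox; last exact: (monoS _ _ (gP n) (gP n.+1) IH).
  by have [_ /(_ _ Ox)/andP[]] := gP 1%N.
pose Psi x := limn (fun n => P_ n x).
have Pcvg x : Omega x -> P_ n x @[n --> \oo] --> Psi x.
  move=> Ox; apply: nondecreasing_is_cvgn.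
    by apply/nondecreasing_seqP => n; exact: P_mono.
  by exists B => _ [n _ <-]; apply: le_trans (ler_norm _) (goodB _ _ (gP n) Ox).
have Pge x : Omega x -> 0 <= Psi x.
  move=> Ox; apply: (@le_trans _ _ (P_ 0%N x)); first by [].
  apply: (@nondecreasing_cvgn_le R (fun n => P_ n x)); last by apply/cvg_ex; exists (Psi x); exact: Pcvg.
  by apply/nondecreasing_seqP => n; exact: P_mono.
have cvgX x : Omega x -> intO (fun y => w y * Psi y + f y) /\ X (P_ n) x @[n --> \oo] --> X Psi x.
  move=> Ox.
  have [] := @prim_dominated R (fun n y => w y * P_ n y + f y) (fun y => w y * Psi y + f y)
     (fun y => Wm * B + f y) x Ox (fun n => IX _ (gP n)).
  - by apply: intOD => //; exact: intO_cst.
  - move=> y n Oy; rewrite (le_trans (ler_normD _ _))// lerD//; last by rewrite ger0_norm ?f0.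
    by rewrite normrM ler_pM ?wB// goodB.
  - by move=> y Oy; apply: cvgD; [apply: cvgMr; exact: Pcvg|exact: cvg_cst].
  by move=> h1 h2; split => //; apply: cvgD => //; exact: cvg_cst.
exists Psi, (X Psi).
have [I1 _] := cvgX _ Omega0.
have cvgS x : Omega x -> intO (fun y => r y * X Psi y) /\ S (P_ n) x @[n --> \oo] --> S Psi x.
  move=> Ox.
  apply: (@prim_dominated R (fun n y => r y * X (P_ n) y) (fun y => r y * X Psi y)
     (fun y => Rm * (A 1 + Wm * C 1 * expR lam / lam)) x Ox (fun n => IrX _ (gP n))).
  - exact: intO_cst.
  - by move=> y n Oy; rewrite normrM ler_pM ?rB ?XB.
  - by move=> y Oy; apply: cvgMr; have [] := cvgX _ Oy.
have [I2 _] := cvgS _ Omega0.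
split => // x Ox; last first.
  split; first exact: Pge.
  move=> A0x; have P0 n : P_ n x = 0.
    apply/eqP; rewrite eq_le; have [_ /(_ _ Ox)/andP[-> ]] := gP n.
    by rewrite /C /A A0x mulr0 mul0r => ->.
  rewrite /Psi; under eq_fun do rewrite P0.
  exact: lim_cst.
have [_ c1] := cvgS _ Ox.
have c2 : P_ n.+1 x @[n --> \oo] --> Psi x.
  by have := Pcvg _ Ox; rewrite -(cvg_shiftS (fun n => P_ n x)).
exact: (cvg_unique _ c2 c1).
Qed.

End InitialValueProblem.

(** * Square integrable functions with a weighted product *)

Section SquareIntegrable.
Context {R : realType}.
Local Notation mu := (@lebesgue_measure R).
Local Notation Omega := (@Omega R).
Implicit Types (f g : R -> R) (x y : R).
Hint Resolve measurable_Omega : core.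

Lemma inL2_measurable f : inL2 f -> measurable_fun Omega f. Proof. by case. Qed.

Lemma inL2_sqr f : inL2 f -> intO (fun x => f x ^+ 2). Proof. by case. Qed.

Lemma inL2_eq f g : (forall x, Omega x -> f x = g x) -> inL2 f -> inL2 g.
Proof.
move=> fg [mf If]; split; first by apply: eq_measurable_fun mf => x /set_mem /fg.
by apply: intO_eq If => x /fg ->.
Qed.

Lemma inL2_mul f g : inL2 f -> inL2 g -> intO (fun x => f x * g x).
Proof.
move=> [mf If] [mg Ig].
apply: (intO_le (g := fun x => f x ^+ 2 + g x ^+ 2)); first exact: measurable_funM.
  exact: intOD.
move=> x _; rewrite [leRHS]ger0_norm ?addr_ge0 ?sqr_ge0// ler_norml.
have := sqr_ge0 (f x - g x); have := sqr_ge0 (f x + g x).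
by have := sqr_ge0 (f x); have := sqr_ge0 (g x) => *; apply/andP; split; lra.
Qed.

Lemma inL2_bounded f (C : R) : measurable_fun Omega f ->
  (forall x, Omega x -> `|f x| <= C) -> inL2 f.
Proof.
move=> mf fC; split => //; apply: (intO_bounded (C := C ^+ 2)).
  exact: measurable_funX.
move=> x Ox; rewrite normrX; apply: lerXn2r; rewrite ?nnegrE//; last exact: fC.
exact: le_trans (normr_ge0 _) (fC _ Ox).
Qed.

Lemma inL2_bddM f g (C : R) : measurable_fun Omega g ->
  (forall x, Omega x -> `|g x| <= C) -> inL2 f -> inL2 (fun x => g x * f x).
Proof.
move=> mg gC [mf If]; split; first exact: measurable_funM.
apply: (@intO_eq _ (fun x => g x ^+ 2 * f x ^+ 2)) => [x _|]; first by rewrite exprMn.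
apply: (intO_bddM (C := C ^+ 2)) => //; first exact: measurable_funX.
move=> x Ox; rewrite normrX; apply: lerXn2r; rewrite ?nnegrE//; last exact: gC.
exact: le_trans (normr_ge0 _) (gC _ Ox).
Qed.

Lemma inL2_cst (c : R) : inL2 (fun=> c).
Proof. by apply: (inL2_bounded (C := `|c|)). Qed.

Lemma inL2D f g : inL2 f -> inL2 g -> inL2 (fun x => f x + g x).
Proof.
move=> f2 g2; split; first by apply: measurable_funD; apply: inL2_measurable.
apply: (@intO_eq _ (fun x => f x ^+ 2 + 2 * (f x * g x) + g x ^+ 2)) => [x _|].
  by rewrite sqrrD; ring.
apply: intOD; last exact: inL2_sqr.
by apply: intOD; [exact: inL2_sqr|apply: intOZ; exact: inL2_mul].
Qed.

Lemma inL2Z (c : R) f : inL2 f -> inL2 (fun x => c * f x).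
Proof. by move=> f2; apply: (inL2_bddM (C := `|c|)). Qed.

Lemma inL2B f g : inL2 f -> inL2 g -> inL2 (fun x => f x - g x).
Proof.
move=> f2 g2; apply: inL2D => //; apply: inL2_eq (inL2Z (-1) g2) => x _.
by rewrite mulN1r.
Qed.

Lemma inL2_intO f : inL2 f -> intO f.
Proof.
move=> f2; apply: intO_eq (inL2_mul f2 (inL2_cst 1)) => x _.
by rewrite mulr1.
Qed.

Definition L2pred : {pred (R -> R)} := fun f => `[< inL2 f >].

Lemma L2_submod_closed : submod_closed L2pred.
Proof.
split; first by apply/asboolP; exact: inL2_cst.
move=> a f g /asboolP f2 /asboolP g2; apply/asboolP.
by apply: inL2D => //; exact: inL2Z.
Qed.

End SquareIntegrable.

HB.instance Definition _ (R : realType) :=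
  GRing.isSubmodClosed.Build R (R -> R) (@L2pred R) (@L2_submod_closed R).

(** Functions, not classes modulo null sets: equality in this type is equality
at every point. *)
Record L2 (R : realType) : Type := MkL2 { L2_fun : R -> R; _ : L2_fun \in @L2pred R }.

HB.instance Definition _ (R : realType) := [isSub for @L2_fun R].
HB.instance Definition _ (R : realType) := [Choice of L2 R by <:].
HB.instance Definition _ (R : realType) := [SubChoice_isSubLmodule of L2 R by <:].

Section WeightedProduct.
Context {R : realType}.
Local Notation mu := (@lebesgue_measure R).
Local Notation Omega := (@Omega R).
Local Notation X := (L2 R).
Implicit Types (f g h : X) (x y : R).
Hint Resolve measurable_Omega : core.

Lemma L2_inL2 f : inL2 (L2_fun f).
Proof. by case: f => f /= /asboolP. Qed.

(** The value is 0 on functions that are not square integrable. *)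
Definition toL2 (f : R -> R) : X := insubd (0 : X) f.

Lemma toL2K (f : R -> R) : inL2 f -> L2_fun (toL2 f) = f.
Proof. by move=> f2; apply: (@insubdK _ _ X); apply/asboolP. Qed.

Lemma L2_funD f g x : L2_fun (f + g) x = L2_fun f x + L2_fun g x.
Proof. by []. Qed.

Lemma L2_funZ (a : R) f x : L2_fun (a *: f) x = a * L2_fun f x.
Proof. by []. Qed.

Lemma L2_funB f g x : L2_fun (f - g) x = L2_fun f x - L2_fun g x.
Proof. by []. Qed.

Variable rho : R -> R.
Variables (rmin rmax : R).
Hypothesis mrho : measurable_fun Omega rho.
Hypothesis rmin0 : 0 < rmin.
Hypothesis rhoP : forall x, Omega x -> rmin <= rho x <= rmax.

Lemma rho_gt0 x : Omega x -> 0 < rho x.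
Proof. by move=> /rhoP/andP[+ _]; exact: lt_le_trans. Qed.

Lemma rho_bdd x : Omega x -> `|rho x| <= rmax.
Proof. by move=> Ox; rewrite gtr0_norm ?rho_gt0//; have /andP[] := rhoP Ox. Qed.

Definition wip f g : R := I (fun x => rho x * (L2_fun f x * L2_fun g x)).

Lemma wip_int f g : intO (fun x => rho x * (L2_fun f x * L2_fun g x)).
Proof. by apply: (intO_bddM mrho rho_bdd); apply: inL2_mul; exact: L2_inL2. Qed.

Lemma wip_semi_inner : semi_inner wip.
Proof.
split.
- by move=> f g; apply: I_eq => x _; rewrite [L2_fun f x * _]mulrC.
- move=> f g h; rewrite /wip -I_D; [|exact: wip_int..].
  by apply: I_eq => x _; rewrite L2_funD; ring.
- move=> a f g; rewrite /wip -I_Z; last exact: wip_int.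
  by apply: I_eq => x _; rewrite L2_funZ; ring.
- move=> f; apply: I_ge0 => x Ox; rewrite mulr_ge0 ?(ltW (rho_gt0 Ox))//.
  by rewrite -expr2 sqr_ge0.
Qed.

Lemma nrm_eq0_ae f : nrm wip f = 0 -> ae_eq mu Omega (L2_fun f) (cst 0).
Proof.
move=> f0; have : wip f f = 0 by rewrite -(nrm_sqr wip_semi_inner) f0 expr0n.
rewrite /wip => /(I_eq0 (wip_int f f)) H; have {}H := H _.
have : ae_eq mu Omega (fun x => rho x * (L2_fun f x * L2_fun f x)) (cst 0).
  apply: H => x Ox; rewrite mulr_ge0 ?(ltW (rho_gt0 Ox))//.
  by rewrite -expr2 sqr_ge0.
apply: filterS => x /= H1 Ox; have /eqP := H1 Ox.
by rewrite -expr2 mulf_eq0 gt_eqF ?rho_gt0//= sqrf_eq0 => /eqP.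
Qed.

Lemma nrm_ae f g : ae_eq mu Omega (L2_fun f) (L2_fun g) -> nrm wip (f - g) = 0.
Proof.
move=> fg; rewrite /nrm (_ : wip (f - g) (f - g) = 0) ?sqrtr0//.
rewrite -[RHS](I_cst (0 : R)); apply: I_ae => //.
  exact: (intO_measurable (wip_int _ _)).
apply: filterS fg => x H Ox.
rewrite -[LHS]/(rho x * ((L2_fun f x - L2_fun g x) * (L2_fun f x - L2_fun g x))).
by rewrite (H Ox) subrr !mulr0.
Qed.

Lemma nrm_le_plain f : nrm wip f ^+ 2 <= rmax * I (fun x => L2_fun f x ^+ 2).
Proof.
have I2 : intO (fun x => L2_fun f x ^+ 2) by apply: inL2_sqr; exact: L2_inL2.
rewrite (nrm_sqr wip_semi_inner) /wip -I_Z//; apply: I_le.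
- exact: wip_int.
- exact: intOZ.
- move=> x Ox; rewrite -expr2 ler_wpM2r ?sqr_ge0//.
  by have /andP[] := rhoP Ox.
Qed.

End WeightedProduct.

(** * Sturm-Liouville operators in flux form *)

Section SturmLiouville.
Context {R : realType}.
Local Notation mu := (@lebesgue_measure R).
Local Notation Omega := (@Omega R).
Local Notation X := (L2 R).
Implicit Types (x y : R).
Hint Resolve measurable_Omega : core.

Variable rho : R -> R.
Variables (rmin rmax nu : R).
Hypothesis mrho : measurable_fun Omega rho.
Hypothesis mrhoV : measurable_fun Omega (fun x => (rho x)^-1).
Hypothesis rmin0 : 0 < rmin.
Hypothesis rhoP : forall x, Omega x -> rmin <= rho x <= rmax.
Hypothesis nu0 : 0 < nu.
Local Notation ip := (wip rho).
Local Notation rhoV := (fun x => (rho x)^-1).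

(** [Psi] has flux [xi = rho Psi'] with [xi' = eta], and satisfies the Dirichlet
conditions. Carrying the primitives as data replaces the second derivatives of
Sobolev spaces. *)
Definition flux_domain (Psi xi eta : R -> R) : Prop :=
  [/\ inL2 eta, forall x, Omega x -> xi x = xi 0 + prim eta x,
      forall x, Omega x -> Psi x = prim (fun y => (rho y)^-1 * xi y) x & Psi 1 = 0].

(** The graph of [P |-> - (nu / rho) (rho P')' + W P]. *)
Definition sturm_liouville (W : R -> R) (P h : X) : Prop := exists xi eta,
  flux_domain (L2_fun P) xi eta /\
  ae_eq mu Omega (fun x => rho x * L2_fun h x)
    (fun x => - nu * eta x + rho x * (W x * L2_fun P x)).

Let rho0 x : Omega x -> 0 < rho x. Proof. exact: (rho_gt0 rmin0 rhoP). Qed.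

Let rhoB x : Omega x -> `|rho x| <= rmax. Proof. exact: (rho_bdd rmin0 rhoP). Qed.

Let rhoVP x : Omega x -> 0 <= (rho x)^-1 <= rmin^-1.
Proof.
move=> Ox; have /andP[r1 r2] := rhoP Ox.
rewrite invr_ge0 (ltW (rho0 Ox))/= lef_pV2// ?posrE//.
exact: rho0.
Qed.

Let rhoVB x : Omega x -> `|(rho x)^-1| <= rmin^-1.
Proof. by move=> Ox; have /andP[r1 r2] := rhoVP Ox; rewrite ger0_norm; [exact: r2|exact: r1]. Qed.

Lemma flux_int Psi xi eta : flux_domain Psi xi eta ->
  [/\ intO eta, intO xi & intO (fun y => (rho y)^-1 * xi y)].
Proof.
move=> [eta2 xiE PsiE _]; have Ieta := inL2_intO eta2.
have Ixi : intO xi.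
  apply: (@intO_eq _ (fun x => xi 0 + prim eta x)) => [x Ox|]; first by rewrite [RHS]xiE.
  apply: (intO_bounded (C := `|xi 0| + I (fun x => `|eta x|))).
    by apply: measurable_funD => //; exact: prim_measurable.
  by move=> x Ox; rewrite (le_trans (ler_normD _ _))// lerD2l prim_bounded.
by split => //; exact: (intO_bddM mrhoV rhoVB).
Qed.

Lemma flux_inL2 Psi xi eta : flux_domain Psi xi eta -> inL2 Psi.
Proof.
move=> D; have [Ieta Ixi Irxi] := flux_int D; have [_ _ PsiE _] := D.
apply: (@inL2_eq _ (prim (fun y => (rho y)^-1 * xi y))) => [x Ox|]; first by rewrite PsiE.
apply: (inL2_bounded (C := I (fun x => `|(rho x)^-1 * xi x|))).
  exact: prim_measurable.
by move=> x Ox; exact: prim_bounded.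
Qed.

(** The boundary terms vanish because [Phi] does at both ends. *)
Lemma flux_by_parts Psi xi eta (Phi f : R -> R) : flux_domain Psi xi eta -> intO f ->
  (forall x, Omega x -> Phi x = prim f x) -> Phi 1 = 0 ->
  I (fun x => eta x * Phi x) = - I (fun x => xi x * f x).
Proof.
move=> D If PhiE Phi1; have [Ieta Ixi _] := flux_int D; have [_ xiE _ _] := D.
have H := prim_mul (xi 0) 0 Ieta If Omega1.
rewrite -xiE ?add0r in H; last exact: Omega1.
rewrite -PhiE ?Phi1 ?mulr0 ?add0r in H; last exact: Omega1.
have I1 : intO (fun x => eta x * Phi x).
  apply: (@intO_eq _ (fun x => prim f x * eta x)) => [x Ox|]; first by rewrite PhiE// mulrC.
  exact: intO_primM.
have I2 : intO (fun x => xi x * f x).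
  apply: (@intO_eq _ (fun x => xi 0 * f x + prim eta x * f x)) => [x Ox|]; first by rewrite [in RHS]xiE// mulrDl.
  by apply: intOD; [exact: intOZ|exact: intO_primM].
apply/eqP; rewrite -subr_eq0 opprK -I_D//; apply/eqP; rewrite [RHS]H prim1; apply: I_eq => x Ox.
by rewrite PhiE// xiE// add0r; ring.
Qed.

Variables (W : R -> R) (Wm : R).
Hypothesis mW : measurable_fun Omega W.
Hypothesis WP : forall x, Omega x -> 0 <= W x <= Wm.

Let WB x : Omega x -> `|W x| <= Wm.
Proof. by move=> Ox; have /andP[r1 r2] := WP Ox; rewrite ger0_norm. Qed.

(** Symmetry and positivity of the operator are visible on this form. *)
Lemma sturm_liouville_form P h xiP etaP Q xi eta :
  flux_domain (L2_fun P) xiP etaP ->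
  ae_eq mu Omega (fun x => rho x * L2_fun h x)
    (fun x => - nu * etaP x + rho x * (W x * L2_fun P x)) ->
  flux_domain (L2_fun Q) xi eta ->
  ip h Q = nu * I (fun x => (rho x)^-1 * (xiP x * xi x)) + I (fun x => rho x * (W x * (L2_fun P x * L2_fun Q x))).
Proof.
move=> DP hE DQ.
have [_ _ IrxiQ] := flux_int DQ; have [_ _ QE Q1] := DQ.
have BP := flux_by_parts DP IrxiQ QE Q1.
have [Ieta Ixi _] := flux_int DP.
have [eta2 _ _ _] := DP.
have PQ : inL2 (fun x => L2_fun Q x) by exact: L2_inL2.
have I1 : intO (fun x => etaP x * L2_fun Q x) by exact: inL2_mul.
have I2 : intO (fun x => rho x * (W x * (L2_fun P x * L2_fun Q x))).
  apply: (intO_bddM mrho rhoB); apply: (intO_bddM mW WB).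
  by apply: inL2_mul => //; exact: L2_inL2.
rewrite /wip; transitivity (I (fun x => - nu * (etaP x * L2_fun Q x) +
    rho x * (W x * (L2_fun P x * L2_fun Q x)))).
  apply: I_ae.
  - exact: (intO_measurable (wip_int mrho rmin0 rhoP h Q)).
  - by apply: intO_measurable; apply: intOD => //; exact: intOZ.
  - by apply: filterS hE => x H Ox; rewrite mulrA H//; ring.
rewrite I_D ?I_Z//; last exact: intOZ.
rewrite BP mulNr mulrN opprK; congr (nu * _ + _).
by apply: I_eq => x _; ring.
Qed.

Let w x := nu^-1 * (rho x * W x).

Let nuV0 : 0 <= nu^-1. Proof. by rewrite invr_ge0 ltW. Qed.

Let rmax0 : 0 < rmax. Proof. by apply: lt_le_trans (rho0 Omega0) _; have /andP[] := rhoP Omega0. Qed.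

Let wP x : Omega x -> 0 <= w x <= nu^-1 * (rmax * Wm).
Proof.
move=> Ox; have /andP[w0 w1] := WP Ox; have /andP[r1 r2] := rhoP Ox.
have r0 := ltW (rho0 Ox).
by rewrite !mulr_ge0//= ler_wpM2l// ler_pM.
Qed.

Let mw : measurable_fun Omega w.
Proof. by apply: measurable_funM => //; exact: measurable_funM. Qed.

(** The solution with [P 0 = 0] and unit initial flux; being positive at 1, it
can be used to correct the boundary value there. *)
Lemma homogeneous_solution : exists chi xi : R -> R,
  [/\ intO (fun y => w y * chi y), intO (fun y => (rho y)^-1 * xi y),
      forall x, Omega x -> xi x = 1 + prim (fun y => w y * chi y) x,
      forall x, Omega x -> chi x = prim (fun y => (rho y)^-1 * xi y) x &
      forall x, Omega x -> x / rmax <= chi x].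
Proof.
have I0 : intO (fun _ : R => 0 : R) by exact: intO_cst.
have [chi [xi [Jc Kc xiE cE cP]]] := ivp mw wP I0 (fun _ _ => lexx 0) mrhoV rhoVP ler01.
have Jc' : intO (fun y => w y * chi y).
  by apply: intO_eq Jc => x _; rewrite addr0.
have xiE' x : Omega x -> xi x = 1 + prim (fun y => w y * chi y) x.
  by move=> Ox; rewrite xiE//; congr (_ + _); apply: prim_eq => // y _; rewrite addr0.
exists chi, xi; split => // x Ox.
rewrite cE// mulrC -prim_cst//; apply: prim_le => //; first exact: intO_cst.
move=> y Oy _; have /andP[r1 r2] := rhoP Oy.
rewrite -[leLHS]mulr1 ler_pM ?invr_ge0 ?(ltW rmax0)//.
  by rewrite lef_pV2 ?posrE// rho0.
rewrite xiE'// lerDl prim_ge0// => z Oz; rewrite mulr_ge0//.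
  by have /andP[] := wP Oz.
by have [] := cP _ Oz.
Qed.

(** Shooting. The initial value problem is solvable for nonnegative data, so the
source is split into positive and negative parts and a multiple of the
homogeneous solution enforces [P 1 = 0]. *)
Lemma sturm_liouville_surj h : exists P, sturm_liouville W P h.
Proof.
have h2 := L2_inL2 h.
have mh := inL2_measurable h2; have Ih := inL2_intO h2.
pose f1 x := nu^-1 * (rho x * Num.max (L2_fun h x) 0).
pose f2 x := nu^-1 * (rho x * Num.max (- L2_fun h x) 0).
have max_int g : intO g -> intO (fun x => Num.max (g x) 0).
  move=> Ig; apply: (intO_le (g := g)) => //.
    by apply: measurable_maxr => //; exact: intO_measurable.
  move=> x _; case: (leP (g x) 0) => g0; first by rewrite normr0.
  by [].
have If1 : intO f1 by apply: intOZ; apply: (intO_bddM mrho rhoB); exact: max_int.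
have If2 : intO f2 by apply: intOZ; apply: (intO_bddM mrho rhoB); apply: max_int; exact: intON.
have f10 x : Omega x -> 0 <= f1 x.
  by move=> Ox; rewrite !mulr_ge0 ?(ltW (rho0 Ox))// le_max lexx orbT.
have f20 x : Omega x -> 0 <= f2 x.
  by move=> Ox; rewrite !mulr_ge0 ?(ltW (rho0 Ox))// le_max lexx orbT.
have f12 x : f1 x - f2 x = nu^-1 * (rho x * L2_fun h x).
  rewrite /f1 /f2 -!mulrBr; congr (_ * (_ * _)).
  case: (leP (L2_fun h x) 0) => g0.
    by rewrite max_l ?oppr_ge0// sub0r opprK.
  by rewrite max_r ?subr0// oppr_le0 ltW.
have [P1 [xi1 [J1 K1 xiE1 PE1 _]]] := ivp mw wP If1 f10 mrhoV rhoVP (lexx 0).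
have [P2 [xi2 [J2 K2 xiE2 PE2 _]]] := ivp mw wP If2 f20 mrhoV rhoVP (lexx 0).
have [chi [xic [Jc Kc xiEc cE cP]]] := homogeneous_solution.
have chi1 : 0 < chi 1.
  by apply: lt_le_trans (cP _ Omega1); rewrite divr_gt0.
pose q := (P2 1 - P1 1) / chi 1.
pose P x := P2 x - P1 x - q * chi x.
pose xi x := xi2 x - xi1 x - q * xic x.
pose eta x := (w x * P2 x + f2 x) - (w x * P1 x + f1 x) - q * (w x * chi x).
have Ieta : intO eta by apply: intOB; [exact: intOB|exact: intOZ].
have PE x : Omega x -> P x = prim (fun y => (rho y)^-1 * xi y) x.
  move=> Ox; rewrite /P PE1// PE2// cE// -prim_Z// -!prim_B//; try exact: intOZ; try exact: intOB.
  by apply: prim_eq => // y _; rewrite /xi; ring.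
have etaE x : eta x = w x * P x - nu^-1 * (rho x * L2_fun h x).
  by rewrite /eta /P -f12; ring.
have xiE x : Omega x -> xi x = xi 0 + prim eta x.
  move=> Ox; rewrite /xi xiE1// xiE2// xiEc// xiE1 ?prim0; last exact: Omega0.
  rewrite xiE2 ?prim0; last exact: Omega0.
  rewrite xiEc ?prim0; last exact: Omega0.
  rewrite /eta prim_B//; try exact: intOZ; try exact: intOB.
  by rewrite prim_B// prim_Z//; ring.
have P1_0 : P 1 = 0 by rewrite /P /q divfK ?subrr// gt_eqF.
have Ixi : intO xi.
  apply: (@intO_eq _ (fun x => xi 0 + prim eta x)) => [x Ox|]; first by rewrite [RHS]xiE.
  apply: (intO_bounded (C := `|xi 0| + I (fun x => `|eta x|))).
    by apply: measurable_funD => //; exact: prim_measurable.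
  by move=> x Ox; rewrite (le_trans (ler_normD _ _))// lerD2l prim_bounded.
have Irxi : intO (fun y => (rho y)^-1 * xi y) by exact: (intO_bddM mrhoV rhoVB).
have P2in : inL2 P.
  apply: (@inL2_eq _ (prim (fun y => (rho y)^-1 * xi y))) => [x Ox|]; first by rewrite PE.
  apply: (inL2_bounded (C := I (fun x => `|(rho x)^-1 * xi x|))); first exact: prim_measurable.
  by move=> x Ox; exact: prim_bounded.
have eta2 : inL2 eta.
  apply: (@inL2_eq _ (fun x => w x * P x - nu^-1 * (rho x * L2_fun h x))) => [x Ox|]; first by rewrite etaE.
  apply: inL2B; last by apply: inL2Z; exact: (inL2_bddM mrho rhoB).
  apply: (inL2_bddM (C := nu^-1 * (rmax * Wm)) mw) => // x Ox.
  by have /andP[w0 w1] := wP Ox; rewrite ger0_norm.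
exists (toL2 P), xi, eta; rewrite toL2K//; split; first by split.
apply: aeW => x _; rewrite etaE /w; field.
by rewrite gt_eqF.
Qed.

Lemma sturm_liouville_positive : positive_operator ip (sturm_liouville W).
Proof.
split; [|exact: sturm_liouville_surj|].
- move=> P h Q k [xiP [etaP [DP hE]]] [xiQ [etaQ [DQ kE]]].
  rewrite (sturm_liouville_form DP hE DQ) (ipC (wip_semi_inner mrho rmin0 rhoP) P k).
  rewrite (sturm_liouville_form DQ kE DP).
  by congr (nu * _ + _); apply: I_eq => x _; ring.
- move=> P h [xi [eta [D hE]]]; rewrite (sturm_liouville_form D hE D) addr_ge0//.
    rewrite mulr_ge0 ?(ltW nu0)// I_ge0// => x Ox.
    by rewrite mulr_ge0 ?invr_ge0 ?(ltW (rho0 Ox))// -expr2 sqr_ge0.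
  rewrite I_ge0// => x Ox; have /andP[w0 _] := WP Ox.
  apply: mulr_ge0; first by rewrite ltW ?rho0.
  by apply: mulr_ge0 => //; rewrite -expr2 sqr_ge0.
Qed.

(** Left of the source, [P] is a positive multiple of the homogeneous solution.
Right of it, a zero at [x < 1] besides the one at 1 would force [P], and then
its flux, to vanish on [[x, 1]] by the energy identity; but the flux at 1 is
negative, by the Wronskian of the particular and the homogeneous solutions. *)
Lemma driven_nonvanishing (psi : X) (c d : R) : 0 < c -> c < d -> d < 1 ->
  (forall x, Omega x -> L2_fun psi x = \1_(`[c, d]%classic : set R) x) ->
  exists2 P, sturm_liouville W P psi & forall x, 0 < x < 1 -> ~~ (c <= x <= d) -> L2_fun P x <> 0.
Proof.
move=> c0 cd d1 psiE.
have Oc : Omega c by apply/OmegaP; apply/andP; split; lra.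
have Od : Omega d by apply/OmegaP; apply/andP; split; lra.
have O1 : Omega (1 : R) := Omega1.
have psi_in x : Omega x -> c <= x <= d -> L2_fun psi x = 1.
  by move=> Ox xP; rewrite psiE// indicE mem_set//= in_itv.
have psi_out x : Omega x -> ~~ (c <= x <= d) -> L2_fun psi x = 0.
  by move=> Ox xP; rewrite psiE// indicE memNset//= in_itv/=; exact/negP.
have psi_ge0 x : Omega x -> 0 <= L2_fun psi x by move=> Ox; rewrite psiE// indicE.
pose f x := nu^-1 * (rho x * L2_fun psi x).
have If : intO f.
  by apply: intOZ; apply: (intO_bddM mrho rhoB); apply: inL2_intO; exact: L2_inL2.
have f0 x : Omega x -> 0 <= f x.
  by move=> Ox; rewrite !mulr_ge0 ?(ltW (rho0 Ox)) ?psi_ge0.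
have fm x : Omega x -> c < x <= d -> nu^-1 * rmin <= f x.
  move=> Ox /andP[xc xd]; rewrite /f psi_in ?(ltW xc)// mulr1 ler_wpM2l//.
  by have /andP[] := rhoP Ox.
have nr0 : 0 < nu^-1 * rmin by rewrite mulr_gt0// invr_gt0.
have [p [xip [Jp Kp xipE pE p0]]] := ivp mw wP If f0 mrhoV rhoVP (lexx 0).
have [chi [xic [Jc Kc xicE cE chi_ge]]] := homogeneous_solution.
have chi1 : 0 < chi 1 by apply: lt_le_trans (chi_ge _ O1); rewrite divr_gt0.
have chi0 x : Omega x -> 0 <= chi x.
  move=> Ox; apply: le_trans (chi_ge _ Ox); rewrite divr_ge0 ?(ltW rmax0)//.
  by move: Ox => /OmegaP/andP[].
have w0 x : Omega x -> 0 <= w x by move=> /wP/andP[].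
(* past the source the flux of [p] is at least [F] *)
pose F := prim f d.
have F0 : 0 < F.
  apply: (@lt_le_trans _ _ (nu^-1 * rmin * (d - c))); first by rewrite mulr_gt0// subr_gt0.
  apply: le_trans (prim_sub_ge Oc Od (ltW cd) If fm) _.
  by rewrite gerBl prim_ge0.
have rV_ge x : Omega x -> rmax^-1 <= (rho x)^-1.
  move=> Ox; have /andP[_ r2] := rhoP Ox.
  by rewrite lef_pV2 ?posrE// rho0.
have p1 : 0 < p 1.
  apply: (@lt_le_trans _ _ (rmax^-1 * F * (1 - d))).
    by rewrite !mulr_gt0// ?invr_gt0// subr_gt0.
  have H := @prim_sub_ge _ (fun y => (rho y)^-1 * xip y) (rmax^-1 * F) d 1 Od O1 (ltW d1) Kp.
  apply: le_trans (H _) _; last by rewrite -!pE// gerBl; have [] := p0 _ Od.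
  move=> z Oz /andP[dz z1]; rewrite ler_pM ?invr_ge0 ?(ltW rmax0) ?(ltW F0) ?rV_ge//.
  rewrite xipE// add0r; apply: (@le_trans _ _ (prim f z)).
    by apply: prim_mono => //; exact: ltW.
  apply: prim_le => // y Oy _; rewrite lerDr mulr_ge0 ?w0//.
  by have [] := p0 _ Oy.
pose q := p 1 / chi 1; have q0 : 0 < q by rewrite divr_gt0.
pose P x := q * chi x - p x.
pose xi x := q * xic x - xip x.
pose eta x := q * (w x * chi x) - (w x * p x + f x).
have Ieta : intO eta by apply: intOB => //; exact: intOZ.
have PE x : Omega x -> P x = prim (fun y => (rho y)^-1 * xi y) x.
  move=> Ox; rewrite /P pE// cE// -prim_Z// -prim_B//; last exact: intOZ.
  by apply: prim_eq => // y _; rewrite /xi; ring.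
have etaE x : eta x = w x * P x - f x by rewrite /eta /P; ring.
have xiE x : Omega x -> xi x = xi 0 + prim eta x.
  move=> Ox; rewrite /xi xipE// xicE// xipE ?prim0; last exact: Omega0.
  rewrite xicE ?prim0; last exact: Omega0.
  by rewrite /eta prim_B ?prim_Z//; [ring|exact: intOZ].
have P1_0 : P 1 = 0 by rewrite /P /q divfK ?subrr// gt_eqF.
have Irxi : intO (fun y => (rho y)^-1 * xi y).
  apply: (@intO_eq _ (fun y => q * ((rho y)^-1 * xic y) - (rho y)^-1 * xip y)) => [y _|].
    by rewrite /xi; ring.
  by apply: intOB => //; exact: intOZ.
have Pin : inL2 P.
  apply: (@inL2_eq _ (prim (fun y => (rho y)^-1 * xi y))) => [x Ox|]; first by rewrite PE.
  apply: (inL2_bounded (C := I (fun x => `|(rho x)^-1 * xi x|))); first exact: prim_measurable.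
  by move=> x Ox; exact: prim_bounded.
have eta2 : inL2 eta.
  apply: (@inL2_eq _ (fun x => w x * P x - nu^-1 * (rho x * L2_fun psi x))) => [x Ox|]; first by rewrite etaE.
  apply: inL2B; last by apply: inL2Z; apply: (inL2_bddM mrho rhoB); exact: L2_inL2.
  apply: (inL2_bddM (C := nu^-1 * (rmax * Wm)) mw) => // x Ox.
  by have /andP[? ?] := wP Ox; rewrite ger0_norm.
have D : flux_domain P xi eta by split.
exists (toL2 P).
  exists xi, eta; rewrite toL2K//; split => //.
  apply: aeW => x _; rewrite etaE /f /w; field.
  by rewrite gt_eqF.
rewrite toL2K// => x /andP[x0 x1] xJ Px.
have Ox : Omega x by apply/OmegaP; rewrite !ltW.
have [xc|cx] := ltP x c.
  (* left of the source p vanishes *)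
  have px : p x = 0.
    have [_] := p0 _ Ox; apply; rewrite add0r.
    have := @prim_sub_eq _ f (fun=> 0) 0 x Omega0 Ox (ltW x0) If (intO_cst 0).
    rewrite !prim0 !subr0 prim_cst// mul0r; apply => z Oz /andP[z0 zx].
    rewrite /f psi_out ?mulr0//; apply/negP => /andP[zc _].
    by have := le_lt_trans zc (le_lt_trans zx xc); rewrite ltxx.
  move: Px; rewrite /P px subr0 => /eqP; rewrite mulf_eq0 gt_eqF//=.
  rewrite gt_eqF//; apply: lt_le_trans (chi_ge _ Ox); exact: divr_gt0.
have dx : d < x by move: xJ; rewrite cx/= -ltNge.
have Ixi : intO xi by have [] := flux_int D.
have IwP : intO (fun y => w y * P y).
  apply: (@intO_eq _ (fun y => eta y + f y)) => [y _|]; first by rewrite etaE subrK.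
  exact: intOD.
have f_out z : Omega z -> x < z <= 1 -> f z = 0.
  move=> Oz /andP[xz _]; rewrite /f psi_out ?mulr0//; apply/negP => /andP[_ zd].
  by have := lt_trans (le_lt_trans zd dx) xz; rewrite ltxx.
(* by the Wronskian [xip * chi - xic * p], whose derivative is [f * chi] *)
have xi1 : xi 1 < 0.
  have Ifc : intO (fun y => f y * chi y).
    apply: (@intO_eq _ (fun y => prim (fun y => (rho y)^-1 * xic y) y * f y)) => [y Oy|].
      by rewrite -cE// mulrC.
    exact: intO_primM.
  have wr : xip 1 * chi 1 - xic 1 * p 1 = I (fun y => f y * chi y).
    have := prim_mul 0 0 Jp Kc O1; rewrite -xipE// !add0r -cE// mul0r add0r => ->.
    have := prim_mul 1 0 Jc Kp O1; rewrite -xicE// add0r -pE// mulr0 add0r => ->.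
    rewrite -prim_B ?prim1//.
    - by apply: I_eq => y Oy; rewrite -!cE// -!pE// -xicE// -xipE//; ring.
    - by apply: intOD; exact: intO_Mprim.
    - by apply: intOD; exact: intO_Mprim.
  have wr0 : 0 < I (fun y => f y * chi y).
    have fc0 y : Omega y -> 0 <= f y * chi y by move=> Oy; rewrite mulr_ge0 ?f0 ?chi0.
    apply: (@lt_le_trans _ _ (nu^-1 * rmin * (c / rmax) * (d - c))).
      by rewrite !mulr_gt0 ?invr_gt0// subr_gt0.
    have H := prim_sub_ge (m := nu^-1 * rmin * (c / rmax)) Oc Od (ltW cd) Ifc.
    apply: le_trans (H _) _ => [z Oz zP|].
      rewrite ler_pM ?fm ?(ltW nr0)//; first by rewrite divr_ge0// ltW.
      apply: le_trans (chi_ge _ Oz); rewrite ler_wpM2r ?invr_ge0 ?(ltW rmax0)//.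
      by move: zP => /andP[/ltW].
    rewrite -prim1; apply: (@le_trans _ _ (prim (fun y => f y * chi y) d)).
      by rewrite gerBl prim_ge0.
    by apply: prim_mono => //; exact: ltW.
  have qc : q * chi 1 = p 1 by rewrite /q divfK// gt_eqF.
  have : xi 1 * chi 1 < 0.
    have -> : xi 1 * chi 1 = xic 1 * (q * chi 1) - xip 1 * chi 1 by rewrite /xi; ring.
    by rewrite qc; lra.
  by rewrite pmulr_llt0.
(* the energy identity on [x, 1] *)
pose e y := (rho y)^-1 * xi y * (xi 0 + prim eta y) + eta y * (0 + prim (fun y => (rho y)^-1 * xi y) y).
have Ie : intO e by apply: intOD; exact: intO_Mprim.
have enE y : Omega y -> P y * xi y = prim e y.
  move=> Oy; have := prim_mul 0 (xi 0) Irxi Ieta Oy.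
  by rewrite add0r -PE// -xiE// mul0r add0r.
have e1x : prim e 1 - prim e x = 0 by rewrite -!enE// P1_0 Px !mul0r subr0.
have Irx2 : intO (fun y => (rho y)^-1 * xi y ^+ 2).
  apply: (@intO_eq _ (fun y => (rho y)^-1 * xi y * (xi 0 + prim eta y))) => [y Oy|].
    by rewrite -xiE// -mulrA expr2.
  exact: intO_Mprim.
have rx20 y : Omega y -> 0 <= (rho y)^-1 * xi y ^+ 2.
  by move=> Oy; rewrite mulr_ge0 ?sqr_ge0// invr_ge0 ltW// rho0.
have x1' : x <= 1 by exact: ltW.
have rx2_le : prim (fun y => (rho y)^-1 * xi y ^+ 2) 1 - prim (fun y => (rho y)^-1 * xi y ^+ 2) x <= 0.
  rewrite -e1x; apply: prim_sub_le => // z Oz zP.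
  rewrite /e -xiE// add0r -PE// etaE f_out// subr0.
  have : 0 <= w z * (P z * P z) by rewrite mulr_ge0 ?w0// -expr2 sqr_ge0.
  by rewrite expr2; lra.
(* the flux vanishes almost everywhere on [x, 1]; the increment of [P] is bounded
   by the weighted arithmetic-geometric inequality *)
have P0 y : Omega y -> x <= y -> P y = 0.
  move=> Oy xy; apply/eqP; rewrite -normr_le0; apply/ler_addgt0Pl => ep ep0; rewrite addr0.
  have y1 : y <= 1 by move: Oy => /OmegaP/andP[].
  pose K := prim (fun y => (rho y)^-1) 1 + 1.
  have IrV : intO (fun y => (rho y)^-1) by apply: (intO_bounded mrhoV rhoVB).
  have rV0 y' : Omega y' -> 0 <= (rho y')^-1 by move=> /rhoVP/andP[].
  have K0 : 0 < K by rewrite ltr_wpDl// prim_ge0.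
  pose g y := ep / K * (rho y)^-1 + (ep / K)^-1 * ((rho y)^-1 * xi y ^+ 2).
  have eK : 0 < ep / K by rewrite divr_gt0.
  have Ig : intO g by apply: intOD; exact: intOZ.
  have gB z : Omega z -> x < z <= y -> `|(rho z)^-1 * xi z| <= g z.
    move=> Oz _; rewrite /g normrM ger0_norm ?rV0//.
    rewrite mulrCA [ep / K * _]mulrC -mulrDr ler_wpM2l ?rV0//.
    rewrite -(ler_pM2l eK) [leRHS](_ : _ = (ep / K) ^+ 2 + xi z ^+ 2); last first.
      by field; rewrite !gt_eqF.
    have := sqr_ge0 (ep / K - `|xi z|); rewrite sqrrB.
    have -> : `|xi z| ^+ 2 = xi z ^+ 2 by rewrite real_normK ?num_real.
    have := mulr_ge0 (ltW eK) (normr_ge0 (xi z)); lra.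
  have gle : prim g y - prim g x <= ep.
    rewrite /g !prim_D ?prim_Z//; try exact: intOZ.
    have h1 : prim (fun y => (rho y)^-1) y - prim (fun y => (rho y)^-1) x <= K.
      have := prim_mono Oy O1 y1 IrV rV0; have := prim_ge0 Ox rV0; rewrite /K; lra.
    have h2 : prim (fun y => (rho y)^-1 * xi y ^+ 2) y - prim (fun y => (rho y)^-1 * xi y ^+ 2) x <= 0.
      by have := prim_mono Oy O1 y1 Irx2 rx20; lra.
    have h3 : ep / K * (prim (fun y => (rho y)^-1) y - prim (fun y => (rho y)^-1) x) <= ep.
      by apply: le_trans (ler_wpM2l (ltW eK) h1) _; rewrite divfK// gt_eqF.
    have eKV : 0 <= (ep / K)^-1 by rewrite invr_ge0 ltW.
    have := ler_wpM2l eKV h2; rewrite mulr0; lra.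
  have PyE : P y = prim (fun y => (rho y)^-1 * xi y) y - prim (fun y => (rho y)^-1 * xi y) x.
    by rewrite -!PE// Px subr0.
  rewrite ler_norml; apply/andP; split.
    have := @prim_sub_le _ (fun y => - 1 * ((rho y)^-1 * xi y)) g x y Ox Oy xy (intOZ _ Irxi) Ig.
    rewrite !prim_Z// => H; have {}H := H _.
    have : -1 * prim (fun y => (rho y)^-1 * xi y) y - -1 * prim (fun y => (rho y)^-1 * xi y) x <= prim g y - prim g x.
      by apply: H => z Oz zP; apply: le_trans (gB z Oz zP); rewrite mulN1r -normrN ler_norm.
    by rewrite PyE; lra.
  rewrite PyE; apply: le_trans gle; apply: prim_sub_le => // z Oz zP.
  by apply: le_trans (gB z Oz zP); exact: ler_norm.
have xi_const y : Omega y -> x < y <= 1 -> xi y = xi 1.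
  move=> Oy /andP[xy y1].
  have := @prim_sub_eq _ eta (fun=> 0) y 1 Oy O1 y1 Ieta (intO_cst 0).
  rewrite !prim_cst// !mul0r subr0 => H; have {}H : prim eta 1 - prim eta y = 0.
    apply: H => z Oz /andP[yz z1]; rewrite etaE f_out//; last by rewrite (lt_trans xy yz).
    by rewrite P0 ?mulr0 ?subr0// ltW// (lt_trans xy).
  by rewrite xiE// [RHS]xiE//; lra.
have xi12 : 0 < xi 1 ^+ 2.
  have xn : xi 1 != 0 by rewrite lt_eqF.
  by rewrite exprn_even_gt0.
have H := @prim_sub_ge _ (fun y => (rho y)^-1 * xi y ^+ 2) (rmax^-1 * xi 1 ^+ 2) x 1 Ox O1 x1' Irx2.
have {}H : rmax^-1 * xi 1 ^+ 2 * (1 - x) <=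
    prim (fun y => (rho y)^-1 * xi y ^+ 2) 1 - prim (fun y => (rho y)^-1 * xi y ^+ 2) x.
  by apply: H => z Oz zP; rewrite xi_const// ler_wpM2r ?rV_ge// ltW.
have : 0 < rmax^-1 * xi 1 ^+ 2 * (1 - x).
  by apply: mulr_gt0; [apply: mulr_gt0 => //; rewrite invr_gt0|rewrite subr_gt0].
lra.
Qed.

End SturmLiouville.

(** * Fubini on the space-time cylinder *)

Lemma ae_imp (R : realType) d (T : measurableType d) (m : {measure set T -> \bar R}) (P S : T -> Prop) :
  {ae m, forall x, P x} -> (forall x, P x -> S x) -> {ae m, forall x, S x}.
Proof.
by move=> aP PS; have F := ae_filter_ringOfSetsType m; apply: filterS aP.
Qed.

Lemma ae_imp2 (R : realType) d (T : measurableType d) (m : {measure set T -> \bar R}) (P Q S : T -> Prop) :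
  {ae m, forall x, P x} -> {ae m, forall x, Q x} ->
  (forall x, P x -> Q x -> S x) -> {ae m, forall x, S x}.
Proof.
move=> aP aQ PQS; have F := ae_filter_ringOfSetsType m.
by apply: filterS2 aP aQ => x; exact: PQS.
Qed.

Section Cylinder.
Context {R : realType}.
Local Notation mu := (@lebesgue_measure R).
Local Notation Omega := (@Omega R).
Local Notation RR := (measurableTypeR R * measurableTypeR R)%type.
Implicit Types (s t x : R).
Hint Resolve measurable_Omega : core.

Lemma measurable_cylinder s t : measurable (cylinder s t).
Proof. by apply: measurableX => //; exact: measurable_itv. Qed.
Hint Resolve measurable_cylinder : core.

Lemma cylinder_inner s t (G : RR -> \bar R) (tau : R) :
  (\int[mu]_x (G \_ (cylinder s t)) (tau, x) =
   ((fun tau => \int[mu]_(x in Omega) G (tau, x)) \_ `[s, t]) tau)%E.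
Proof.
rewrite /patch /cylinder; case: ifPn => tP.
  rewrite [RHS]integral_mkcond; apply: eq_integral => x _.
  rewrite /patch; congr (if _ then _ else _).
  apply/idP/idP; rewrite !inE; first by case.
  by move=> xO; split => //; exact: set_mem.
rewrite -[RHS](integral0 mu setT); apply: eq_integral => x _.
case: ifPn => //; rewrite inE => -[/= h _].
by move: tP; rewrite notin_setE.
Qed.

(** Tonelli: uniformly bounded integrals over the time slices give integrability
in space-time. *)
Lemma cylinder_integrableP s t (G : RR -> R) (C : R) :
  measurable_fun (cylinder s t) G -> 0 <= C ->
  (forall tau, s <= tau <= t -> (\int[mu]_(x in Omega) `|G (tau, x)|%:E <= C%:E)%E) ->
  leb2.-integrable (cylinder s t) (EFin \o G).
Proof.
move=> mG C0 GC; apply/(integrable_mkcond _ (measurable_cylinder s t)).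
have mE : measurable_fun setT ((EFin \o G) \_ (cylinder s t)).
  by apply/(measurable_restrictT _ (measurable_cylinder s t)); exact/measurable_EFinP.
apply/integrable12ltyP => //.
pose H (z : RR) := `|((EFin \o G) \_ (cylinder s t)) z|%E.
have mH : measurable_fun setT H by exact: measurableT_comp.
have mF := @measurable_fun_fubini_tonelli_F _ _ _ _ R mu H mH (fun z => abse_ge0 _).
have mst : measurable (`[s, t]%classic : set R) by exact: measurable_itv.
have HE tau : fubini_F mu H tau = ((fun tau => \int[mu]_(x in Omega) `|G (tau, x)|%:E) \_ `[s, t])%E tau.
  rewrite -(cylinder_inner s t (fun z => `|G z|%:E)); apply: eq_integral => x _.
  by rewrite -[LHS]/((abse \o ((EFin \o G) \_ (cylinder s t))) (tau, x)) -restrict_abse.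
have mmu : (mu `[s, t] < +oo)%E.
  by rewrite lebesgue_measure_itv/=; case: ifP => _; rewrite ?ltry// -EFinB ltry.
apply: (@le_lt_trans _ _ (\int[mu]_(tau in `[s, t]) C%:E)%E); last first.
  by rewrite integral_cst//; apply: lte_mul_pinfty => //; rewrite lee_fin.
rewrite [leRHS]integral_mkcond; apply: ge0_le_integral => //.
- by move=> tau _; apply: integral_ge0.
- by apply/(measurable_restrictT _ mst); exact: measurable_cst.
- move=> tau _; rewrite -[leLHS]/(fubini_F mu H tau) HE /patch.
  case: ifPn => // tP; apply: GC; by move: tP; rewrite inE/= in_itv.
Qed.

(** The inner integrals need to be known only for almost every time, and only
when they make sense: this is how weak solutions satisfy their equation slice by
slice. *)
Lemma cylinder_fubini s t (G : RR -> R) (F : R -> R) :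
  leb2.-integrable (cylinder s t) (EFin \o G) ->
  measurable_fun `[s, t] F ->
  {ae mu, forall tau, s <= tau <= t -> intO (fun x => G (tau, x)) -> I (fun x => G (tau, x)) = F tau} ->
  \int[leb2]_(z in cylinder s t) G z = \int[mu]_(tau in `[s, t]) F tau.
Proof.
move=> IG mF FG.
have IG' : leb2.-integrable setT ((EFin \o G) \_ (cylinder s t)).
  by apply/(integrable_mkcond _ (measurable_cylinder s t)).
have E := @integral12_prod_meas1 _ _ _ _ R mu mu _ IG'.
have A := @ae_integrable1 _ _ _ _ R mu mu _ IG'.
have M := @measurable_fubini_F _ _ _ _ R mu mu _ IG'.
rewrite /Rintegral [X in fine X = _]integral_mkcond -[X in fine X = _]E.
congr fine; rewrite [RHS]integral_mkcond.
apply: ae_eq_integral => //.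
  apply/(measurable_restrictT _ (measurable_itv `[s, t])); exact/measurable_EFinP.
have A' : {ae mu, forall tau, mu.-integrable setT (fun y : R => ((EFin \o G) \_ (cylinder s t)) (tau, y))} := A.
rewrite /ae_eq; apply: ae_imp2 FG A' _ => tau FGt It _.
rewrite /fubini_F cylinder_inner /patch; case: ifPn => // tP.
have IGt : intO (fun x => G (tau, x)).
  rewrite /intO; apply/(@integrable_mkcond _ _ _ mu Omega _ measurable_Omega).
  apply: eq_integrable It => // x _; rewrite /patch /cylinder.
  congr (if _ then _ else _).
  apply/idP/idP; rewrite !inE; first by case.
  by move=> xO; split => //; exact: set_mem.
have tst : s <= tau <= t by move: tP; rewrite inE/= in_itv.
rewrite /= -FGt//.
rewrite -[LHS]fineK; first by [].
apply: integrable_fin_num; [exact: measurable_Omega|exact: IGt].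
Qed.

Lemma cylinder_ae s t (P : R -> Prop) : {ae mu, forall x, Omega x -> P x} ->
  {ae leb2, forall z : RR, cylinder s t z -> P z.2}.
Proof.
move=> [N [mN N0 NP]]; exists (setT `*` N); split => //.
- exact: measurableX.
- have := @product_measure1E _ _ _ _ R mu mu setT N (@measurableT _ _) mN.
  by rewrite [X in (_ * X)%E]N0 mule0.
- move=> z /= zP; split => //; apply: NP => /= zP'; apply: zP => -[_ /zP'].
  exact.
Qed.

Lemma cylinder_snd s t (g : R -> R) : measurable_fun Omega g ->
  measurable_fun (cylinder s t) (fun z : RR => g z.2).
Proof.
move=> mg; apply: (@measurable_comp _ _ _ _ _ _ Omega (g : measurableTypeR R -> R) _ snd) => //.
- exact: measurable_Omega.
- by move=> x /= [z /= zc <-]; case: zc.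
- by apply: measurable_funS (@measurable_snd _ _ _ _) => //.
Qed.

Lemma cylinder_bddM s t (g G : RR -> R) (C : R) : measurable_fun (cylinder s t) g ->
  (forall z, cylinder s t z -> `|g z| <= C) ->
  leb2.-integrable (cylinder s t) (EFin \o G) ->
  leb2.-integrable (cylinder s t) (EFin \o (fun z => g z * G z)).
Proof.
move=> mg gC IG.
have gC' : [bounded g x | x in cylinder s t].
  exists `|C|; split => // M CM x Ox.
  apply: le_trans (gC _ Ox) _; exact: le_trans (ler_norm _) (ltW CM).
have H := @integrableMr _ _ _ leb2 _ (measurable_cylinder s t) g _ mg gC' IG.
by apply: (eq_integrable _ _ _ _ H).
Qed.

Lemma cylinder_integrable_L2 s t (G : R -> R -> R) (C : R) :
  measurable_fun (cylinder s t) (fun z => G z.1 z.2) -> 0 <= C ->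
  (forall tau, s <= tau <= t -> inL2 (G tau) /\ I (fun x => G tau x ^+ 2) <= C) ->
  leb2.-integrable (cylinder s t) (EFin \o (fun z => G z.1 z.2)).
Proof.
move=> mG C0 GC; apply: (@cylinder_integrableP s t (fun z => G z.1 z.2) (1 + C)) => //=.
  by rewrite addr_ge0.
move=> tau /GC[G2 GI].
have IG := intO_norm (inL2_intO G2).
have fin : (\int[mu]_(x in Omega) `|G tau x|%:E)%E \is a fin_num.
  by apply: integrable_fin_num; [exact: measurable_Omega|exact: IG].
rewrite -(fineK fin) lee_fin -[leLHS]/(I (fun x => `|G tau x|)).
apply: (@le_trans _ _ (I (fun x => 1 + G tau x ^+ 2))).
  apply: I_le => //; first by apply: intOD; [exact: intO_cst|exact: inL2_sqr].
  move=> x _; have := sqr_ge0 (`|G tau x| - 1); rewrite -[G tau x ^+ 2]real_normK ?num_real//.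
  by have := normr_ge0 (G tau x); lra.
by rewrite I_D ?I_cst ?lerD2l//; [exact: intO_cst|exact: inL2_sqr].
Qed.

Lemma cylinder_integrable_sqr s t (G : RR -> R) : measurable_fun (cylinder s t) G ->
  leb2.-integrable (cylinder s t) (fun z => (G z ^+ 2)%:E) ->
  leb2.-integrable (cylinder s t) (EFin \o G).
Proof.
move=> mG IG.
have I1 : leb2.-integrable (cylinder s t) (EFin \o (fun z : RR => 1)).
  apply: (@cylinder_integrable_L2 s t (fun _ _ => 1) 1) => // tau _.
  by split; [exact: inL2_cst|rewrite expr1n I_cst].
apply: le_integrable (integrableD (measurable_cylinder s t) I1 IG) => //.
  exact/measurable_EFinP.
move=> z _; rewrite /= lee_fin [leRHS]ger0_norm ?addr_ge0 ?sqr_ge0//.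
have := sqr_ge0 (`|G z| - 1); rewrite -[G z ^+ 2]real_normK ?num_real//.
by have := normr_ge0 (G z); lra.
Qed.

End Cylinder.

(** * Curves continuous in time with values in square integrable functions *)

Section EnergyContinuity.
Context {R : realType}.
Local Notation mu := (@lebesgue_measure R).
Local Notation Omega := (@Omega R).
Local Notation X := (L2 R).
Implicit Types (s t x T al be : R).
Hint Resolve measurable_Omega : core.

Lemma within_continuous_eps (F : R -> R) al be :
  (forall t0, al <= t0 <= be -> forall e, 0 < e -> exists2 d, 0 < d &
     forall t, al <= t <= be -> `|t - t0| < d -> `|F t - F t0| < e) ->
  {within `[al, be], continuous F}.
Proof.
move=> H; apply/subspace_continuousP => t0 /=; rewrite in_itv/= => t0P.
apply/cvgrPdist_lt => e e0; have [d d0 Hd] := H _ t0P _ e0.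
rewrite near_withinE; apply/nbhs_ballP; exists d => //= t tb; rewrite /= in_itv/= => tP.
by rewrite distrC; apply: Hd => //; rewrite distrC.
Qed.

Let one_bdd x : Omega x -> 1 <= (fun=> 1 : R) x <= (1 : R).
Proof. by rewrite lexx. Qed.

Local Notation ip1 := (wip (fun=> (1 : R))).

Lemma wip1_semi_inner : semi_inner ip1.
Proof. exact: (wip_semi_inner (measurable_cst _) ltr01 one_bdd). Qed.

Lemma nrm1_sqr (f : R -> R) : inL2 f -> nrm ip1 (toL2 f) ^+ 2 = I (fun x => f x ^+ 2).
Proof.
move=> f2; rewrite (nrm_sqr wip1_semi_inner) /wip; apply: I_eq => x _.
by rewrite toL2K// mul1r expr2.
Qed.

Lemma wip1E (f g : R -> R) : inL2 f -> inL2 g -> ip1 (toL2 f) (toL2 g) = I (fun x => f x * g x).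
Proof. by move=> f2 g2; apply: I_eq => x _; rewrite !toL2K// mul1r. Qed.

Lemma nrm1_sub (f g : R -> R) : inL2 f -> inL2 g ->
  nrm ip1 (toL2 f - toL2 g) ^+ 2 = I (fun x => (f x - g x) ^+ 2).
Proof.
move=> f2 g2; rewrite (nrm_sqr wip1_semi_inner) /wip; apply: I_eq => x _.
by rewrite L2_funB !toL2K// mul1r expr2.
Qed.

Lemma L2_continuous_eps T u : L2_continuous T u -> forall t0, 0 <= t0 <= T ->
  forall e, 0 < e -> exists2 d, 0 < d & forall t, 0 <= t <= T -> `|t - t0| < d ->
    nrm ip1 (toL2 (u t) - toL2 (u t0)) < e.
Proof.
move=> [u2 uc] t0 t0P e e0.
have /cvgrPdist_lt/(_ (e ^+ 2) (exprn_gt0 2 e0)) := uc _ t0P.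
rewrite near_withinE => /nbhs_ballP[d /= d0 Hd]; exists d => // t tP td.
have : `|0 - I (fun x => (u t x - u t0 x) ^+ 2)| < e ^+ 2.
  by apply: Hd; [rewrite /ball/= distrC|rewrite /= in_itv].
rewrite sub0r normrN -nrm1_sub; [|exact: u2..].
rewrite ger0_norm ?sqr_ge0// ltr_pXn2r// ?nnegrE ?nrm_ge0//; exact: ltW.
Qed.

(** Cauchy-Schwarz against a fixed function. *)
Lemma L2_continuous_weak T u (q : R -> R) : L2_continuous T u -> inL2 q ->
  {within `[0, T], continuous (fun t => I (fun x => q x * u t x))}.
Proof.
move=> uc q2; have u2 := uc.1; apply: within_continuous_eps => t0 t0P e e0.
set N := nrm ip1 (toL2 q) + 1.
have N0 : 0 < N by rewrite ltr_wpDl// nrm_ge0.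
have [d d0 Hd] := L2_continuous_eps uc t0P (divr_gt0 e0 N0); exists d => // t tP td.
rewrite -!wip1E//; [|exact: u2..].
rewrite -(ipBr wip1_semi_inner); apply: le_lt_trans (cauchy_schwarz wip1_semi_inner _ _) _.
have := Hd t tP td; rewrite ltr_pdivlMr// mulrC; apply: le_lt_trans.
by rewrite ler_wpM2r ?nrm_ge0// lerDl.
Qed.

Lemma L2_continuous_bounded T u : 0 <= T -> L2_continuous T u ->
  exists2 C, 0 <= C & forall t, 0 <= t <= T -> I (fun x => u t x ^+ 2) <= C.
Proof.
move=> T0 uc; have u2 := uc.1.
have [|c _ Hc] := @EVT_max R (fun t => nrm ip1 (toL2 (u t))) 0 T T0.
  apply: within_continuous_eps => t0 t0P e e0.
  have [d d0 Hd] := L2_continuous_eps uc t0P e0; exists d => // t tP td.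
  apply: le_lt_trans (Hd t tP td).
  have N := nrmD wip1_semi_inner.
  have N1 := N (toL2 (u t0) - toL2 (u t)) (toL2 (u t)).
  have N2 := N (toL2 (u t) - toL2 (u t0)) (toL2 (u t0)).
  rewrite !subrK in N1 N2; rewrite (nrm_distC wip1_semi_inner) in N1.
  by rewrite ler_norml; apply/andP; split; lra.
exists (nrm ip1 (toL2 (u c)) ^+ 2); first exact: sqr_ge0.
move=> t tP; rewrite -nrm1_sqr; last exact: u2.
by rewrite ler_pXn2r ?nnegrE ?nrm_ge0//; apply: Hc; rewrite in_itv.
Qed.

Lemma is_derive_of_integral (phi F : R -> R) al be :
  {within `[al, be], continuous F} ->
  (forall s t, al <= s -> s <= t -> t <= be -> phi t - phi s = \int[mu]_(tau in `[s, t]) F tau) ->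
  forall t, al < t < be -> is_derive t 1 phi (F t).
Proof.
move=> Fc H t /andP[at_ tb].
have IF : mu.-integrable `[al, be] (EFin \o F).
  by apply: continuous_compact_integrable => //; exact: segment_compact.
have cF : {for t, continuous F}.
  by apply: (within_continuous_continuous (lt_trans at_ tb) Fc); rewrite in_itv/= at_.
have [D1 D2] := continuous_FTC1_closed tb IF at_ cF.
(* [phi] agrees with this primitive near [t] *)
pose G r := phi al + \int[mu]_(tau in `[al, r]) F tau.
have DG : is_derive t 1 G (F t).
  have D3 : is_derive t 1 (fun r => \int[mu]_(tau in `[al, r]) F tau) (F t).
    by apply: DeriveDef; [exact: D1|rewrite -derive1E; exact: D2].
  by have := is_deriveD (is_derive_cst (phi al) t (1 : R)) D3; rewrite add0r.
apply: near_eq_is_derive DG; near=> r.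
rewrite /G -H; first by rewrite addrC subrK.
- exact: lexx.
- by apply: ltW; near: r; exact: lt_nbhsr.
- by apply: ltW; near: r; exact: lt_nbhsl.
Unshelve. all: by end_near.
Qed.

End EnergyContinuity.

(** * Removing the drift from weak solutions *)

Section DriftWeight.
Context {R : realType}.
Local Notation mu := (@lebesgue_measure R).
Local Notation Omega := (@Omega R).
Local Notation RR := (measurableTypeR R * measurableTypeR R)%type.
Implicit Types (s t x T : R).
Hint Resolve measurable_Omega measurable_cylinder : core.

(** Essentially bounded coefficients are replaced by bounded ones, to have
bounds at every point. *)
Lemma clip_ae (g : R -> R) (lo hi : R) : lo <= hi -> measurable_fun Omega g ->
  {ae mu, forall x, Omega x -> lo <= g x <= hi} ->
  exists h : R -> R, [/\ measurable_fun Omega h, forall x, lo <= h x <= hi &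
    {ae mu, forall x, Omega x -> g x = h x}].
Proof.
move=> lohi mg ae; exists (fun x => Num.max lo (Num.min hi (g x))); split.
- apply: (@measurable_maxr _ _ _ Omega (cst lo) (fun x => Num.min hi (g x))) => //.
  by apply: (@measurable_minr _ _ _ Omega (cst hi) g).
- by move=> x; rewrite le_max lexx/= ge_max lohi ge_min lexx.
- apply: ae_imp ae _ => x H /H/andP[lg gh].
  by rewrite (min_idPr gh) (max_idPr lg).
Qed.

Variables (T nu M : R) (a aa : R -> R).
Hypothesis nu0 : 0 < nu.
Hypothesis ma : measurable_fun Omega a.
Hypothesis maa : measurable_fun Omega aa.
Hypothesis aaM : forall x, Omega x -> `|aa x| <= M.
Hypothesis aaE : {ae mu, forall x, Omega x -> a x = aa x}.

Let b x := - nu^-1 * aa x.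
Let Ib : intO b. Proof. by apply: intOZ; exact: (intO_bounded maa aaM). Qed.

(** The integrating factor of the drift: [- nu u'' + a u' = - (nu / rho) (rho
u')'] when [rho' / rho = - a / nu]. *)
Definition drift_weight x := expR (prim b x).
Local Notation rho := drift_weight.
Let C := I (fun x => `|b x|).

Lemma drift_weightP x : Omega x -> expR (- C) <= rho x <= expR C.
Proof.
move=> Ox; rewrite !ler_expR -ler_norml; exact: prim_bounded.
Qed.

Lemma drift_weight_measurable : measurable_fun Omega rho.
Proof. by apply: measurableT_comp => //; exact: prim_measurable. Qed.

Lemma drift_weightV_measurable : measurable_fun Omega (fun x => (rho x)^-1).
Proof.
apply: (@eq_measurable_fun _ _ _ _ _ (fun x => expR (- prim b x))).
  by move=> x _; rewrite expRN.
by apply: measurableT_comp => //; apply: measurableT_comp => //; exact: prim_measurable.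
Qed.

Let rmin0 : 0 < expR (- C) := expR_gt0 _.
Local Notation fluxD := (flux_domain rho).
Let rhoB x : Omega x -> `|rho x| <= expR C := rho_bdd rmin0 drift_weightP (x := x).
Let brho : intO (fun x => b x * rho x) := proj1 (exp_prim Ib Omega0).

(** The product rule gives [(rho Psi)' = b rho Psi + xi], where [b = - a / nu]
is the logarithmic derivative of the weight. *)
Lemma flux_test Psi xi eta : fluxD Psi xi eta ->
  inH10 (fun x => rho x * Psi x) (fun x => b x * (rho x * Psi x) + xi x).
Proof.
move=> D; have [eta2 xiE PsiE Psi1] := D.
have [Ieta Ixi Irxi] := flux_int drift_weightV_measurable rmin0 drift_weightP D.
have mPsi : measurable_fun Omega Psi.
  exact: inL2_measurable (flux_inL2 drift_weightV_measurable rmin0 drift_weightP D).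
have PsiB x : Omega x -> `|Psi x| <= I (fun x => `|(rho x)^-1 * xi x|).

  by move=> Ox; rewrite PsiE// prim_bounded.
have mxi := intO_measurable Ixi.
have xi2 : inL2 xi.
  apply: (inL2_bounded (C := `|xi 0| + I (fun x => `|eta x|))) => // x Ox.
  by rewrite xiE// (le_trans (ler_normD _ _))// lerD2l prim_bounded.
have b2 : inL2 b by apply: inL2Z; exact: (inL2_bounded maa aaM).
split.
- apply: inL2D => //; apply: (@inL2_eq _ (fun x => (rho x * Psi x) * b x)) => [x _|].
    by rewrite mulrC.
  apply: (inL2_bddM (C := expR C * I (fun x => `|(rho x)^-1 * xi x|))) => //.
    by apply: measurable_funM => //; exact: drift_weight_measurable.
  by move=> x Ox; rewrite normrM ler_pM//; [exact: rhoB|exact: PsiB].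
- move=> x Ox.
  have [_ rhoE] := exp_prim Ib Ox.
  have R0 : rho 0 * Psi 0 = 0 by rewrite (PsiE _ Omega0) prim0 mulr0.
  apply: etrans (esym (congr2 +%R R0 (erefl _))); rewrite [RHS]add0r.
  have E := prim_mul 1 0 brho Irxi Ox; rewrite mulr0 [RHS]add0r in E.
  apply: etrans (etrans _ E) _.
    by congr (_ * _); [exact: rhoE|rewrite [RHS]add0r; exact: PsiE].
  apply: prim_eq => // y Oy.
  have [_ rhoy] := exp_prim Ib Oy.
  rewrite -rhoy PsiE// add0r /drift_weight; set r := expR _; set pp := prim _ _.
  have r0 : r != 0 by rewrite gt_eqF ?expR_gt0.
  rewrite mulrA; congr (_ + _); by rewrite mulrAC mulVf// mul1r.
- by rewrite PsiE ?prim0 ?mulr0//; exact: Omega0.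
- by rewrite Psi1 mulr0.
Qed.

(** Tested on [rho Psi], the drift and the logarithmic derivative of the weight
cancel and [- nu p xi] remains; integrating by parts in space on almost every
slice moves the derivative from [u] to the flux. The result involves [u] alone
and makes sense at every time. The source [f] may be unbounded on a null set,
and is replaced by the almost everywhere equal [fh]. *)
Lemma weak_flux (f fh u : R -> R -> R) Psi xi eta (F : R -> R) s t :
  dirichlet_solution T nu a f u ->
  measurable_fun (cylinder 0 T) (fun z : RR => f z.1 z.2) ->
  leb2.-integrable (cylinder s t) (EFin \o (fun z : RR => fh z.1 z.2)) ->
  {ae leb2, forall z : RR, cylinder s t z -> f z.1 z.2 = fh z.1 z.2} ->
  fluxD Psi xi eta -> 0 <= s -> s <= t -> t <= T ->
  measurable_fun `[s, t] F ->
  (forall tau, s <= tau <= t ->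
     intO (fun x => fh tau x * (rho x * Psi x)) -> I (fun x => fh tau x * (rho x * Psi x)) = F tau) ->
  I (fun x => u t x * (rho x * Psi x)) - I (fun x => u s x * (rho x * Psi x)) =
  \int[mu]_(tau in `[s, t]) (nu * I (fun x => eta x * u tau x) + F tau).
Proof.
move=> [mu_ uc [p [mp p2 pu wk]]] mf Ifh ffh D s0 st tT mF FE.
have T2 := flux_test D; have [eta2 xiE PsiE Psi1] := D.
have [Ieta Ixi Irxi] := flux_int drift_weightV_measurable rmin0 drift_weightP D.
have sub : cylinder s t `<=` cylinder 0 T.
  move=> z [/=]; rewrite !in_itv/= => /andP[h1 h2] h3; split => //=.
  by rewrite in_itv/= (le_trans s0 h1) (le_trans h2 tT).
have mS (D1 D2 : set RR) (g : RR -> R) : measurable D2 -> D1 `<=` D2 ->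
   measurable_fun D2 g -> measurable_fun D1 g by move=> mD s12 mg; exact: (measurable_funS mD s12 mg).
have mp' := mS _ _ _ (measurable_cylinder 0 T) sub mp.
have mf' := mS _ _ _ (measurable_cylinder 0 T) sub mf.
have mPsi : measurable_fun Omega Psi.
  exact: inL2_measurable (flux_inL2 drift_weightV_measurable rmin0 drift_weightP D).
have PsiB x : Omega x -> `|Psi x| <= I (fun x => `|(rho x)^-1 * xi x|).

  by move=> Ox; rewrite PsiE// prim_bounded.
have rPB x : Omega x -> `|rho x * Psi x| <= expR C * I (fun x => `|(rho x)^-1 * xi x|).
  by move=> Ox; rewrite normrM ler_pM//; [exact: rhoB|exact: PsiB].
have mrP : measurable_fun Omega (fun x => rho x * Psi x).
  by apply: measurable_funM => //; exact: drift_weight_measurable.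
have xiB x : Omega x -> `|xi x| <= `|xi 0| + I (fun x => `|eta x|).
  by move=> Ox; rewrite xiE// (le_trans (ler_normD _ _))// lerD2l prim_bounded.
have mxi := intO_measurable Ixi.
have Ip : leb2.-integrable (cylinder s t) (EFin \o (fun z : RR => p z.1 z.2)).
  by apply: cylinder_integrable_sqr => //; apply: integrableS p2.
pose G (z : RR) := - nu * (xi z.2 * p z.1 z.2) + (rho z.2 * Psi z.2) * fh z.1 z.2.
have IG : leb2.-integrable (cylinder s t) (EFin \o G).
  have I1 : leb2.-integrable (cylinder s t) (EFin \o (fun z : RR => xi z.2 * p z.1 z.2)).
    apply: (@cylinder_bddM _ s t (fun z => xi z.2) (fun z => p z.1 z.2) (`|xi 0| + I (fun x => `|eta x|))) => //.
      exact: cylinder_snd.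
    by move=> z [_ /xiB].
  have I2 : leb2.-integrable (cylinder s t) (EFin \o (fun z : RR => (rho z.2 * Psi z.2) * fh z.1 z.2)).
    apply: (@cylinder_bddM _ s t (fun z => rho z.2 * Psi z.2) (fun z => fh z.1 z.2)
       (expR C * I (fun x => `|(rho x)^-1 * xi x|))) => //.
      exact: (@cylinder_snd _ s t (fun x => rho x * Psi x)).
    by move=> z [_ /rPB].
  apply: (eq_integrable _ _ _ _ (integrableD _ (integrableZl _ (- nu) I1) I2)) => //.
have -> : I (fun x => u t x * (rho x * Psi x)) - I (fun x => u s x * (rho x * Psi x)) =
    \int[leb2]_(z in cylinder s t) G z.
  have mpsi' : measurable_fun Omega (fun x => b x * (rho x * Psi x) + xi x).
    by have [+ _ _ _] := T2; exact: inL2_measurable.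
  have c1 := @cylinder_snd _ s t _ mpsi'; have c2 := @cylinder_snd _ s t _ mrP.
  have c3 := @cylinder_snd _ s t _ ma.
  pose L (z : RR) := - nu * p z.1 z.2 * (b z.2 * (rho z.2 * Psi z.2) + xi z.2)
     - a z.2 * p z.1 z.2 * (rho z.2 * Psi z.2) + f z.1 z.2 * (rho z.2 * Psi z.2).
  have mL : measurable_fun (cylinder s t) L.
    apply: measurable_funD; last exact: measurable_funM.
    apply: measurable_funB; last by apply: measurable_funM => //; exact: measurable_funM.
    by apply: measurable_funM => //; apply: measurable_funM.
  have mL' : measurable_fun (cylinder s t) (EFin \o L) by exact/measurable_EFinP.
  suff <- : \int[leb2]_(z in cylinder s t) L z = \int[leb2]_(z in cylinder s t) G z.
    exact: (wk _ _ T2 s t s0 st tT).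
  rewrite /Rintegral; congr fine.
  apply: ae_eq_integral; [exact: measurable_cylinder|exact: mL'|exact: measurable_int IG|].
  have A := cylinder_ae s t aaE.
  rewrite /ae_eq; apply: ae_imp2 A ffh _ => z h1 h2 zc; rewrite /= /L (h1 zc) (h2 zc) /G /b; congr EFin.
  by field; rewrite gt_eqF.
apply: cylinder_fubini => //.
  apply: measurable_funD => //; apply: measurable_funM => //.
  have cI := L2_continuous_weak uc eta2.
  have : measurable_fun `[0, T] (fun tau => I (fun x => eta x * u tau x)).
    by apply: subspace_continuous_measurable_fun => //; exact: measurable_itv.
  apply: measurable_funS; first exact: measurable_itv.
  by apply: subset_itv; rewrite bnd_simp.
apply: ae_imp pu _ => tau H tauP IGt.
have tau0 : 0 <= tau <= T.
  by move: tauP => /andP[h1 h2]; rewrite (le_trans s0 h1) (le_trans h2 tT).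
have [pt2 uE u0 u1] := H tau0.
have Ipt : intO (fun x => xi x * p tau x) by apply: (intO_bddM mxi xiB); exact: inL2_intO.
have If : intO (fun x => fh tau x * (rho x * Psi x)).
  apply: intO_eq (intOB IGt (intOZ (- nu) Ipt)) => x _; rewrite /G/=; ring.
have -> : I (fun x => G (tau, x)) = - nu * I (fun x => xi x * p tau x) + F tau.
  rewrite -FE// -I_Z// -I_D//; last exact: intOZ.
  by apply: I_eq => x _; rewrite /G/=; ring.
congr (_ + _); rewrite (flux_by_parts drift_weightV_measurable rmin0 drift_weightP D (inL2_intO pt2))//.
  by rewrite mulrN mulNr.
by move=> x Ox; rewrite uE// u0 add0r.
Qed.

End DriftWeight.

(** * The difference of two weak solutions as an evolution *)

Section DifferenceEvolution.
Context {R : realType}.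
Local Notation mu := (@lebesgue_measure R).
Local Notation Omega := (@Omega R).
Local Notation RR := (measurableTypeR R * measurableTypeR R)%type.
Implicit Types (s t x T : R).
Hint Resolve measurable_Omega measurable_cylinder : core.

Variables (T nu M : R) (a aa : R -> R).
Hypothesis T0 : 0 <= T.
Hypothesis nu0 : 0 < nu.
Hypothesis ma : measurable_fun Omega a.
Hypothesis maa : measurable_fun Omega aa.
Hypothesis aaM : forall x, Omega x -> `|aa x| <= M.
Hypothesis aaE : {ae mu, forall x, Omega x -> a x = aa x}.
Local Notation rho := (drift_weight nu aa).
Let C := I (fun x => `|- nu^-1 * aa x|).
Let mrho : measurable_fun Omega rho := drift_weight_measurable nu maa aaM.
Let mrhoV : measurable_fun Omega (fun x => (rho x)^-1) := drift_weightV_measurable nu maa aaM.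
Let rmin0 : 0 < expR (- C) := expR_gt0 _.
Let rhoP x : Omega x -> expR (- C) <= rho x <= expR C := drift_weightP nu maa aaM (x := x).
Let rhoB x : Omega x -> `|rho x| <= expR C := rho_bdd rmin0 rhoP (x := x).
Local Notation ip := (wip rho).
Local Notation ip1 := (wip (fun=> (1 : R))).
Let ipP : semi_inner ip := wip_semi_inner mrho rmin0 rhoP.

Variables (g u v : R -> R -> R) (al be Cb : R) (c : R -> R).
Hypothesis su : dirichlet_solution T nu a (fun t x => g t x * (u t x - v t x)) u.
Hypothesis sv : dirichlet_solution T nu a (fun _ _ => 0) v.
Hypothesis mg : measurable_fun (cylinder 0 T) (fun z : RR => g z.1 z.2).
Hypothesis al0 : 0 <= al.
Hypothesis beT : be <= T.
Hypothesis mc : measurable_fun Omega c.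
Hypothesis cB : forall x, Omega x -> `|c x| <= Cb.
Hypothesis gc : {ae leb2, forall z : RR, cylinder al be z -> g z.1 z.2 = c z.2}.

(** The right-hand side is continuous in time, which makes the left-hand side
differentiable. *)
Lemma difference_flux Psi xi eta s t : flux_domain rho Psi xi eta ->
  al <= s -> s <= t -> t <= be ->
  I (fun x => (u t x - v t x) * (rho x * Psi x)) - I (fun x => (u s x - v s x) * (rho x * Psi x)) =
  \int[mu]_(tau in `[s, t])
    (I (fun x => (nu * eta x + c x * (rho x * Psi x)) * u tau x) -
     I (fun x => (nu * eta x + c x * (rho x * Psi x)) * v tau x)).
Proof.
move=> D als st tbe; have [eta2 xiE PsiE Psi1] := D.
have [mu_ uc _] := su; have [mv_ vc _] := sv.
have Psi2 := flux_inL2 mrhoV rmin0 rhoP D.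
have rP2 : inL2 (fun x => rho x * Psi x) by exact: (inL2_bddM mrho rhoB).
pose q x := c x * (rho x * Psi x).
have q2 : inL2 q by exact: (inL2_bddM mc cB).
have s0 : 0 <= s := le_trans al0 als; have tT := le_trans tbe beT.
have inT tau : s <= tau <= t -> 0 <= tau <= T.
  by move=> /andP[h1 h2]; rewrite (le_trans s0 h1) (le_trans h2 tT).
have u2 tau : s <= tau <= t -> inL2 (u tau) by move=> /inT; exact: uc.1.
have v2 tau : s <= tau <= t -> inL2 (v tau) by move=> /inT; exact: vc.1.
have sub : cylinder s t `<=` cylinder 0 T.
  by move=> z [/=]; rewrite !in_itv/= => /inT h1 h3; split.
have sub' : cylinder s t `<=` cylinder al be.
  move=> z [/=]; rewrite !in_itv/= => /andP[h1 h2] h3; split => //=.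
  by rewrite in_itv/= (le_trans als h1) (le_trans h2 tbe).
have mf : measurable_fun (cylinder 0 T) (fun z : RR => g z.1 z.2 * (u z.1 z.2 - v z.1 z.2)).
  by apply: measurable_funM => //; exact: measurable_funB.
have [Cu Cu0 CuP] := L2_continuous_bounded T0 uc.
have [Cv Cv0 CvP] := L2_continuous_bounded T0 vc.
have Iu : leb2.-integrable (cylinder s t) (EFin \o (fun z : RR => u z.1 z.2)).
  apply: (@cylinder_integrable_L2 _ s t u Cu) => //; first exact: (measurable_funS _ sub mu_).
  by move=> tau tP; split; [exact: u2|apply: CuP; exact: inT].
have Iv : leb2.-integrable (cylinder s t) (EFin \o (fun z : RR => v z.1 z.2)).
  apply: (@cylinder_integrable_L2 _ s t v Cv) => //; first exact: (measurable_funS _ sub mv_).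
  by move=> tau tP; split; [exact: v2|apply: CvP; exact: inT].
have Ifh : leb2.-integrable (cylinder s t) (EFin \o (fun z : RR => c z.2 * (u z.1 z.2 - v z.1 z.2))).
  apply: (@cylinder_bddM _ s t (fun z => c z.2) (fun z => u z.1 z.2 - v z.1 z.2) Cb) => //.
  - exact: cylinder_snd.
  - by move=> z [_ /cB].
  - by apply: (eq_integrable _ _ _ _ (integrableB _ Iu Iv)).
have ffh : {ae leb2, forall z : RR, cylinder s t z ->
    g z.1 z.2 * (u z.1 z.2 - v z.1 z.2) = c z.2 * (u z.1 z.2 - v z.1 z.2)}.
  by apply: ae_imp gc _ => z H /sub'/H ->.
have IF r y : inL2 r -> L2_continuous T y ->
    mu.-integrable `[s, t] (EFin \o (fun tau => I (fun x => r x * y tau x))).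
  move=> r2 yc; have : mu.-integrable `[0, T] (EFin \o (fun tau => I (fun x => r x * y tau x))).
    by apply: continuous_compact_integrable; [exact: segment_compact|exact: L2_continuous_weak].
  apply: integrableS => //; apply: subset_itv; rewrite bnd_simp//.
have mF r y : inL2 r -> L2_continuous T y ->
    measurable_fun `[s, t] (fun tau => I (fun x => r x * y tau x)).
  by move=> r2 yc; apply/measurable_EFinP; exact: measurable_int (IF _ _ r2 yc).
have mq : measurable_fun `[s, t] (fun tau => I (fun x => q x * u tau x) - I (fun x => q x * v tau x)).
  by apply: measurable_funB; exact: mF.
have Eu := weak_flux nu0 ma maa aaM aaE (fh := fun t x => c x * (u t x - v t x)) su mf Ifh ffh D s0 st tT mq.
have I0 : leb2.-integrable (cylinder s t) (EFin \o (fun z : RR => (fun _ _ : R => 0) z.1 z.2)).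
  exact: integrable0.
have m0 : measurable_fun `[s, t] (fun _ : R => 0 : R) by exact: measurable_cst.
have mz : measurable_fun (cylinder 0 T) (fun z : RR => (fun _ _ : R => 0 : R) z.1 z.2) by exact: measurable_cst.
have Ev := weak_flux nu0 ma maa aaM aaE (fh := fun _ _ => 0) sv mz I0 _ D s0 st tT m0.
have uvrP r : 0 <= r <= T -> I (fun x => (u r x - v r x) * (rho x * Psi x)) =
    I (fun x => u r x * (rho x * Psi x)) - I (fun x => v r x * (rho x * Psi x)).
  move=> rT; rewrite -I_B; [|exact: inL2_mul (uc.1 _ rT) rP2|exact: inL2_mul (vc.1 _ rT) rP2].
  by apply: I_eq => x _; rewrite mulrBl.
have tT' : 0 <= t <= T by rewrite (le_trans s0 st).
have sT' : 0 <= s <= T by rewrite s0 (le_trans st tT).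
have swap (k1 k2 k3 k4 : R) : (k1 - k2) - (k3 - k4) = (k1 - k3) - (k2 - k4) by ring.
rewrite !uvrP// swap.
rewrite Eu => [|tau tauP _]; last first.
  rewrite -I_B; [|exact: inL2_mul q2 (u2 _ tauP)|exact: inL2_mul q2 (v2 _ tauP)].
  by apply: I_eq => x _; rewrite /q; ring.
rewrite Ev => [||tau tauP _]; last 2 first.
- exact: aeW.
- by rewrite -[RHS](I_cst (0 : R)); apply: I_eq => x _; rewrite mul0r.
pose A (y : R -> R -> R) tau := I (fun x => eta x * y tau x).
pose B (y : R -> R -> R) tau := I (fun x => q x * y tau x).
have IA y : L2_continuous T y -> mu.-integrable `[s, t] (EFin \o A y) by exact: IF.
have IB y : L2_continuous T y -> mu.-integrable `[s, t] (EFin \o B y) by exact: IF.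
have I1 : mu.-integrable `[s, t] (EFin \o (fun tau => nu * A u tau + (B u tau - B v tau))).
  apply: (eq_integrable _ _ _ _ (integrableD _ (integrableZl _ nu (IA _ uc)) (integrableB _ (IB _ uc) (IB _ vc)))) => //.
have I2 : mu.-integrable `[s, t] (EFin \o (fun tau => nu * A v tau + 0)).
  apply: (eq_integrable _ _ _ _ (integrableZl _ nu (IA _ vc))) => //.
  by move=> tau _; rewrite /= addr0.
rewrite -(RintegralB _ I1 I2)//.
apply: eq_Rintegral => tau; rewrite inE/= in_itv/= => tauP.
have split y : inL2 (y tau) ->
   I (fun x => (nu * eta x + c x * (rho x * Psi x)) * y tau x) = nu * A y tau + B y tau.
  move=> y2; rewrite /A /B -I_Z; last exact: inL2_mul.
  rewrite -I_D; [|by apply: intOZ; exact: inL2_mul|exact: inL2_mul].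
  by apply: I_eq => x _; rewrite /q; ring.
rewrite !split; [|exact: v2|exact: u2].
rewrite /A /B; ring.
Qed.

Let W0 t : L2 R := toL2 (u t) - toL2 (v t).

(** Multiplication by [expR (- m * t)] adds [m] to the operator, so that the
potential [m - c] can be made nonnegative although the backward equation has an
antidissipative source. *)
Lemma gauged_evolution (m : R) (W : R -> R) : {ae mu, forall x, Omega x -> W x = m - c x} ->
  evolution ip (sturm_liouville rho nu W) al be (fun t => expR (- m * t) *: W0 t).
Proof.
move=> WE; have [mu_ uc _] := su; have [mv_ vc _] := sv.
have inT tau : al <= tau <= be -> 0 <= tau <= T.
  by move=> /andP[h1 h2]; rewrite (le_trans al0 h1) (le_trans h2 beT).
have nrm_ip1 (x : L2 R) : nrm ip x <= expR (C / 2) * nrm ip1 x.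
  rewrite -(@ler_pXn2r _ 2)// ?nnegrE ?mulr_ge0 ?nrm_ge0 ?expR_ge0//.
  have -> : (expR (C / 2) * nrm ip1 x) ^+ 2 = expR C * nrm ip1 x ^+ 2.
    by rewrite exprMn; congr (_ * _); rewrite expr2 -expRD; congr expR; lra.
  rewrite (nrm_sqr (wip1_semi_inner (R:=R))).
  apply: le_trans (nrm_le_plain mrho rmin0 rhoP x) _.
  rewrite ler_wpM2l ?expR_ge0// le_eqVlt; apply/orP; left; apply/eqP; apply: I_eq => y _.
  by rewrite mul1r expr2.
split.
  move=> t0 t0P e e0; have t0T := inT _ t0P.
  pose N := nrm ip (W0 t0) + 1; pose E := expR (- m * t0) + 1; pose K := expR (C / 2).
  have N0 : 0 < N by rewrite ltr_wpDl ?nrm_ge0.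
  have E0 : 0 < E by rewrite ltr_wpDl ?expR_ge0.
  have K0 : 0 < K by exact: expR_gt0.
  have p1 : 0 < Num.min 1 (e / (2 * N)) by rewrite lt_min ltr01 divr_gt0 ?mulr_gt0.
  have p2 : 0 < e / (4 * (K * E)) by rewrite divr_gt0// !mulr_gt0.
  have cexp : {for t0, continuous (fun t => expR (- m * t))}.
    apply: continuous_comp; last exact: continuous_expR.
    by apply: continuousM; [exact: cvg_cst|exact: cvg_id].
  have /cvgrPdist_lt/(_ _ p1)/nbhs_ballP[d1 /= d10 H1] := cexp.
  have [d2 d20 H2] := L2_continuous_eps uc t0T p2.
  have [d3 d30 H3] := L2_continuous_eps vc t0T p2.
  exists (Num.min d1 (Num.min d2 d3)); first by rewrite !lt_min d10 d20 d30.
  move=> t tP; rewrite !lt_min => /and3P[k1 k2 k3]; have tT := inT _ tP.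
  have G1 : `|expR (- m * t0) - expR (- m * t)| < Num.min 1 (e / (2 * N)).
    by apply: H1; rewrite /ball/= distrC.
  have G2 := H2 _ tT k2; have G3 := H3 _ tT k3.
  have GW : nrm ip (W0 t - W0 t0) <= K * (e / (4 * (K * E)) * 2).
    apply: le_trans (nrm_ip1 _) _; rewrite ler_wpM2l ?expR_ge0//.
    have -> : W0 t - W0 t0 = (toL2 (u t) - toL2 (u t0)) - (toL2 (v t) - toL2 (v t0)).
      by rewrite /W0 !opprD !opprK addrACA.
    by apply: le_trans (nrmB (wip1_semi_inner (R:=R)) _ _) _; lra.
  have -> : expR (- m * t) *: W0 t - expR (- m * t0) *: W0 t0 =
     expR (- m * t) *: (W0 t - W0 t0) + (expR (- m * t) - expR (- m * t0)) *: W0 t0.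
    by rewrite [X in _ = X + _]scalerBr [X in _ = _ + X]scalerBl addrA subrK.
  apply: le_lt_trans (nrmD ipP _ _) _; rewrite !(nrmZ ipP).
  move: G1; rewrite distrC lt_min => /andP[G1 G1'].
  have EE : `|expR (- m * t)| <= E.
    by rewrite /E ger0_norm ?expR_ge0//; have := ler_norm (expR (- m * t) - expR (- m * t0)); lra.
  have B1 : `|expR (- m * t)| * nrm ip (W0 t - W0 t0) <= e / 2.
    apply: le_trans (_ : E * (K * (e / (4 * (K * E)) * 2)) <= _).
      by apply: ler_pM => //; exact: nrm_ge0.
    by rewrite le_eqVlt; apply/orP; left; apply/eqP; field; rewrite !gt_eqF.
  have B2 : `|expR (- m * t) - expR (- m * t0)| * nrm ip (W0 t0) < e / 2.
    have : `|expR (- m * t) - expR (- m * t0)| * N < e / 2.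
      by move: G1'; rewrite invfM mulrA ltr_pdivlMr.
    by apply: le_lt_trans; rewrite ler_wpM2l// /N lerDl ler01.
  by rewrite [ltRHS](splitr e) ler_ltD.
move=> P h [xi [eta [D hE]]] t tP.
have tP' : al <= t <= be by move: tP => /andP[h1 h2]; rewrite !ltW.
have tT := inT _ tP'.
have [eta2 xiE PsiE Psi1] := D.
have rP2 : inL2 (fun x => rho x * L2_fun P x) by apply: (inL2_bddM mrho rhoB); exact: L2_inL2.
pose q x := nu * eta x + c x * (rho x * L2_fun P x).
have q2 : inL2 q by apply: inL2D; [exact: inL2Z|exact: (inL2_bddM mc cB)].
pose phi t := ip (W0 t) P.
pose F tau := I (fun x => q x * u tau x) - I (fun x => q x * v tau x).
have W0E s x : al <= s <= be -> L2_fun (W0 s) x = u s x - v s x.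
  by move=> /inT sT; rewrite /W0 L2_funB !toL2K//; [exact: vc.1|exact: uc.1].
have phiE s : al <= s <= be -> phi s = I (fun x => (u s x - v s x) * (rho x * L2_fun P x)).
  by move=> sP; apply: I_eq => x _; rewrite W0E//; ring.
have Fc : {within `[al, be], continuous F}.
  have : {within `[0, T], continuous F}.
    by move=> r; apply: cvgB; [exact: (L2_continuous_weak uc q2)|exact: (L2_continuous_weak vc q2)].
  apply: continuous_subspaceW; apply: subset_itv; rewrite bnd_simp//.
have Dphi : is_derive t 1 phi (F t).
  have [h1 h2] := andP tP.
  apply: (@is_derive_of_integral _ phi F al be) => // r s alr rs sbe.
  have rP : al <= r <= be by rewrite alr (le_trans rs sbe).
  have sP : al <= s <= be by rewrite sbe (le_trans alr rs).
  by rewrite !phiE// (difference_flux D alr rs sbe).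
have De : is_derive t 1 (fun r => expR (- m * r)) (- m * expR (- m * t)).
  have D1 : is_derive t (1 : R) (fun r => - m * r) (- m).
    by apply: is_derive_eq; rewrite /GRing.scale/= mulr1.
  have := is_derive1_comp (is_derive_expR (- m * t)) D1; rewrite mulrC; exact.
have -> : (fun r => ip (expR (- m * r) *: W0 r) P) = (fun r => expR (- m * r)) * phi.
  by apply/funext => r; rewrite (ipZl ipP).
apply: is_derive_eq.
rewrite (ipZl ipP) /GRing.scale/=.
suff E : F t = m * phi t - ip (W0 t) h by rewrite E; ring.
have u2 := uc.1 _ tT; have v2 := vc.1 _ tT.
rewrite /F -I_B; [|exact: inL2_mul q2 u2|exact: inL2_mul q2 v2].
rewrite /phi /wip -I_Z; last exact: (wip_int mrho rmin0 rhoP).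
rewrite -I_B; [|by apply: intOZ; exact: (wip_int mrho rmin0 rhoP)|exact: (wip_int mrho rmin0 rhoP)].
apply: I_ae.
- by apply: measurable_funB; apply: intO_measurable; exact: inL2_mul.
- by apply: measurable_funB; apply: intO_measurable; [apply: intOZ|]; exact: (wip_int mrho rmin0 rhoP).
rewrite /ae_eq; apply: ae_imp2 hE WE _ => x h1 h2 Ox.
have {}h1 := h1 Ox; have {}h2 := h2 Ox.
rewrite W0E// /q.
have -> : rho x * ((u t x - v t x) * L2_fun h x) = (u t x - v t x) * (rho x * L2_fun h x) by ring.
by rewrite h1 h2; ring.
Qed.

End DifferenceEvolution.

(** * Constant gain on a time interval *)

Section ConstantGain.
Context {R : realType}.
Local Notation mu := (@lebesgue_measure R).
Local Notation Omega := (@Omega R).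
Local Notation RR := (measurableTypeR R * measurableTypeR R)%type.
Implicit Types (s t x T : R).
Hint Resolve measurable_Omega measurable_cylinder : core.

Lemma inLinf_clip (a : R -> R) : inLinf a -> exists (M : R) (aa : R -> R), [/\ measurable_fun Omega aa,
  forall x, Omega x -> `|aa x| <= M & {ae mu, forall x, Omega x -> a x = aa x}].
Proof.
move=> [ma [M aM]].
have M0 : - `|M| <= `|M| by rewrite ge0_cp.
have aM' : {ae mu, forall x, Omega x -> - `|M| <= a x <= `|M|}.
  by apply: ae_imp aM _ => x H /H aMx; rewrite -ler_norml (le_trans aMx)// ler_norm.
have [h [mh hP hE]] := clip_ae M0 ma aM'.
by exists `|M|, h; split => // x _; rewrite ler_norml.
Qed.

(** A single time is negligible; it matters at the end points of the interval
where the gain acts. *)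
Lemma cylinder_ae_time s t (t0 : R) : {ae leb2, forall z : RR, cylinder s t z -> z.1 <> t0}.
Proof.
exists ([set t0] `*` setT); split => //.
- exact: measurableX.
- have := @product_measure1E _ _ _ _ R mu mu [set t0] setT (measurable_set1 _) (@measurableT _ _).
  by rewrite [X in (X * _)%E](@lebesgue_measure_set1 R t0) mul0e.
- move=> z /= zP; split => //; apply: contrapT => zt; apply: zP => _; exact.
Qed.

Variables (T nu M : R) (a aa : R -> R).
Hypothesis T0 : 0 <= T.
Hypothesis nu0 : 0 < nu.
Hypothesis ma : measurable_fun Omega a.
Hypothesis maa : measurable_fun Omega aa.
Hypothesis aaM : forall x, Omega x -> `|aa x| <= M.
Hypothesis aaE : {ae mu, forall x, Omega x -> a x = aa x}.
Local Notation rho := (drift_weight nu aa).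
Let C := I (fun x => `|- nu^-1 * aa x|).
Let mrho : measurable_fun Omega rho := drift_weight_measurable nu maa aaM.
Let mrhoV : measurable_fun Omega (fun x => (rho x)^-1) := drift_weightV_measurable nu maa aaM.
Let rmin0 : 0 < expR (- C) := expR_gt0 _.
Let rhoP x : Omega x -> expR (- C) <= rho x <= expR C := drift_weightP nu maa aaM (x := x).
Local Notation ip := (wip rho).
Let ipP : semi_inner ip := wip_semi_inner mrho rmin0 rhoP.

Variables (g1 g2 u ut v : R -> R -> R).
Hypothesis su : dirichlet_solution T nu a (fun t x => g1 t x * (u t x - v t x)) u.
Hypothesis sut : dirichlet_solution T nu a (fun t x => g2 t x * (ut t x - v t x)) ut.
Hypothesis sv : dirichlet_solution T nu a (fun _ _ => 0) v.
Hypothesis mg1 : measurable_fun (cylinder 0 T) (fun z : RR => g1 z.1 z.2).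
Hypothesis mg2 : measurable_fun (cylinder 0 T) (fun z : RR => g2 z.1 z.2).

Let w t : L2 R := toL2 (u t) - toL2 (v t).
Let wt t : L2 R := toL2 (ut t) - toL2 (v t).

(** After the gauges [expR (- c1 * t)] and [expR (- c2 * t)] both differences
follow the same evolution with zero potential. A multiple of one agrees with the
other at [be], hence at all earlier times by backward uniqueness. *)
Lemma constant_gain_comparison (al be c1 c2 lam : R) :
  0 <= al -> al <= be -> be <= T ->
  {ae leb2, forall z : RR, cylinder al be z -> g1 z.1 z.2 = c1} ->
  {ae leb2, forall z : RR, cylinder al be z -> g2 z.1 z.2 = c2} ->
  nrm ip (wt be - lam *: w be) = 0 ->
  forall t, al <= t <= be -> nrm ip (wt t - (lam * expR ((c1 - c2) * (be - t))) *: w t) = 0.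
Proof.
move=> al0 albe beT gc1 gc2 E t tP.
have W0 (c : R) : {ae mu, forall x, Omega x -> (fun=> 0) x = c - (fun=> c) x}.
  by apply: aeW => x _; rewrite subrr.
have cB (c : R) x : Omega x -> `|(fun=> c) x| <= `|c| by [].
have e1 := gauged_evolution T0 nu0 ma maa aaM aaE su sv mg1 al0 beT (measurable_cst c1) (cB c1) gc1 (W0 c1).
have e2 := gauged_evolution T0 nu0 ma maa aaM aaE sut sv mg2 al0 beT (measurable_cst c2) (cB c2) gc2 (W0 c2).
have LP : positive_operator ip (sturm_liouville rho nu (fun=> 0)).
  by apply: (sturm_liouville_positive mrho mrhoV rmin0 rhoP nu0 (Wm := 0)) => // x _; rewrite lexx.
have e3 := evolutionB ipP e2 (evolutionZ ipP (lam * expR ((c1 - c2) * be)) e1).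
have fact r : expR (- c2 * r) *: wt r - (lam * expR ((c1 - c2) * be)) *: (expR (- c1 * r) *: w r) =
    expR (- c2 * r) *: (wt r - (lam * expR ((c1 - c2) * (be - r))) *: w r).
  rewrite [RHS]scalerBr !scalerA; congr (_ - _ *: _).
  rewrite -mulrA -expRD mulrCA -expRD; congr (_ * expR _); ring.
have z : nrm ip (expR (- c2 * be) *: (wt be - lam *: w be)) = 0.
  by rewrite (nrmZ ipP) E mulr0.
have := backward_uniqueness ipP LP e3 albe.
rewrite /= fact subrr mulr0 expR0 mulr1 => /(_ z t tP).
rewrite /= fact (nrmZ ipP) => /eqP; rewrite mulf_eq0 normr_eq0 gt_eqF ?expR_gt0//= => /eqP.
exact.
Qed.

End ConstantGain.

(** * The two nudging identities *)

Section NudgingIdentities.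
Context {R : realType}.
Local Notation mu := (@lebesgue_measure R).
Local Notation Omega := (@Omega R).
Local Notation RR := (measurableTypeR R * measurableTypeR R)%type.
Implicit Types (s t x : R).
Hint Resolve measurable_Omega measurable_cylinder : core.

Variables (T nu kappa : R) (a : R -> R).
Hypothesis T0 : 0 < T.
Hypothesis nu0 : 0 < nu.
Hypothesis ha : inLinf a.

Section Bridge.
Variables (aa : R -> R) (M : R).
Hypothesis maa : measurable_fun Omega aa.
Hypothesis aaM : forall x, Omega x -> `|aa x| <= M.
Local Notation ip := (wip (drift_weight nu aa)).
Let C := I (fun x => `|- nu^-1 * aa x|).
Let rmin0 : 0 < expR (- C) := expR_gt0 _.

Lemma diff_ae_nrm (u ut v : R -> R) (c : R) : inL2 u -> inL2 ut -> inL2 v ->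
  ae_eq mu Omega (fun x => ut x - v x) (fun x => c * (u x - v x)) <->
  nrm ip (toL2 ut - toL2 v - c *: (toL2 u - toL2 v)) = 0.
Proof.
move=> u2 ut2 v2; have mr := drift_weight_measurable nu maa aaM.
have rP := drift_weightP nu maa aaM; split => [H|].
  apply: (nrm_ae mr rmin0 rP).
  by rewrite /ae_eq; apply: ae_imp H _ => x H Ox; have := H Ox; rewrite L2_funZ !L2_funB !toL2K.
move=> /(nrm_eq0_ae mr rmin0 rP) H.
rewrite /ae_eq; apply: ae_imp H _ => x H Ox; have := H Ox.
by rewrite /cst L2_funB L2_funZ !L2_funB !toL2K// => /eqP; rewrite subr_eq0 => /eqP.
Qed.
End Bridge.

Lemma constant_gain (k : R) (u0 uobs0 : R -> R) (uobs u ut : R -> R -> R) :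
  observation T nu a uobs0 uobs ->
  bfn_solution T nu kappa a (fun _ _ => k) uobs u0 u ut ->
  forall t : R, 0 <= t <= T ->
    ae_eq mu Omega (fun x => ut t x - uobs t x)
      (fun x => expR ((- k - kappa * k) * (T - t)) * (u t x - uobs t x)).
Proof.
move=> [so _] [[su _] [sut utT]] t tP.
have [ma _] := ha; have [M [aa [maa aaM aaE]]] := inLinf_clip ha.
have [_ uc _] := su; have [_ utc _] := sut; have [_ oc _] := so.
have TT : 0 <= T <= T by rewrite lexx ltW.
apply: (diff_ae_nrm maa aaM _ (uc.1 _ tP) (utc.1 _ tP) (oc.1 _ tP)).2.
rewrite -[expR _]mul1r.
apply: (constant_gain_comparison (ltW T0) nu0 ma maa aaM aaE su sut so _ _ (lexx 0) (ltW T0) (lexx T)) => //.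
- exact: aeW.
- exact: aeW.
- apply: (diff_ae_nrm maa aaM _ (uc.1 _ TT) (utc.1 _ TT) (oc.1 _ TT)).1.
  by rewrite /ae_eq; apply: ae_imp utT _ => x H Ox; rewrite mul1r H.
Qed.

(** The comparison is applied on [[t2, T]], [[t1, t2]] and [[0, t1]] in this
order; on the outer intervals the gain vanishes except at one time. *)
Lemma interval_gain (k t1 t2 : R) (u0 uobs0 : R -> R) (uobs u ut : R -> R -> R) :
  0 <= t1 -> t1 < t2 -> t2 <= T ->
  observation T nu a uobs0 uobs ->
  bfn_solution T nu kappa a
    (fun t _ => k * \1_(`[t1, t2]%classic : set R) t) uobs u0 u ut ->
  ae_eq mu Omega (fun x => ut 0 x - uobs 0 x)
    (fun x => expR ((- k - kappa * k) * (t2 - t1)) * (u 0 x - uobs 0 x)).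
Proof.
move=> t10 t12 t2T [so _] [[su _] [sut utT]].
have [ma _] := ha; have [M [aa [maa aaM aaE]]] := inLinf_clip ha.
have [_ uc _] := su; have [_ utc _] := sut; have [_ oc _] := so.
have TT : 0 <= T <= T by rewrite lexx ltW.
have t20 : 0 <= t2 by rewrite (le_trans t10)// ltW.
have mi (c : R) : measurable_fun (cylinder 0 T) (fun z : RR => c * \1_(`[t1, t2]%classic : set R) z.1).
  apply: measurable_funM => //.
  apply: (measurable_funS (@measurableT _ _)) => //.
  by apply: measurableT_comp => //; exact: measurable_indic.
have m1 : measurable_fun (cylinder 0 T) (fun z : RR => - (k * \1_(`[t1, t2]%classic : set R) z.1)).
  by apply: measurableT_comp => //; exact: mi.
have m2 : measurable_fun (cylinder 0 T) (fun z : RR => kappa * (k * \1_(`[t1, t2]%classic : set R) z.1)).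
  by apply: measurable_funM => //; exact: mi.
have out s t (j : R) : t <= t1 \/ t2 <= s -> 
   {ae leb2, forall z : RR, cylinder s t z -> j * (k * \1_(`[t1, t2]%classic : set R) z.1) = 0}.
  move=> st; apply: ae_imp2 (cylinder_ae_time s t t1) (cylinder_ae_time s t t2) _ => z h1 h2 zc.
  have {}h1 := h1 zc; have {}h2 := h2 zc; move: zc => [/=]; rewrite in_itv/= => /andP[sz zt] _.
  rewrite indicE; case: (boolP (_ \in _)); last by rewrite !mulr0.
  rewrite inE/= in_itv/= => /andP[k1 k2]; exfalso.
  case: st => st; [apply: h1|apply: h2]; apply/eqP; rewrite eq_le.
    by rewrite k1 (le_trans zt).
  by rewrite k2 (le_trans st).
have inn j : {ae leb2, forall z : RR, cylinder t1 t2 z -> j * (k * \1_(`[t1, t2]%classic : set R) z.1) = j * k}.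
  by apply: aeW => z [/= h _]; rewrite indicE mem_set// mulr1.
have neg s t c : {ae leb2, forall z : RR, cylinder s t z -> -1 * (k * \1_(`[t1, t2]%classic : set R) z.1) = c} ->
    {ae leb2, forall z : RR, cylinder s t z -> - (k * \1_(`[t1, t2]%classic : set R) z.1) = c}.
  by move=> H; apply: ae_imp H _ => z H /H; rewrite mulN1r.
have cmp := constant_gain_comparison (ltW T0) nu0 ma maa aaM aaE su sut so m1 m2.
have EN : nrm (wip (drift_weight nu aa)) (toL2 (ut T) - toL2 (uobs T) - 1 *: (toL2 (u T) - toL2 (uobs T))) = 0.
  apply: (diff_ae_nrm maa aaM _ (uc.1 _ TT) (utc.1 _ TT) (oc.1 _ TT)).1.
  by rewrite /ae_eq; apply: ae_imp utT _ => x H Ox; rewrite mul1r H.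
have t2P : t2 <= t2 <= T by rewrite lexx.
have t1P : t1 <= t1 <= t2 by rewrite lexx ltW.
have t0P : (0 : R) <= 0 <= t1 by rewrite lexx.
have E2 := cmp _ _ _ _ _ t20 t2T (lexx T) (neg _ _ _ (out t2 T (-1) (or_intror (lexx t2)))) (out t2 T kappa (or_intror (lexx t2))) EN _ t2P.
have E1 := cmp _ _ _ _ _ t10 (ltW t12) t2T (neg _ _ _ (inn (-1))) (inn kappa) E2 _ t1P.
have t1T : t1 <= T := le_trans (ltW t12) t2T.
have E0 := cmp _ _ _ _ _ (lexx 0) t10 t1T (neg _ _ _ (out 0 t1 (-1) (or_introl (lexx t1)))) (out 0 t1 kappa (or_introl (lexx t1))) E1 _ t0P.
have z0 : (0 : R) <= 0 <= T by rewrite lexx ltW.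
apply: (diff_ae_nrm maa aaM _ (uc.1 _ z0) (utc.1 _ z0) (oc.1 _ z0)).2.
have -> : expR ((- k - kappa * k) * (t2 - t1)) = 1 * expR ((0 - 0) * (T - t2)) *
    expR ((-1 * k - kappa * k) * (t2 - t1)) * expR ((0 - 0) * (t1 - 0)).
  by rewrite subrr !mul0r expR0 !mul1r mulr1 mulN1r.
exact: E0.
Qed.
End NudgingIdentities.

(** * Trapezoidal bumps *)

Section Bumps.
Context {R : realType}.
Local Notation mu := (@lebesgue_measure R).
Local Notation Omega := (@Omega R).
Local Notation X := (L2 R).
Implicit Types (x y c d : R).
Hint Resolve measurable_Omega : core.

(** Half-open, so that adjacent slots do not overlap and primitives vanish
exactly up to [c]. *)
Definition slot c d x : R := (c < x <= d)%R%:R.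

Lemma sqr_one_sub_le1 (p : R) : 0 <= p <= 1 -> (1 - p) ^+ 2 <= 1.
Proof. by move=> /andP[p0 p1]; rewrite -[leRHS](expr1n _ 2) ler_pXn2r ?nnegrE//; lra. Qed.

Lemma slot_measurable c d : measurable_fun Omega (slot c d).
Proof.
have -> : slot c d = \1_(`]c, d]%classic : set R).
  by apply/funext => x; rewrite indicE mem_setE /= in_itv.
exact: measurable_indic.
Qed.

Lemma slot_bounded c d x : `|slot c d x| <= 1.
Proof. by rewrite /slot; case: (_ && _); rewrite ?normr1 ?normr0. Qed.

Lemma slot_ge0 c d x : 0 <= slot c d x.
Proof. by rewrite /slot ler0n. Qed.

Lemma slot_inL2 c d : inL2 (slot c d).
Proof. by apply: (inL2_bounded (C := 1)); [exact: slot_measurable|move=> x _; exact: slot_bounded]. Qed.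

Lemma prim_left f c x : intO f -> (forall y, Omega y -> y <= c -> f y = 0) ->
  Omega x -> x <= c -> prim f x = 0.
Proof.
move=> If f0 Ox xc; have I0 := intO_cst (0 : R); have x0 : 0 <= x by have /OmegaP/andP[] := Ox.
have := @prim_sub_eq _ f (fun=> 0) 0 x Omega0 Ox x0 If I0.
rewrite !prim0 !subr0 prim_cst// mul0r; apply=> z Oz /andP[_ zx].
by apply: f0 => //; exact: le_trans xc.
Qed.

Lemma prim_right f d x : intO f -> (forall y, Omega y -> d < y -> f y = 0) ->
  Omega x -> d <= x -> prim f x = I f.
Proof.
move=> If f0 Ox dx; have I0 := intO_cst (0 : R); have x1 : x <= 1 by have /OmegaP/andP[] := Ox.
have := @prim_sub_eq _ f (fun=> 0) x 1 Ox Omega1 x1 If I0.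
rewrite !prim_cst// ?mul0r ?subrr ?prim1; last exact: Omega1.
move=> H; apply/esym/eqP; rewrite -subr_eq0; apply/eqP; apply: H => z Oz /andP[xz _].
by apply: f0 => //; exact: le_lt_trans xz.
Qed.

Lemma I_slot c d : 0 <= c -> c <= d -> d <= 1 -> I (slot c d) <= d - c.
Proof.
move=> c0 cd d1.
have Oc : Omega c by apply/OmegaP; rewrite c0 (le_trans cd).
have Od : Omega d by apply/OmegaP; rewrite d1 (le_trans c0).
have Is := inL2_intO (slot_inL2 c d).
rewrite -(@prim_right (slot c d) d d)//; last first.
  by move=> y _ dy; rewrite /slot (leNgt y) dy andbF.
have := @prim_sub_le _ (slot c d) (fun=> 1) c d Oc Od cd Is (intO_cst 1).
rewrite !prim_cst// !mul1r (@prim_left (slot c d) c c)// ?subr0.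
  by apply => z _ _; exact: le_trans (ler_norm _) (slot_bounded _ _ _).
by move=> y _ yc; rewrite /slot ltNge yc.
Qed.

Lemma I_slots c d h : 0 <= c -> 0 < h -> c + 2 * h <= d - 2 * h -> d < 1 ->
  I (fun x => slot c (c + 2 * h) x + slot (d - 2 * h) d x) <= 4 * h.
Proof.
move=> c0 h0 cd d1; have Is p q := inL2_intO (slot_inL2 p q).
have [c1 c2] : c <= c + 2 * h /\ c + 2 * h <= 1 by split; lra.
have [e0 e1] : 0 <= d - 2 * h /\ d - 2 * h <= d by split; lra.
have S1 := I_slot c0 c1 c2; have S2 := I_slot e0 e1 (ltW d1).
by rewrite I_D//; lra.
Qed.

Variable rho : R -> R.
Variables (rmin rmax : R).
Hypothesis mrho : measurable_fun Omega rho.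
Hypothesis mrhoV : measurable_fun Omega (fun x => (rho x)^-1).
Hypothesis rmin0 : 0 < rmin.
Hypothesis rhoP : forall x, Omega x -> rmin <= rho x <= rmax.
Local Notation ip := (wip rho).

Let rho0 x : Omega x -> 0 < rho x. Proof. exact: (rho_gt0 rmin0 rhoP). Qed.
Let rhoB x : Omega x -> `|rho x| <= rmax. Proof. exact: (rho_bdd rmin0 rhoP). Qed.
Let rmax0 : 0 < rmax. Proof. by apply: lt_le_trans (rho0 Omega0) _; have /andP[] := rhoP Omega0. Qed.
Let rhoVB x : Omega x -> rmax^-1 <= (rho x)^-1 <= rmin^-1.
Proof.
by move=> Ox; have /andP[r1 r2] := rhoP Ox; rewrite !lef_pV2 ?posrE ?r1 ?r2//; exact: rho0.
Qed.

Let rs c d x := rho x * slot c d x.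

Let Irs c d : intO (rs c d).
Proof. by apply: (intO_bddM mrho rhoB); apply: inL2_intO; exact: slot_inL2. Qed.

Let rs_ge0 c d x : Omega x -> 0 <= rs c d x.
Proof. by move=> Ox; rewrite mulr_ge0 ?slot_ge0// ltW// rho0. Qed.

Let rs_left c d x : x <= c -> rs c d x = 0.
Proof. by move=> xc; rewrite /rs /slot ltNge xc mulr0. Qed.

Let rs_right c d x : d < x -> rs c d x = 0.
Proof. by move=> dx; rewrite /rs /slot (leNgt x) dx andbF mulr0. Qed.

Let prim_rs_ge c d x : 0 <= c -> c <= x -> x <= d -> d <= 1 -> rmin * (x - c) <= prim (rs c d) x.
Proof.
move=> c0 cx xd d1.
have Oc : Omega c by apply/OmegaP; rewrite c0 (le_trans cx)// (le_trans xd).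
have Ox : Omega x by apply/OmegaP; rewrite (le_trans c0 cx) (le_trans xd).
have -> : prim (rs c d) x = prim (rs c d) x - prim (rs c d) c.
  by rewrite (@prim_left (rs c d) c c) ?subr0// => y _; exact: rs_left.
apply: prim_sub_ge => // z Oz /andP[cz zx]; rewrite /rs /slot cz (le_trans zx xd) mulr1.
by have /andP[] := rhoP Oz.
Qed.

Let I_rs c d : 0 <= c -> c < d -> d <= 1 -> 0 < I (rs c d).
Proof.
move=> c0 cd d1; have Od : Omega d by apply/OmegaP; rewrite d1 (le_trans c0)// ltW.
rewrite -(@prim_right (rs c d) d d)//; last by move=> y _; exact: rs_right.
by apply: lt_le_trans (prim_rs_ge c0 (ltW cd) (lexx d) d1); rewrite mulr_gt0// subr_gt0.
Qed.

Definition potential (eta : R -> R) x := prim (fun y => (rho y)^-1 * prim eta y) x.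

Let Irprim eta : intO eta -> intO (fun y => (rho y)^-1 * prim eta y).
Proof.
move=> Ie; apply: (intO_bddM (C := rmin^-1)) => //.
  move=> x Ox; have /andP[h1 h2] := rhoVB Ox; rewrite ger0_norm//.
  by rewrite invr_ge0 ltW// rho0.
apply: (intO_bounded (C := I (fun x => `|eta x|))); first exact: prim_measurable.
by move=> x Ox; exact: prim_bounded.
Qed.

Lemma potential_lin eta1 eta2 (k1 k2 : R) x : intO eta1 -> intO eta2 -> Omega x ->
  potential (fun y => k1 * eta1 y - k2 * eta2 y) x = k1 * potential eta1 x - k2 * potential eta2 x.
Proof.
move=> I1 I2 Ox; rewrite /potential -!prim_Z//; [|exact: Irprim..].
rewrite -prim_B//; [|by apply: intOZ; exact: Irprim..].
apply: prim_eq => // y Oy; rewrite prim_B//; [|exact: intOZ..].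
by rewrite !prim_Z//; ring.
Qed.

(** The source is one slot up and one slot down, balanced so that the flux
returns to 0; the flux is nonnegative in between, so the potential increases to
a constant. *)
Lemma transition c h : 0 <= c -> 0 < h -> c + 2 * h <= 1 -> exists r1 r2 Z : R,
  let eta x := r1 * rs c (c + h) x - r2 * rs (c + h) (c + 2 * h) x in
  [/\ 0 < Z, forall x, Omega x -> x <= c -> potential eta x = 0,
      forall x, Omega x -> c + 2 * h <= x -> potential eta x = Z &
      forall x, Omega x -> 0 <= potential eta x <= Z].
Proof.
move=> c0 h0 ch.
have R1 : 0 < I (rs c (c + h)) by apply: I_rs => //; lra.
have R2 : 0 < I (rs (c + h) (c + 2 * h)) by apply: I_rs; lra.
set r1 := (I (rs c (c + h)))^-1; set r2 := (I (rs (c + h) (c + 2 * h)))^-1.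
have r10 : 0 < r1 by rewrite invr_gt0.
have r20 : 0 < r2 by rewrite invr_gt0.
pose eta x := r1 * rs c (c + h) x - r2 * rs (c + h) (c + 2 * h) x.
have Ieta : intO eta by apply: intOB; apply: intOZ.
have primE x : Omega x -> prim eta x = r1 * prim (rs c (c + h)) x - r2 * prim (rs (c + h) (c + 2 * h)) x.
  by move=> Ox; rewrite prim_B//; [rewrite !prim_Z|exact: intOZ..].
have lowE x : Omega x -> x <= c + h -> prim eta x = r1 * prim (rs c (c + h)) x.
  move=> Ox xc; rewrite primE// (@prim_left (rs (c + h) (c + 2 * h)) (c + h) x)// ?mulr0 ?subr0//.
  by move=> y _; exact: rs_left.
have highE x : Omega x -> c + h <= x -> prim eta x = 1 - r2 * prim (rs (c + h) (c + 2 * h)) x.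
  move=> Ox cx; rewrite primE// (@prim_right (rs c (c + h)) (c + h) x)//; last by move=> y _; exact: rs_right.
  by rewrite mulVf// gt_eqF.
have pos x : Omega x -> 0 <= prim eta x.
  move=> Ox; have [xc|cx] := leP x (c + h).
    by rewrite lowE// mulr_ge0 ?(ltW r10)//; apply: prim_ge0 => // y Oy; exact: rs_ge0.
  have L : prim (rs (c + h) (c + 2 * h)) x <= I (rs (c + h) (c + 2 * h)).
    by apply: prim_le_I => // y Oy; exact: rs_ge0.
  rewrite highE ?(ltW cx)// subr_ge0 -[leRHS](mulVf (lt0r_neq0 R2)).
  by rewrite ler_wpM2l ?(ltW r20).
have left x : Omega x -> x <= c -> prim eta x = 0.
  move=> Ox xc; rewrite lowE//; last lra.
  by rewrite (@prim_left (rs c (c + h)) c x) ?mulr0// => y _; exact: rs_left.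
have right x : Omega x -> c + 2 * h < x -> prim eta x = 0.
  move=> Ox cx; rewrite highE//; last lra.
  rewrite (@prim_right (rs (c + h) (c + 2 * h)) (c + 2 * h) x)//; [|by move=> y _; exact: rs_right|lra].
  by rewrite mulVf ?subrr// gt_eqF.
pose zeta y := (rho y)^-1 * prim eta y.
have Iz : intO zeta by exact: Irprim.
have z0 y : Omega y -> 0 <= zeta y.
  by move=> Oy; rewrite mulr_ge0 ?pos// invr_ge0 ltW// rho0.
have Z0 : 0 < I zeta.
  have O1 : Omega (c + h / 2) by apply/OmegaP; apply/andP; split; lra.
  have O2 : Omega (c + h) by apply/OmegaP; apply/andP; split; lra.
  have le12 : c + h / 2 <= c + h by lra.
  have mpos : 0 < rmax^-1 * (r1 * (rmin * (h / 2))).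
    by rewrite mulr_gt0 ?invr_gt0// mulr_gt0// mulr_gt0//; lra.
  have G : rmax^-1 * (r1 * (rmin * (h / 2))) * (c + h - (c + h / 2)) <= prim zeta (c + h) - prim zeta (c + h / 2).
    apply: prim_sub_ge => // z Oz /andP[z1 z2].
    have /andP[v1 v2] := rhoVB Oz.
    apply: ler_pM => //; first by rewrite invr_ge0 ltW.
      by rewrite mulr_ge0 ?(ltW r10)// mulr_ge0 ?(ltW rmin0)//; lra.
    rewrite lowE// ler_wpM2l ?(ltW r10)//.
    apply: le_trans (prim_rs_ge c0 _ z2 _); [|lra|lra].
    by rewrite ler_wpM2l ?(ltW rmin0)//; lra.
  have G2 := prim_ge0 O1 z0; have G3 := prim_le_I O2 Iz z0.
  have G4 : 0 < rmax^-1 * (r1 * (rmin * (h / 2))) * (c + h - (c + h / 2)).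
    by rewrite mulr_gt0//; lra.
  lra.
exists r1, r2, (I zeta); split => //.
- move=> x Ox xc; apply: (@prim_left zeta c) => // y Oy yc.
  by rewrite /zeta left// mulr0.
- move=> x Ox cx; apply: (@prim_right zeta (c + 2 * h)) => // y Oy yc.
  by rewrite /zeta right// mulr0.
- by move=> x Ox; rewrite prim_ge0//= prim_le_I.
Qed.

(** The source is piecewise constant, that is, a combination of indicators of
intervals: this is what lets the induction of [test_flat] close. *)
Lemma bump c d h : 0 <= c -> 0 < h -> c + 2 * h <= d - 2 * h -> d < 1 ->
  exists (k1 k2 k3 k4 : R) (Psi : R -> R),
  let y x := k1 * slot c (c + h) x + k2 * slot (c + h) (c + 2 * h) x +
    k3 * slot (d - 2 * h) (d - h) x + k4 * slot (d - h) d x in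
  [/\ flux_domain rho Psi (prim (fun x => rho x * y x)) (fun x => rho x * y x),
      forall x, Omega x -> x <= c \/ d <= x -> Psi x = 0 &
      forall x, Omega x -> (slot c d x - Psi x) ^+ 2 <= slot c (c + 2 * h) x + slot (d - 2 * h) d x].
Proof.
move=> c0 h0 cd d1.
have [r1 [r2 [Z [Z0 L1 R1 B1]]]] := @transition c h c0 h0 ltac:(lra).
have [s1 [s2 [Y [Y0 L2 R2 B2]]]] := @transition (d - 2 * h) h ltac:(lra) h0 ltac:(lra).
set e1 := (fun x => _ - _) in L1 R1 B1; set e2 := (fun x => _ - _) in L2 R2 B2.
have E1 : d - 2 * h + h = d - h by lra.
have E2 : d - 2 * h + 2 * h = d by lra.
have I1 : intO e1 by apply: intOB; apply: intOZ.
have I2 : intO e2 by apply: intOB; apply: intOZ.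
rewrite E2 in R2.
pose eta x := Z^-1 * e1 x - Y^-1 * e2 x.
pose Psi := potential eta.
have PsiE x : Omega x -> Psi x = Z^-1 * potential e1 x - Y^-1 * potential e2 x.
  by move=> Ox; exact: potential_lin.
exists (Z^-1 * r1), (- (Z^-1 * r2)), (- (Y^-1 * s1)), (Y^-1 * s2), Psi => y.
have etaE : (fun x => rho x * y x) = eta.
  by apply/funext => x; rewrite /y /eta /e1 /e2 /rs E1 E2; ring.
have y2 : inL2 y.
  by do !apply: inL2D; apply: inL2Z; exact: slot_inL2.
have zero x : Omega x -> x <= c \/ d <= x -> Psi x = 0.
  move=> Ox [xc|dx]; rewrite PsiE//.
    by rewrite L1// L2 ?mulr0 ?subrr//; lra.
  rewrite R1 ?R2//; last lra.
  by rewrite !mulVf ?subrr// gt_eqF.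
split; [|exact: zero|].
- rewrite etaE; split.
  + by rewrite -etaE; exact: (inL2_bddM mrho rhoB).
  + by move=> x Ox; rewrite prim0 add0r.
  + by [].
  + by apply: zero; [exact: Omega1|right; exact: ltW].
- move=> x Ox.
  have [xc|cx] := leP x c.
    rewrite zero//; last by left.
    by rewrite /slot ltNge xc/= subrr expr0n/= addr_ge0 ?ler0n.
  have [dx|xd] := ltP d x.
    rewrite zero//; last by right; exact: ltW.
    by rewrite /slot (leNgt x d) dx andbF subrr expr0n/= addr_ge0 ?ler0n.
  have b1 : 0 <= Z^-1 * potential e1 x <= 1.
    have /andP[k1 k2] := B1 _ Ox; rewrite mulr_ge0 ?invr_ge0 ?(ltW Z0)//=.
    by rewrite mulrC ler_pdivrMr// mul1r.
  have b2 : 0 <= Y^-1 * potential e2 x <= 1.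
    have /andP[k1 k2] := B2 _ Ox; rewrite mulr_ge0 ?invr_ge0 ?(ltW Y0)//=.
    by rewrite mulrC ler_pdivrMr// mul1r.
  have s1x : slot c d x = 1 by rewrite /slot cx xd.
  rewrite s1x.
  have [xl|lx] := leP x (c + 2 * h).
    rewrite {1}/slot cx xl /= ler_wpDr ?slot_ge0//.
    rewrite (PsiE _ Ox) (L2 _ Ox (le_trans xl cd)) mulr0 subr0.
    exact: sqr_one_sub_le1.
  have [xr|rx] := leP x (d - 2 * h).
    rewrite (PsiE _ Ox) (R1 _ Ox (ltW lx)) (L2 _ Ox xr) mulr0 subr0 mulVf ?gt_eqF// subrr expr0n/=.
    by rewrite addr_ge0 ?slot_ge0.
  have -> : slot (d - 2 * h) d x = 1 by rewrite /slot rx xd.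
  apply: ler_wpDl; first exact: slot_ge0.
  rewrite (PsiE _ Ox) (R1 _ Ox (ltW lx)) mulVf ?gt_eqF//.
  have -> (q : R) : 1 - (1 - q) = q by ring.
  have /andP[p0 p1] := b2.
  by rewrite expr_le1.
Qed.

End Bumps.

(** * Local test functions *)

Section IllPosedness.
Context {R : realType}.
Local Notation mu := (@lebesgue_measure R).
Local Notation Omega := (@Omega R).
Local Notation X := (L2 R).
Local Notation RR := (measurableTypeR R * measurableTypeR R)%type.
Implicit Types (s t x : R).
Hint Resolve measurable_Omega measurable_cylinder : core.

Lemma sqr_le (p q : R) : 0 <= q -> p ^+ 2 <= q ^+ 2 -> p <= q.
Proof.
move=> q0; case: (ltP p 0) => [p0 _|p0]; first exact: ltW (lt_le_trans p0 q0).
by rewrite ler_pXn2r// nnegrE.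
Qed.

(** A point of ]0, 1[ off [[a1, b1]] is not in the essential support. *)
Lemma vanishing_interval (K : R -> R) (a1 b1 : R) :
  0 <= a1 -> a1 < b1 -> b1 <= 1 -> a1 <> 0 \/ b1 <> 1 ->
  ess_support K `<=` `[a1, b1]%classic ->
  exists c d : R, [/\ 0 < c, c < d, d < 1 &
    {ae mu, forall x, Omega x -> c < x < d -> K x = 0}].
Proof.
move=> a10 ab b11 ne sK.
have near0 (y lo hi : R) : 0 <= lo -> lo < y < hi -> hi <= 1 -> ~ `[a1, b1]%classic y ->
    exists c d : R, [/\ 0 < c, c < d, d < 1 & {ae mu, forall x, Omega x -> c < x < d -> K x = 0}].
  move=> lo0 /andP[loy yhi] hi1 ny.
  have : ~ ess_support K y by move=> /sK.
  rewrite /ess_support /= => /existsNP[U] /not_implyP[/nbhs_ballP[r /= r0 rU] /contrapT aeU].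
  pose q := Num.min r (Num.min (y - lo) (hi - y)) / 2.
  have q0 : 0 < q by rewrite divr_gt0// !lt_min r0 !subr_gt0 loy yhi.
  have [q1 q2 q3] : [/\ q < r, q < y - lo & q < hi - y].
    have H : q < Num.min r (Num.min (y - lo) (hi - y)).
      by rewrite /q ltr_pdivrMr// ltr_pMr ?ltr1n// !lt_min r0 !subr_gt0 loy yhi.
    by move: H; rewrite !lt_min => /and3P[].
  exists (y - q), (y + q); split; [lra..|].
  apply: ae_imp aeU _ => x H Ox /andP[x1 x2]; apply: H => //; apply: rU.
  by rewrite /ball/= ltr_norml; apply/andP; split; lra.
have [b1n|b1e] := eqVneq b1 1.
  have a1n : a1 != 0 by apply/eqP; case: ne => // /(_ b1n).
  have a1p : 0 < a1 by rewrite lt0r a1n.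
  apply: (near0 (a1 / 2) 0 a1) => //; [by apply/andP; split; lra|lra|].
  by rewrite /= in_itv/= => /andP[? _]; lra.
have b1p : b1 < 1 by rewrite lt_neqAle b1e.
apply: (near0 ((b1 + 1) / 2) b1 1) => //; [lra|by apply/andP; split; lra|].
by rewrite /= in_itv/= => /andP[_ ?]; lra.
Qed.

Lemma zero_observation (T nu : R) (a : R -> R) : observation T nu a (fun=> 0) (fun _ _ => 0).
Proof.
split; last by apply: aeW.
split; first exact: measurable_cst.
- split=> [t _|t0 _]; first exact: inL2_cst.
  rewrite (_ : (fun t => _) = (fun=> 0)); first exact: cvg_cst.
  by apply/funext => t; rewrite -[RHS](I_cst (0 : R)); apply: I_eq => x _; rewrite subrr expr0n.
- exists (fun _ _ => 0); split.
  + exact: measurable_cst.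
  + apply: (eq_integrable _ _ _ _ (integrable0 _ _)) => // z _; by rewrite expr0n.
  + apply: aeW => t _; split => //; first exact: inL2_cst.
    by move=> x Ox; rewrite add0r -/(prim (fun=> 0) x) prim_cst// mul0r.
  + move=> psi psi' _ s t _ _ _.
    rewrite (_ : (fun x => 0 * psi x) = (fun=> 0)); last by apply/funext => x; rewrite mul0r.
    rewrite subrr (_ : (fun z => _) = (fun=> 0)); last first.
      by apply/funext => z; rewrite !(mulr0, mul0r) subrr addr0.
    by rewrite /Rintegral integral0.
Qed.

Section Test.
Variable rho : R -> R.
Variables (rmin rmax nu : R).
Hypothesis mrho : measurable_fun Omega rho.
Hypothesis mrhoV : measurable_fun Omega (fun x => (rho x)^-1).
Hypothesis rmin0 : 0 < rmin.
Hypothesis rhoP : forall x, Omega x -> rmin <= rho x <= rmax.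
Local Notation ip := (wip rho).
Let ipP : semi_inner ip := wip_semi_inner mrho rmin0 rhoP.
Let rmax0 : 0 < rmax.
Proof. by apply: lt_le_trans rmin0 _; have /andP[] := rhoP Omega0; exact: le_trans. Qed.

(** Domains of the operators do not depend on the bounded potential. *)
Lemma sturm_liouville_change (W W' : R -> R) (P h h' : X) : sturm_liouville rho nu W P h ->
  {ae mu, forall x, Omega x -> L2_fun h' x = L2_fun h x + (W' x - W x) * L2_fun P x} ->
  sturm_liouville rho nu W' P h'.
Proof.
move=> [xi [eta [D E]]] hh'; exists xi, eta; split => //.
rewrite /ae_eq; apply: ae_imp2 E hh' _ => x H1 H2 Ox.
by rewrite (H2 Ox) mulrDr (H1 Ox); ring.
Qed.

Variables (c0 d0 m : R) (W1 W2 : R -> R).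
Hypothesis c00 : 0 <= c0.
Hypothesis d01 : d0 < 1.
Hypothesis W1m : {ae mu, forall x, Omega x -> c0 < x < d0 -> W1 x = m}.
Hypothesis W2m : {ae mu, forall x, Omega x -> c0 < x < d0 -> W2 x = m}.
Local Notation L1 := (sturm_liouville rho nu W1).
Local Notation L2 := (sturm_liouville rho nu W2).

Definition interval_test (x : X) : Prop := exists c d,
  [/\ c0 < c, c < d, d < d0 & ae_eq mu Omega (L2_fun x) (slot c d)].

Definition span (P : X -> Prop) (y : X) : Prop := forall N : X -> Prop,
  (forall (a : R) (x y : X), N x -> N y -> N (a *: x + y)) -> (forall x : X, P x -> N x) -> N y.

(** Indicators of intervals, and elements of both domains at which the two
operators take the same value, a combination of such indicators plus [m *: x]:
where both potentials equal [m], both operators are the potential-free one plus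
[m]. *)
Definition local_test (x : X) : Prop := interval_test x \/
  exists y, [/\ span interval_test y, L1 x (y + m *: x) & L2 x (y + m *: x)].

(** Indicators are limits of the trapezoids of [bump]; the other local tests are
their own approximation. *)
Lemma local_test_approx psi : local_test psi -> forall e : R, 0 < e -> exists psi' eta,
  [/\ nrm ip (psi - psi') <= e, L1 psi' eta, L2 psi' eta & span local_test eta].
Proof.
have span_add (y x : X) : span interval_test y -> local_test x -> span local_test (y + m *: x).
  move=> sy lx N NL NS; rewrite addrC; apply: (NL); first exact: NS.
  by apply: (sy N NL) => z iz; apply: (NS); left.
case=> [[c [d [c0c cd dd0 psiE]]]|[y [sy l1 l2]]] e e0; last first.
  exists psi, (y + m *: psi); split => //; last by apply: span_add => //; right; exists y.
  by rewrite subrr -(scale0r (0 : X)) (nrmZ ipP) normr0 mul0r ltW.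
pose h := Num.min ((d - c) / 4) (e ^+ 2 / (4 * rmax)).
have h0 : 0 < h by rewrite lt_min !divr_gt0 ?subr_gt0 ?exprn_gt0 ?mulr_gt0.
have /andP[hl hr] : (h <= (d - c) / 4) && (h <= e ^+ 2 / (4 * rmax)).
  by rewrite -le_min; exact: lexx.
have h1 : 4 * h <= d - c by rewrite mulrC -ler_pdivlMr.
have h2 : rmax * (4 * h) <= e ^+ 2.
  by rewrite (_ : rmax * (4 * h) = h * (4 * rmax)); [rewrite -ler_pdivlMr ?mulr_gt0|ring].
have cc : 0 <= c := ltW (le_lt_trans c00 c0c).
have dd : d < 1 := lt_trans dd0 d01.
have hcd : c + 2 * h <= d - 2 * h by lra.
have [k1 [k2 [k3 [k4 [Psi /= [D Psi0 PsiE]]]]]] :=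
  @bump _ rho rmin rmax mrho mrhoV rmin0 rhoP c d h cc h0 hcd dd.
set y := (fun x => k1 * slot c (c + h) x + k2 * slot (c + h) (c + 2 * h) x +
    k3 * slot (d - 2 * h) (d - h) x + k4 * slot (d - h) d x) in D.
have Psi2 : inL2 Psi := flux_inL2 mrhoV rmin0 rhoP D.
pose sl p q : X := toL2 (slot p q).
pose z : X := (- nu) *: (k1 *: sl c (c + h) + (k2 *: sl (c + h) (c + 2 * h) +
    (k3 *: sl (d - 2 * h) (d - h) + k4 *: sl (d - h) d))).
have zE x : L2_fun z x = - nu * y x.
  by rewrite /z /y /sl !(L2_funZ, L2_funD) !toL2K; [ring|exact: slot_inL2..].
have slI p q : c0 < p -> p < q -> q < d0 -> interval_test (sl p q).
  by move=> *; exists p, q; split => //; apply: aeW => x _; rewrite /sl toL2K//; exact: slot_inL2.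
have sz : span interval_test z.
  move=> N NL NS.
  have NZ (b : R) (x : X) : N x -> N (b *: x).
    by move=> Nx; rewrite (_ : b *: x = (b - 1) *: x + x); [exact: NL|rewrite scalerBl scale1r subrK].
  apply: (NZ); apply: (NL); first by apply: (NS); apply: slI; lra.
  apply: (NL); first by apply: (NS); apply: slI; lra.
  apply: (NL); first by apply: (NS); apply: slI; lra.
  by apply: (NZ); apply: (NS); apply: slI; lra.
pose x0 : X := toL2 Psi.
have SL W : {ae mu, forall x, Omega x -> c0 < x < d0 -> W x = m} ->
    sturm_liouville rho nu W x0 (z + m *: x0).
  move=> WmE; exists (prim (fun x => rho x * y x)), (fun x => rho x * y x).
  rewrite /x0 toL2K//; split => //.
  rewrite /ae_eq; apply: ae_imp WmE _ => x H Ox.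
  rewrite L2_funD L2_funZ zE toL2K//.
  have -> : W x * Psi x = m * Psi x.
    have [xc|cx] := leP x c; first by rewrite Psi0 ?mulr0//; left.
    have [dx|xd] := leP d x; first by rewrite Psi0 ?mulr0//; right.
    by rewrite H//; apply/andP; split; lra.
  ring.
exists x0, (z + m *: x0); split; [|exact: SL|exact: SL|]; last first.
  by apply: span_add => //; right; exists z; split => //; exact: SL.
have diff : nrm ip (psi - x0) = nrm ip (sl c d - x0).
  have E0 : nrm ip (psi - sl c d) = 0.
    apply: (nrm_ae mrho rmin0 rhoP); rewrite /ae_eq; apply: ae_imp psiE _ => x H Ox.
    by rewrite (H Ox) toL2K//; exact: slot_inL2.
  apply/eqP; rewrite eq_le; apply/andP; split.
    have := nrmD ipP (psi - sl c d) (sl c d - x0).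
    by rewrite addrA subrK E0 add0r.
  have := nrmD ipP (sl c d - psi) (psi - x0).
  by rewrite addrA subrK [nrm ip (sl c d - psi)](nrm_distC ipP) E0 add0r.
rewrite diff; apply: (sqr_le (ltW e0)).
apply: le_trans (nrm_le_plain mrho rmin0 rhoP _) _; apply: le_trans h2.
apply: (ler_wpM2l (ltW rmax0)).
apply: (@le_trans _ _ (I (fun x => slot c (c + 2 * h) x + slot (d - 2 * h) d x))).
  apply: I_le; [by apply: inL2_sqr; exact: L2_inL2|by apply: intOD; apply: inL2_intO; exact: slot_inL2|].
  have sE : L2_fun (sl c d) = slot c d by apply: toL2K; exact: slot_inL2.
  have xE : L2_fun x0 = Psi by exact: toL2K.
  by move=> x Ox; rewrite L2_funB sE xE; exact: PsiE.
exact: I_slots.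
Qed.

End Test.
End IllPosedness.

(** * Consequences of solvability for a gain depending on space *)

Section Obstructed.
Context {R : realType}.
Local Notation mu := (@lebesgue_measure R).
Local Notation Omega := (@Omega R).
Local Notation X := (L2 R).
Implicit Types (s t x : R).
Hint Resolve measurable_Omega : core.

Variable rho : R -> R.
Variables (rmin rmax nu : R).
Hypothesis mrho : measurable_fun Omega rho.
Hypothesis mrhoV : measurable_fun Omega (fun x => (rho x)^-1).
Hypothesis rmin0 : 0 < rmin.
Hypothesis rhoP : forall x, Omega x -> rmin <= rho x <= rmax.
Hypothesis nu0 : 0 < nu.
Local Notation ip := (wip rho).
Let ipP : semi_inner ip := wip_semi_inner mrho rmin0 rhoP.

Variables (c0 d0 m Wm : R) (W1 W2 : R -> R).
Hypothesis c00 : 0 <= c0.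
Hypothesis d01 : d0 < 1.
Hypothesis mW1 : measurable_fun Omega W1.
Hypothesis mW2 : measurable_fun Omega W2.
Hypothesis W1P : forall x, Omega x -> 0 <= W1 x <= Wm.
Hypothesis W2P : forall x, Omega x -> 0 <= W2 x <= Wm.
Hypothesis W1m : {ae mu, forall x, Omega x -> c0 < x < d0 -> W1 x = m}.
Hypothesis W2m : {ae mu, forall x, Omega x -> c0 < x < d0 -> W2 x = m}.
Local Notation L1 := (sturm_liouville rho nu W1).
Local Notation L2 := (sturm_liouville rho nu W2).
Let L1P : positive_operator ip L1 := sturm_liouville_positive mrho mrhoV rmin0 rhoP nu0 mW1 W1P.
Let L2P : positive_operator ip L2 := sturm_liouville_positive mrho mrhoV rmin0 rhoP nu0 mW2 W2P.

Variables (psi Psi Theta : X).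
Hypothesis psiI : interval_test c0 d0 psi.
Hypothesis PsiE : sturm_liouville rho nu (fun x => W2 x + 1) Psi psi.
Hypothesis ThetaE : sturm_liouville rho nu (fun x => W1 x + 1) Theta psi.

Let resolvent_shift (W : R -> R) (P : X) : sturm_liouville rho nu (fun x => W x + 1) P psi ->
  sturm_liouville rho nu W P (psi - 1 *: P).
Proof.
move=> H; apply: sturm_liouville_change H _; apply: aeW => x _.
by rewrite L2_funB L2_funZ; ring.
Qed.

(** The obstruction says that [U T] is orthogonal to [U 0]. By [ip_mid] the
state at half time vanishes, hence so does the initial one. *)
Lemma obstructed_initial (T : R) (U V : R -> X) : 0 < T ->
  evolution ip L1 0 T U -> evolution ip L2 0 T V ->
  nrm ip (V T - U T) = 0 -> nrm ip (U 0 - (Psi - Theta)) = 0 ->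
  nrm ip (Psi - Theta) = 0.
Proof.
move=> T0 eU eV UV U0.
have approx := local_test_approx mrho mrhoV rmin0 rhoP c00 d01 W1m W2m.
have lt : local_test rho nu c0 d0 m W1 W2 psi by left.
have ob := obstruction ipP L1P L2P T0 eU eV UV (approx nu) ltr01 lt (resolvent_shift PsiE) (resolvent_shift ThetaE).
have T00 : (0 : R) <= 0 <= T by rewrite lexx ltW.
have TTT : 0 <= T <= T by rewrite lexx ltW.
have z : ip (U T) (U 0) = 0.
  have : ip (U T) (U 0 - (Psi - Theta)) = 0 by rewrite (ipC ipP) (nrm0_ip ipP).
  by rewrite (ipBr ipP) ob subr0.
have half : nrm ip (U (T / 2)) = 0.
  apply/eqP; rewrite -sqrf_eq0 -[T in T / 2]addr0.
  by rewrite -(ip_mid ipP L1P eU TTT T00) z.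
have T2 : 0 <= T / 2 by rewrite divr_ge0// ltW.
have T2T : T / 2 <= T by rewrite ler_pdivrMr// ler_peMr ?ler1n// ltW.
have eU' := evolution_sub (lexx 0) T2T eU.
have zz : (0 : R) <= 0 <= T / 2 by rewrite lexx.
have n0 := backward_uniqueness ipP L1P eU' T2 half zz.
have := nrmB ipP (U 0) (U 0 - (Psi - Theta)); rewrite n0 U0 addr0.
rewrite opprB addrC subrK => le0; apply/eqP; rewrite eq_le le0; exact: nrm_ge0.
Qed.

(** If the two resolvents of [psi] coincide as [Psi], the operators agree at
[Psi], and the pairing of their difference with [Psi] is the integral of [rho
(W1 - W2) Psi ^ 2]. *)
Lemma obstructed_gain : (forall x, Omega x -> W2 x <= W1 x) -> nrm ip (Psi - Theta) = 0 ->
  {ae mu, forall x, Omega x -> (W1 x - W2 x) * (L2_fun Psi x * L2_fun Psi x) = 0}.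
Proof.
move=> W12 E.
pose q x := (W1 x - W2 x) * L2_fun Psi x.
have q2 : inL2 q.
  apply: (inL2_bddM (C := Wm)); [exact: measurable_funB| |exact: L2_inL2].
  move=> x Ox; have /andP[h1 h2] := W1P Ox; have /andP[h3 h4] := W2P Ox.
  rewrite ger0_norm; last by rewrite subr_ge0; exact: W12.
  by rewrite lerBlDr (le_trans h2)// lerDl.
have P1 : L1 Psi (psi - 1 *: Psi + toL2 q).
  apply: sturm_liouville_change (resolvent_shift PsiE) _; apply: aeW => x _.
  by rewrite L2_funD toL2K.
have sym := op_sym L1P P1 (resolvent_shift ThetaE).
have r0 y : ip y Psi = ip y Theta.
  have : ip (Psi - Theta) y = 0 by exact: nrm0_ip.
  by rewrite (ipC ipP) (ipBr ipP) => /eqP; rewrite subr_eq0 => /eqP.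
have key : ip (toL2 q) Psi = 0.
  move: sym; rewrite -r0 (ipDl ipP) !(ipBl ipP) !(ipBr ipP) !(ipZl ipP) !(ipZr ipP) -r0.
  by rewrite [ip psi Psi](ipC ipP) => /eqP; rewrite addrC -subr_eq0 addrK => /eqP.
have In : intO (fun x => rho x * (L2_fun (toL2 q) x * L2_fun Psi x)).
  exact: (wip_int mrho rmin0 rhoP).
have nn x : Omega x -> 0 <= rho x * (L2_fun (toL2 q) x * L2_fun Psi x).
  move=> Ox; rewrite toL2K// /q; apply: mulr_ge0; first exact: ltW (rho_gt0 rmin0 rhoP Ox).
  by rewrite -mulrA -expr2; apply: mulr_ge0; [rewrite subr_ge0; exact: W12|exact: sqr_ge0].
have A := I_eq0 In nn key.
apply: ae_imp A _ => x H Ox; have /eqP := H Ox.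
rewrite toL2K// /q /cst mulf_eq0 gt_eqF ?(rho_gt0 rmin0 rhoP Ox)//= -mulrA => /eqP.
exact.
Qed.

End Obstructed.

(** * Ill-posedness and the main result *)

Section NoSolution.
Context {R : realType}.
Local Notation mu := (@lebesgue_measure R).
Local Notation Omega := (@Omega R).
Local Notation X := (L2 R).
Local Notation RR := (measurableTypeR R * measurableTypeR R)%type.
Implicit Types (s t x : R).
Hint Resolve measurable_Omega measurable_cylinder : core.

(** The initial state is the difference of the two resolvents of the indicator
of an interval [[c, d]] where the gain vanishes. If a solution existed the gain
would vanish wherever the resolvent [Psi] does not, that is off [[c, d]], and
therefore almost everywhere. *)
Lemma no_solution (T nu kappa c0 d0 : R) (a K : R -> R) :
  0 < T -> 0 < nu -> 0 < kappa -> inLinf a -> inLinf K ->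
  {ae mu, forall x, Omega x -> 0 <= K x} -> ~ ae_eq mu Omega K (fun _ => 0) ->
  0 < c0 -> c0 < d0 -> d0 < 1 ->
  {ae mu, forall x, Omega x -> c0 < x < d0 -> K x = 0} ->
  exists2 u0 : R -> R, inL2 u0 & ~ exists u ut : R -> R -> R,
    bfn_solution T nu kappa a (fun _ x => K x) (fun _ _ => 0) u0 u ut.
Proof.
move=> T0 nu0 kappa0 ha [mK [Mk KM]] K0 Kn c00 cd d01 Kcd.
have [ma _] := ha; have [M [aa [maa aaM aaE]]] := inLinf_clip ha.
have aeK : {ae mu, forall x, Omega x -> 0 <= K x <= `|Mk|}.
  apply: ae_imp2 K0 KM _ => x H1 H2 Ox; rewrite (H1 Ox)/=.
  by rewrite (le_trans (ler_norm _))// (le_trans (H2 Ox))// ler_norm.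
have [Kh [mKh KhP KhE]] := clip_ae (normr_ge0 Mk) mK aeK.
pose rho := drift_weight nu aa.
pose C := I (fun x => `|- nu^-1 * aa x|).
have mrho : measurable_fun Omega rho := drift_weight_measurable nu maa aaM.
have mrhoV : measurable_fun Omega (fun x => (rho x)^-1) := drift_weightV_measurable nu maa aaM.
have rmin0 : 0 < expR (- C) := expR_gt0 _.
have rhoP x : Omega x -> expR (- C) <= rho x <= expR C := drift_weightP nu maa aaM (x := x).
(* a gauge for which the potential of the backward equation is nonnegative *)
pose m := kappa * `|Mk|.
have m0 : 0 <= m by rewrite mulr_ge0// ltW.
pose W1 x := m + Kh x; pose W2 x := m - kappa * Kh x.
have mW1 : measurable_fun Omega W1 by apply: measurable_funD.
have mW2 : measurable_fun Omega W2 by apply: measurable_funB => //; apply: measurable_funM.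
have Kb x : 0 <= Kh x /\ Kh x <= `|Mk| by have /andP[] := KhP x.
have W1P x : Omega x -> 0 <= W1 x <= m + `|Mk|.
  by move=> _; have [k1 k2] := Kb x; rewrite /W1 addr_ge0//= lerD2l.
have W2P x : Omega x -> 0 <= W2 x <= m + `|Mk|.
  move=> _; have [k1 k2] := Kb x; rewrite /W2 subr_ge0 /m ler_wpM2l ?(ltW kappa0)//=.
  by rewrite lerD2l (le_trans _ (normr_ge0 _))// oppr_le0 mulr_ge0// ltW.
have W12 x : Omega x -> W2 x <= W1 x.
  move=> _; have [k1 k2] := Kb x; rewrite /W1 /W2 lerD2l (le_trans _ k1)//.
  by rewrite oppr_le0 mulr_ge0// ltW.
have Khcd : {ae mu, forall x, Omega x -> c0 < x < d0 -> Kh x = 0}.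
  by apply: ae_imp2 KhE Kcd _ => x H1 H2 Ox xcd; rewrite -H1// H2.
have W1m : {ae mu, forall x, Omega x -> c0 < x < d0 -> W1 x = m}.
  by apply: ae_imp Khcd _ => x H Ox xcd; rewrite /W1 H// addr0.
have W2m : {ae mu, forall x, Omega x -> c0 < x < d0 -> W2 x = m}.
  by apply: ae_imp Khcd _ => x H Ox xcd; rewrite /W2 H// mulr0 subr0.
have [c [d [c0c cd' dd0]]] : exists c d : R, [/\ c0 < c, c < d & d < d0].
  by exists ((2 * c0 + d0) / 3), ((c0 + 2 * d0) / 3); split; lra.
have c_0 : 0 < c := lt_trans c00 c0c; have d_1 : d < 1 := lt_trans dd0 d01.
have ind2 : inL2 (\1_(`[c, d]%classic : set R)).
  apply: (inL2_bounded (C := 1)) => [|x _]; first exact: measurable_indic.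
  by rewrite indicE; case: (_ \in _); rewrite ?normr1 ?normr0.
pose psi : X := toL2 (\1_(`[c, d]%classic : set R)).
have psiE x : Omega x -> L2_fun psi x = \1_(`[c, d]%classic : set R) x by rewrite /psi toL2K.
have psiI : interval_test c0 d0 psi.
  exists c, d; split => //; rewrite /ae_eq.
  have N : {ae mu, forall x, x <> c}.
    exists [set c]; split => //; first exact: lebesgue_measure_set1.
    by move=> x /= H; apply: contrapT => xc; apply: H.
  apply: ae_imp N _ => x xc Ox; rewrite psiE// indicE mem_setE /= in_itv/= /slot.
  by rewrite le_eqVlt eq_sym; move/eqP/negbTE: xc => ->.
have mW21 : measurable_fun Omega (fun x => W2 x + 1) by apply: measurable_funD.
have mW11 : measurable_fun Omega (fun x => W1 x + 1) by apply: measurable_funD.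
have W21P x : Omega x -> 0 <= W2 x + 1 <= m + `|Mk| + 1.
  by move=> /W2P/andP[h1 h2]; rewrite addr_ge0//= lerD2r.
have W11P x : Omega x -> 0 <= W1 x + 1 <= m + `|Mk| + 1.
  by move=> /W1P/andP[h1 h2]; rewrite addr_ge0//= lerD2r.
have [Psi PsiE Psi0] := driven_nonvanishing mrho mrhoV rmin0 rhoP nu0 mW21 W21P c_0 cd' d_1 psiE.
have [Th ThE] := sturm_liouville_surj mrho mrhoV rmin0 rhoP nu0 mW11 W11P psi.
exists (L2_fun (Psi - Th)); first exact: L2_inL2.
move=> [u [ut [[su uu0] [sut utT]]]].
have so := (zero_observation T nu a).1.
pose z0 : R -> R := fun=> 0.
have z2 : inL2 z0 by exact: inL2_cst.
have sub0 (f : R -> R) : inL2 f -> forall x, L2_fun (toL2 f - toL2 z0) x = f x.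
  by move=> f2 x; rewrite L2_funB !toL2K// /z0 subr0.
pose U t : X := expR (- m * t) *: (toL2 (u t) - toL2 z0).
pose V t : X := expR (- m * t) *: (toL2 (ut t) - toL2 z0).
have mg1 : measurable_fun (cylinder 0 T) (fun z : RR => - K z.2).
  by apply: measurableT_comp => //; exact: cylinder_snd.
have mg2 : measurable_fun (cylinder 0 T) (fun z : RR => kappa * K z.2).
  by apply: measurable_funM => //; exact: cylinder_snd.
have mc1 : measurable_fun Omega (fun x => - Kh x) by exact: measurableT_comp.
have mc2 : measurable_fun Omega (fun x => kappa * Kh x) by exact: measurable_funM.
have cB1 x : Omega x -> `|- Kh x| <= `|Mk|.
  by move=> _; have [k1 k2] := Kb x; rewrite normrN ger0_norm.
have cB2 x : Omega x -> `|kappa * Kh x| <= kappa * `|Mk|.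
  move=> _; have [k1 k2] := Kb x; rewrite ger0_norm ?mulr_ge0 ?(ltW kappa0)//.
  by rewrite ler_wpM2l// ltW.
have aec := cylinder_ae 0 T KhE.
have gc1 : {ae leb2, forall z : RR, cylinder 0 T z -> - K z.2 = - Kh z.2}.
  by apply: ae_imp aec _ => z H /H ->.
have gc2 : {ae leb2, forall z : RR, cylinder 0 T z -> kappa * K z.2 = kappa * Kh z.2}.
  by apply: ae_imp aec _ => z H /H ->.
have WE1 : {ae mu, forall x, Omega x -> W1 x = m - - Kh x}.
  by apply: aeW => x _; rewrite opprK.
have WE2 : {ae mu, forall x, Omega x -> W2 x = m - kappa * Kh x} by exact: aeW.
have eU : evolution (wip rho) (sturm_liouville rho nu W1) 0 T U :=
  gauged_evolution (g := fun _ x => - K x) (ltW T0) nu0 ma maa aaM aaE su so mg1 (lexx 0) (lexx T) mc1 cB1 gc1 WE1.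
have eV : evolution (wip rho) (sturm_liouville rho nu W2) 0 T V :=
  gauged_evolution (g := fun _ x => kappa * K x) (ltW T0) nu0 ma maa aaM aaE sut so mg2 (lexx 0) (lexx T) mc2 cB2 gc2 WE2.
have [_ uc _] := su; have [_ utc _] := sut.
have TT : 0 <= T <= T by rewrite lexx ltW.
have OT : (0 : R) <= 0 <= T by rewrite lexx ltW.
have UV : nrm (wip rho) (V T - U T) = 0.
  apply: (nrm_ae mrho rmin0 rhoP); rewrite /ae_eq; apply: ae_imp utT _ => x H Ox.
  rewrite /U /V !L2_funZ !sub0; [|exact: uc.1|exact: utc.1].
  by rewrite (H Ox).
have U0 : nrm (wip rho) (U 0 - (Psi - Th)) = 0.
  apply: (nrm_ae mrho rmin0 rhoP); rewrite /ae_eq; apply: ae_imp uu0 _ => x H Ox.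
  rewrite /U L2_funZ sub0; last exact: uc.1.
  by rewrite (H Ox) mulr0 expR0 mul1r.
have E := obstructed_initial mrho mrhoV rmin0 rhoP nu0 (ltW c00) d01 mW1 mW2 W1P W2P W1m W2m
  psiI PsiE ThE T0 eU eV UV U0.
have key := obstructed_gain mrho mrhoV rmin0 rhoP nu0 mW1 mW2 W1P W2P PsiE ThE W12 E.
apply: Kn; rewrite /ae_eq.
have ends : {ae mu, forall x, x <> 0 /\ x <> 1}.
  have N y : {ae mu, forall x, x <> y}.
    exists [set y]; split => //; first exact: lebesgue_measure_set1.
    by move=> x /= H; apply: contrapT => xc; apply: H.
  by apply: ae_imp2 (N 0) (N 1) _.
have K1 : {ae mu, forall x, Omega x -> Kh x = 0}.
  apply: ae_imp2 key (ae_imp2 ends Khcd (fun x h1 h2 => conj h1 h2)) _ => x H1 [[x0 x1] H2] Ox.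
  have [xcd|xcd] := boolP (c <= x <= d).
    apply: H2 => //; move: xcd => /andP[h1 h2].
    by rewrite (lt_le_trans c0c h1) (le_lt_trans h2 dd0).
  have x01 : 0 < x < 1.
    by move: Ox => /OmegaP/andP[h1 h2]; rewrite !lt_neqAle h1 h2 !andbT eq_sym; apply/andP; split; apply/eqP.
  have P0 := Psi0 x x01 xcd.
  have /eqP := H1 Ox; rewrite mulf_eq0 => /orP[|]; last first.
    by rewrite -expr2 sqrf_eq0 => /eqP.
  rewrite /W1 /W2 (_ : m + Kh x - (m - kappa * Kh x) = (1 + kappa) * Kh x); last by ring.
  by rewrite mulf_eq0 => /orP[|/eqP //]; rewrite gt_eqF// addr_gt0.
by apply: ae_imp2 KhE K1 _ => x h1 h2 Ox; rewrite h1// h2.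
Qed.

End NoSolution.

Theorem theorem1 (R : realType) (T nu kappa : R) (a : R -> R)
    (hT : 0 < T) (hnu : 0 < nu) (hkappa : 0 < kappa) (ha : inW1inf a) :
  (* 1. constant gain *)
  (forall (k : R) (u0 uobs0 : R -> R) (uobs u ut : R -> R -> R),
     0 <= k -> inL2 u0 -> inL2 uobs0 ->
     observation T nu a uobs0 uobs ->
     bfn_solution T nu kappa a (fun _ _ => k) uobs u0 u ut ->
     let w := fun t x => u t x - uobs t x in
     let wt := fun t x => ut t x - uobs t x in
     forall t : R, 0 <= t <= T ->
       ae_eq (@lebesgue_measure R) Omega (wt t)
         (fun x => expR ((- k - kappa * k) * (T - t)) * w t x)) /\
  (* 2. gain K(x), not almost everywhere zero, supported in [a1, b1] *)
  (forall (K : R -> R) (a1 b1 : R),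
     inLinf K ->
     {ae @lebesgue_measure R, forall x, Omega x -> 0 <= K x} ->
     ~ ae_eq (@lebesgue_measure R) Omega K (fun _ => 0) ->
     0 <= a1 -> a1 < b1 -> b1 <= 1 -> a1 <> 0 \/ b1 <> 1 ->
     ess_support K `<=` `[a1, b1]%classic ->
     exists (u0 uobs0 : R -> R) (uobs : R -> R -> R),
       [/\ inL2 u0, inL2 uobs0, observation T nu a uobs0 uobs &
           ~ exists u ut : R -> R -> R,
               bfn_solution T nu kappa a (fun _ x => K x) uobs u0 u ut]) /\
  (* 3. gain constant on a time interval and zero outside it *)
  (forall (k t1 t2 : R) (u0 uobs0 : R -> R) (uobs u ut : R -> R -> R),
     0 < k -> 0 <= t1 -> t1 < t2 -> t2 <= T -> inL2 u0 -> inL2 uobs0 ->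
     observation T nu a uobs0 uobs ->
     bfn_solution T nu kappa a
       (fun t _ => k * \1_(`[t1, t2]%classic : set R) t) uobs u0 u ut ->
     let w := fun t x => u t x - uobs t x in
     let wt := fun t x => ut t x - uobs t x in
     ae_eq (@lebesgue_measure R) Omega (wt 0)
       (fun x => expR ((- k - kappa * k) * (t2 - t1)) * w 0 x)).
Proof.
have [hai _] := ha; split; [|split].
- move=> k u0 uobs0 uobs u ut _ _ _ so sb w wt t tP.
  exact: (constant_gain hT hnu hai so sb).
- move=> K a1 b1 hK K0 Kn a10 ab b11 ne sK.
  have [c [d [c0 cd d1 Kcd]]] := vanishing_interval a10 ab b11 ne sK.
  have [u0 u02 no] := no_solution hT hnu hkappa hai hK K0 Kn c0 cd d1 Kcd.
  exists u0, (fun=> 0), (fun _ _ => 0); split => //; first exact: inL2_cst.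
  exact: zero_observation.
- move=> k t1 t2 u0 uobs0 uobs u ut _ t10 t12 t2T _ _ so sb w wt.
  exact: (interval_gain hT hnu hai t10 t12 t2T so sb).
Qed.
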